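(* Let $\mathcal{H}=\mathcal{H}_{A'}\otimes\mathcal{H}_{B'}\otimes\mathcal{H}_{A''}\otimes\mathcal{H}_{B''}$ with each factor $\cong\mathbb{C}^2$. Let $\varrho$ be the set of density operators $\rho$ on $\mathcal{H}$ that commute with every unitary $U\otimes U\otimes V\otimes V$, where $U,V$ range over the Pauli group. Every such $\rho$ can be written uniquely as $\rho=\sum_{i,j=1}^4 [r]_{ij}\,\Pi_i\otimes\Pi_j$ with $[r]_{ij}\ge 0$ and $\sum_{i,j}[r]_{ij}=1$, where $\Pi_i\otimes\Pi_j$ means $\Pi_i$ acting on $\mathcal{H}_{A'}\otimes\mathcal{H}_{B'}$ and $\Pi_j$ acting on $\mathcal{H}_{A''}\otimes\mathcal{H}_{B''}$. Let $$D_0=\tfrac14\begin{pmatrix}1&0&0&0\\0&1&0&0\\0&0&1&0\\0&0&0&1\end{pmatrix},\qquad G_0=\tfrac14\begin{pmatrix}1&1&0&0\\1&1&0&0\\0&0&0&0\\0&0&0&0\end{pmatrix},$$ and let $\mathcal{P}_s$ be the set of states in $\varrho$ whose coefficient matrix $r$ lies in the convex hull of all $4\times4$ matrices obtained from $D_0$ or $G_0$ by independently permuting rows and/or columns. Then a state $\rho\in\varrho$ is separable with respect to the bipartition $\mathcal{H}_A=\mathcal{H}_{A'}\otimes\mathcal{H}_{A''}$ versus $\mathcal{H}_B=\mathcal{H}_{B'}\otimes\mathcal{H}_{B''}$ if and only if $\rho\in\mathcal{P}_s$.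
   Context: The Pauli group is the 16-element group of $2\times2$ unitaries generated by the Pauli matrices $\sigma_x,\sigma_y,\sigma_z$. The Bell basis of $\mathbb{C}^2\otimes\mathbb{C}^2$ is $|\Phi_{1,2}\rangle=\frac{1}{\sqrt2}(|00\rangle\pm|11\rangle)$, $|\Phi_{3,4}\rangle=\frac{1}{\sqrt2}(|01\rangle\pm|10\rangle)$, and $\Pi_i=|\Phi_i\rangle\langle\Phi_i|$. A state on $\mathcal{H}_A\otimes\mathcal{H}_B$ is separable if it is a convex combination of product states $\rho_A\otimes\rho_B$. *)

(* Defs.v *)
From HB Require Import structures.
From mathcomp Require Import all_boot all_order all_algebra all_fingroup.
From mathcomp Require Import reals.
From mathcomp.real_closed Require Import complex mxtens.

Set Implicit Arguments.
Unset Strict Implicit.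
Unset Printing Implicit Defensive.

Import Order.TTheory GRing.Theory Num.Theory.
Local Open Scope ring_scope.
Local Open Scope complex_scope.

Definition adjmx (R : realType) m n (A : 'M[R[i]]_(m, n)) : 'M[R[i]]_(n, m) :=
  (map_mx Num.conj A)^T.

Definition is_density (R : realType) n (M : 'M[R[i]]_n) : Prop :=
  [/\ adjmx M = M,
      (forall v : 'cV[R[i]]_n, 0 <= (adjmx v *m M *m v) 0 0)
    & \tr M = 1].

Definition mx2 (R : realType) (a b c d : R[i]) : 'M[R[i]]_2 :=
  \matrix_(i < 2, j < 2)
    if (i == 0 :> nat) then (if (j == 0 :> nat) then a else b)
    else (if (j == 0 :> nat) then c else d).

Definition sigma_x (R : realType) : 'M[R[i]]_2 := mx2 0 1 1 0.
Definition sigma_y (R : realType) : 'M[R[i]]_2 := mx2 0 (- 'i) 'i 0.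
Definition sigma_z (R : realType) : 'M[R[i]]_2 := mx2 1 0 0 (-1).

Definition pauli_group (R : realType) (U : 'M[R[i]]_2) : Prop :=
  exists (k : 'I_4) (P : 'M[R[i]]_2),
    (P = 1%:M \/ P = sigma_x R \/ P = sigma_y R \/ P = sigma_z R)
    /\ U = ('i ^+ k) *: P.

(* operators on H = H_A' (x) H_B' (x) H_A'' (x) H_B'' (Kronecker order) *)
Definition tens4 (R : realType) (U1 U2 U3 U4 : 'M[R[i]]_2)
  : 'M[R[i]]_(2 * 2 * 2 * 2) := ((U1 *t U2) *t U3) *t U4.

Definition in_varrho (R : realType) (rho : 'M[R[i]]_(2 * 2 * 2 * 2)) : Prop :=
  is_density rho /\
  forall U V : 'M[R[i]]_2, pauli_group U -> pauli_group V ->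
    tens4 U U V V *m rho = rho *m tens4 U U V V.

Definition ket (R : realType) (a : 'I_2) : 'cV[R[i]]_2 := delta_mx a 0.

(* unnormalised Bell vectors: index 0,1,2,3 <-> Phi_1,...,Phi_4 *)
Definition bell_vec (R : realType) (k : 'I_4) : 'cV[R[i]]_(2 * 2) :=
  let k0 := ket R 0 in let k1 := ket R 1 in
  match val k with
  | 0 => k0 *t k0 + k1 *t k1
  | 1 => k0 *t k0 - k1 *t k1
  | 2 => k0 *t k1 + k1 *t k0
  | _ => k0 *t k1 - k1 *t k0
  end.

(* Pi_k = |Phi_k><Phi_k| with |Phi_k> = bell_vec k / sqrt 2 *)
Definition bell_proj (R : realType) (k : 'I_4) : 'M[R[i]]_(2 * 2) :=
  2^-1 *: (bell_vec R k *m adjmx (bell_vec R k)).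

(* sum_{i,j} r_ij Pi_i (x) Pi_j ; Pi_i on A'B', Pi_j on A''B'' *)
Definition bell_state (R : realType) (r : 'M[R[i]]_4)
  : 'M[R[i]]_(2 * 2 * 2 * 2) :=
  \sum_(i < 4) \sum_(j < 4) r i j *: (bell_proj R i *t bell_proj R j).

Definition D0 (R : realType) : 'M[R[i]]_4 := 4^-1 *: 1%:M.
Definition G0 (R : realType) : 'M[R[i]]_4 :=
  \matrix_(i < 4, j < 4) if ((i < 2)%N && (j < 2)%N) then 4^-1 else 0.

Definition perm_generator (R : realType) (M : 'M[R[i]]_4) : Prop :=
  exists s t : 'S_4,
    M = \matrix_(i, j) D0 R (s i) (t j) \/ M = \matrix_(i, j) G0 R (s i) (t j).

Definition in_hull (R : realType) (r : 'M[R[i]]_4) : Prop :=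
  exists (n : nat) (w : 'I_n -> R[i]) (M : 'I_n -> 'M[R[i]]_4),
    [/\ forall k, 0 <= w k, \sum_(k < n) w k = 1,
        forall k, perm_generator (M k)
      & r = \sum_(k < n) w k *: M k].

Definition in_Ps (R : realType) (rho : 'M[R[i]]_(2 * 2 * 2 * 2)) : Prop :=
  in_varrho rho /\ exists r : 'M[R[i]]_4, rho = bell_state r /\ in_hull r.

Definition unidx4 (i : 'I_(2 * 2 * 2 * 2)) : 'I_2 * 'I_2 * 'I_2 * 'I_2 :=
  let (i3, d) := mxtens_unindex i in
  let (i2, c) := mxtens_unindex i3 in
  let (a, b) := mxtens_unindex i2 in (a, b, c, d).

(* X (x) Y with X on H_A = H_A' (x) H_A'' and Y on H_B = H_B' (x) H_B'',
   written as an operator on H_A' (x) H_B' (x) H_A'' (x) H_B'' *)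
Definition prodAB (R : realType) (X Y : 'M[R[i]]_(2 * 2))
  : 'M[R[i]]_(2 * 2 * 2 * 2) :=
  \matrix_(i, j)
    let: (a1, b1, a2, b2) := unidx4 i in
    let: (c1, d1, c2, d2) := unidx4 j in
    X (mxtens_index (a1, a2)) (mxtens_index (c1, c2)) *
    Y (mxtens_index (b1, b2)) (mxtens_index (d1, d2)).

Definition separable_AB (R : realType) (rho : 'M[R[i]]_(2 * 2 * 2 * 2)) : Prop :=
  exists (n : nat) (w : 'I_n -> R[i]) (X Y : 'I_n -> 'M[R[i]]_(2 * 2)),
    [/\ forall k, 0 <= w k, \sum_(k < n) w k = 1,
        forall k, is_density (X k) /\ is_density (Y k)
      & rho = \sum_(k < n) w k *: prodAB (X k) (Y k)].

(* Main.v *)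
(* Expand a separable state in the operators sigma_a (x) sigma_a (x) sigma_b (x) sigma_b: for a product
   state of A and B, the fifteen nontrivial coefficients are products of the Pauli expectations of
   the two factors, and they determine the weights r_ij by a sign transform. The sixty generators
   (permutations of D_0 and of G_0) become the signed commuting triples of two-qubit Paulis with sign
   product +1, that is, signed perfect matchings of K6. A pure two-qubit state has five squared
   expectations adding up to 1 on each set of five anticommuting ones and ten adding up to 2 on its
   complement, so Cauchy-Schwarz bounds the sums of absolute coefficients by 1 and 2; positivity of
   r and of its partial transpose gives 32 further inequalities. That these inequalities cut out
   exactly the convex hull of the sixty matchings is shown by peeling extreme rays off a
   separating functional, following a certificate of finitely many faces up to symmetry.
   Conversely, a matching is the equal mixture of four products of stabilizer states with
   correlated signs, hence separable. *)

From Stdlib Require Import BinNat.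
Require Import Defs.
From HB Require Import structures.
From mathcomp Require Import all_boot all_order all_algebra all_fingroup.
From mathcomp Require Import reals ring lra.
From mathcomp.real_closed Require Import complex mxtens.

Set Implicit Arguments.
Unset Strict Implicit.
Unset Printing Implicit Defensive.
Import Order.TTheory GRing.Theory Num.Theory.
Local Open Scope ring_scope.

(** * Signed perfect matchings of K6 *)

(** The sign product is +1 because three Paulis forming a matching multiply to 1 or to -1, but
    correlations belong to doubled operators, with one copy of the Pauli on each party, and doubling
    squares this sign away. So the eigenvalues of a matching on a Bell pair multiply to +1, which
    makes the indicator of a four-point plane an affine function of the signs of its three edges.
    There are six vertices because, modulo phases, the two-qubit Paulis form a four-dimensional
    symplectic space over the field with two elements, whose symmetry group is that of six points;
    phases contribute the switchings of signs. One certificate node thus serves a whole orbit.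
    Completeness of the inequalities is proved without listing the extreme points of the polytope
    that they cut out. An arbitrary functional nonnegative on the matchings is reduced, and the only
    case distinction is which matching turns tight first. A branch closes once the tight matchings
    span the sixteen-dimensional space of functionals, since then nothing of the functional is
    left. *)

(* The fifteen nontrivial two-qubit Pauli operators are the edges of the complete graph on these
   six vertices: two of them anticommute iff their edges share a vertex, so the commuting triples
   with product +-1 are the perfect matchings. *)
Definition vertices : seq nat := [:: 0; 1; 2; 3; 4; 5]%N.

Lemma vertices_ind (P : nat -> Prop) :
  P 0%N -> P 1%N -> P 2%N -> P 3%N -> P 4%N -> P 5%N -> forall v, v \in vertices -> P v.
Proof. by move=> P0 P1 P2 P3 P4 P5; do 6![case=> //]. Qed.

Definition sgn (K : pzRingType) (b : bool) : K := if b then -1 else 1.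
Arguments sgn {K} b.

Definition parity (s : nat -> bool) : bool := foldr addb false (map s vertices).

(* Entry [i] is the partner of vertex [i] together with the sign ([true] is -1) of their edge. *)
Definition matching := seq (nat * bool).
Definition partner (t : matching) (i : nat) : nat := (nth (0%N, false) t i).1.
Definition msign (t : matching) (i : nat) : bool := (nth (0%N, false) t i).2.

(* Twice the value at a signed matching, because every edge is met from both of its ends; the
   same factor 2 occurs in [pairing]. *)
Definition meval (K : pzRingType) (t : matching) (u0 : K) (u : nat -> nat -> K) : K :=
  u0 *+ 2 + \sum_(i <- vertices) sgn (msign t i) * u i (partner t i).

Definition pairing (K : pzRingType) (u0 : K) (u x : nat -> nat -> K) : K :=
  u0 *+ 2 + \sum_(i <- vertices) \sum_(j <- vertices | j != i) u i j * x i j.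

(* Relabelling the six vertices and switching signs. For odd [s] the extra global sign
   [parity s] is needed to preserve the matchings with sign product +1. *)
Definition relabel (K : pzRingType) (p : nat -> nat) (s : nat -> bool)
    (u : nat -> nat -> K) (i j : nat) : K :=
  sgn (parity s (+) s i (+) s j) * u (p i) (p j).

(* What Hadamard products of two pure-state correlation tables satisfy: Cauchy-Schwarz on the
   five edges at a vertex, Cauchy-Schwarz on the ten edges avoiding it (counted twice), and
   positivity of the Bell weights (odd [s]) and of their partial transposes (even [s]). *)
Definition correlations (R : realFieldType) (x : nat -> nat -> R) : Prop :=
  [/\ forall v, v \in vertices -> \sum_(j <- vertices | j != v) `|x v j| <= 1,
      forall v, v \in vertices ->
        \sum_(i <- vertices | i != v) \sum_(j <- vertices | (j != v) && (j != i)) `|x i j| <= 4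
    & forall s : nat -> bool,
        0 <= 2 + \sum_(i <- vertices) \sum_(j <- vertices | j != i)
                   sgn (parity s (+) s i (+) s j) * x i j].

Definition symmetric_table (K : Type) (u : nat -> nat -> K) : Prop :=
  forall i j, u i j = u j i.

Definition negative_edge (neg : seq nat) (i j : nat) : bool :=
  (6 * minn i j + maxn i j)%N \in neg.

(* The valid inequalities corresponding to the three clauses of [correlations]; the lists give the
   edges (coded by [negative_edge]) or vertices carrying a minus sign. *)
Inductive facet := Star of nat & seq nat | Five of nat & seq nat | Switch of seq nat.

(** Bounds per unordered edge: the 4 in [correlations] counts each of the ten edges twice, hence 2
    here, while the sum over a star meets each edge once. *)
Definition facet_const (f : facet) : int :=
  if f is Five _ _ then Posz 2 else Posz 1.

Definition facet_coef (f : facet) (i j : nat) : int :=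
  match f with
  | Star v neg =>
      if (i == v) || (j == v) then sgn (negative_edge neg i j) else Posz 0
  | Five v neg =>
      if (i == v) || (j == v) then Posz 0 else sgn (negative_edge neg i j)
  | Switch neg =>
      let s := fun v => v \in neg in sgn (parity s (+) s i (+) s j)
  end.

Definition facet_wf (f : facet) : bool :=
  match f with Star v _ | Five v _ => v \in vertices | Switch _ => true end.

(* Written with the raw integer operations, so that the kernel evaluates it cheaply. *)
Definition facet_eval (f : facet) (t : matching) : int :=
  foldr (fun i z => intZmod.addz z (if msign t i then intZmod.oppz (facet_coef f i (partner t i))
                                         else facet_coef f i (partner t i)))
        (intZmod.addz (facet_const f) (facet_const f)) vertices.

Lemma facet_evalE (R : realFieldType) (f : facet) (t : matching) :
  (facet_eval f t)%:~R =
  meval t ((facet_const f)%:~R : R) (fun i j => (facet_coef f i j)%:~R).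
Proof.
rewrite /meval /facet_eval.
have -> : (facet_const f)%:~R *+ 2 = (intZmod.addz (facet_const f) (facet_const f))%:~R :> R.
  by rewrite -[intZmod.addz _ _]/(facet_const f + facet_const f) rmorphD.
elim: vertices => [|i l IH]; first by rewrite big_nil addr0.
rewrite big_cons [foldr _ _ _]/=.
set z := foldr _ _ l in IH *; set c := if _ then _ else _.
rewrite -[intZmod.addz z c]/(z + c) rmorphD /= IH -addrA; congr (_ + _); rewrite addrC; congr (_ + _).
rewrite /c /sgn; case: (msign t i); rewrite ?mul1r ?mulN1r //.
exact: rmorphN.
Qed.

Lemma sgnM (K : pzRingType) (a b : bool) : sgn (a (+) b) = sgn a * sgn b :> K.
Proof. by case: a; case: b; rewrite /sgn /= ?mulr1 ?mul1r ?mulN1r ?opprK. Qed.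

Lemma sgn_sq (K : pzRingType) (a : bool) : sgn a * sgn a = 1 :> K.
Proof. by rewrite -sgnM addbb. Qed.

Lemma sgnR (R : realFieldType) b : (sgn b)%:~R = sgn b :> R.
Proof. by case: b; rewrite /sgn ?rmorphN ?rmorph1. Qed.

Lemma sgn_ler_norm (R : realFieldType) b (y : R) : - `|y| <= sgn b * y.
Proof. by case: b; rewrite /sgn ?mulN1r ?mul1r ?lerN2 ?ler_norm ?lerNnormlW. Qed.

Lemma normr_sgnM (R : realFieldType) b (y : R) : `|sgn b * y| = `|y|.
Proof. by case: b; rewrite /sgn ?mulN1r ?mul1r ?normrN. Qed.

Lemma facet_sym f : symmetric_table (facet_coef f).
Proof.
case: f => [v neg|v neg|neg] i j; rewrite /facet_coef /negative_edge 1?minnC 1?maxnC 1?orbC //.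
by rewrite -!addbA (addbC (i \in _)).
Qed.

Lemma star_sum (K : comPzRingType) (y : nat -> nat -> K) v : v \in vertices ->
  \sum_(i <- vertices) \sum_(j <- vertices | j != i)
     (if i == v then y v j else if j == v then y v i else 0)
  = (\sum_(j <- vertices | j != v) y v j) *+ 2.
Proof. by move: v; apply: vertices_ind; rewrite unlock /=; ring. Qed.

Lemma five_sum (K : comPzRingType) (y : nat -> nat -> K) v :
  \sum_(i <- vertices) \sum_(j <- vertices | j != i)
     (if (i == v) || (j == v) then 0 else y i j)
  = \sum_(i <- vertices | i != v) \sum_(j <- vertices | (j != v) && (j != i)) y i j.
Proof.
rewrite [RHS]big_mkcond; apply: eq_bigr => i _; case: eqP => [_|_] /=.
  by rewrite big1.
by rewrite big_mkcondl; apply: eq_bigr => j _; rewrite if_neg.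
Qed.

(** Each signed term is at least minus its absolute value, so the first two clauses of
    [correlations] bound the whole sum. The star clause enters doubled, because [pairing] meets its
    edges from both ends. *)
Lemma facet_ge0 (R : realFieldType) (x : nat -> nat -> R) (f : facet) :
  symmetric_table x -> correlations x -> facet_wf f ->
  0 <= pairing (facet_const f)%:~R (fun i j => (facet_coef f i j)%:~R) x.
Proof.
move=> xsym [Hstar Hfive Hsgn]; rewrite /pairing.
case: f => [v neg|v neg|neg] /= vV.
- set S := \sum_(i <- vertices) _.
  have : - ((\sum_(j <- vertices | j != v) `|x v j|) *+ 2) <= S.
    rewrite -(star_sum (fun i j => `|x i j|)) // -sumrN; apply: ler_sum => i _.
    rewrite -sumrN; apply: ler_sum => j _.
    case: eqP => [->|_] /=; first by rewrite sgnR sgn_ler_norm.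
    case: eqP => [->|_]; first by rewrite sgnR (xsym v i) sgn_ler_norm.
    by rewrite mul0r oppr0.
  have := Hstar v vV; move: S (\sum_(j <- _ | _) _) => S T; rewrite rmorph1; lra.
- set S := \sum_(i <- vertices) _.
  have : - \sum_(i <- vertices | i != v) \sum_(j <- vertices | (j != v) && (j != i)) `|x i j| <= S.
    rewrite -(five_sum (fun i j => `|x i j|)) // -sumrN; apply: ler_sum => i _.
    rewrite -sumrN; apply: ler_sum => j _.
    by case: ifP => _; rewrite ?mul0r ?oppr0 // sgnR sgn_ler_norm.
  have := Hfive v vV; move: S (\sum_(i <- _ | i != v) _) => S T.
  have -> : (Posz 2)%:~R = 2 :> R by [].
  lra.
have := Hsgn (fun v => v \in neg); rewrite rmorph1.
congr (_ <= _ + _); apply: eq_bigr => i _; apply: eq_bigr => j _.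
by rewrite sgnR.
Qed.

Lemma meval_peel (R : realFieldType) (t : matching) (c u0 : R) u f :
  meval t (u0 - c * (facet_const f)%:~R) (fun i j => u i j - c * (facet_coef f i j)%:~R)
  = meval t u0 u - c * (facet_eval f t)%:~R.
Proof.
rewrite facet_evalE /meval mulrDr mulr_sumr opprD -sumrN addrACA -big_split /=.
rewrite mulrnBl -mulrnAr; congr (_ + _).
by apply: eq_bigr => i _; rewrite mulrBr; congr (_ - _); rewrite mulrCA.
Qed.

Lemma pairing_peel (R : realFieldType) (c u0 : R) u x f :
  pairing (u0 - c * (facet_const f)%:~R) (fun i j => u i j - c * (facet_coef f i j)%:~R) x
  = pairing u0 u x
    - c * pairing (facet_const f)%:~R (fun i j => (facet_coef f i j)%:~R) x.
Proof.
rewrite /pairing mulrDr mulr_sumr opprD -sumrN addrACA -big_split /=.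
rewrite mulrnBl -mulrnAr; congr (_ + _).
apply: eq_bigr => i _; rewrite mulr_sumr -sumrN -big_split /=.
by apply: eq_bigr => j _; rewrite mulrBl mulrA.
Qed.

(* Every functional [u] that vanishes on [E] and is nonnegative on [M] is nonnegative on all
   correlation tables. For [E = [::]] and [M] all signed matchings with sign product +1, this says
   by duality that correlation tables lie in the convex hull of these matchings. *)
Definition settled (R : realFieldType) (E M : seq matching) : Prop :=
  forall (x u : nat -> nat -> R) (u0 : R),
    symmetric_table x -> correlations x -> symmetric_table u ->
    {in E, forall t, meval t u0 u = 0} -> {in M, forall t, 0 <= meval t u0 u} ->
    0 <= pairing u0 u x.

(* Subtract from [u] the largest multiple of the facet [f] that keeps it nonnegative on [M]; then
   [u] vanishes on one more matching. *)
Lemma settled_peel (R : realFieldType) (E M : seq matching) (f : facet) :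
  facet_wf f -> all (fun t => facet_eval f t == 0) E ->
  has (fun t => 0 < facet_eval f t) M ->
  {in M, forall t, 0 < facet_eval f t -> settled R (t :: E) M} ->
  settled R E M.
Proof.
move=> fwf fE fM branch x u u0 xsym xcor usym uE uM.
pose ratio t := meval t u0 u / (facet_eval f t)%:~R.
(* Ratio test of the simplex method: among the matchings with positive facet value, the one that
   turns tight first. *)
have [t0 t0M [ft0 t0min]] : exists2 t0, t0 \in M & 0 < facet_eval f t0 /\
    {in M, forall t, 0 < facet_eval f t -> ratio t0 <= ratio t}.
  elim: M fM {branch uM} => //= t M IH; have [|ft] := boolP (has _ M).
    move=> /IH [t1 t1M [ft1 t1min]] _.
    have [ft|ft] := boolP ((0 < facet_eval f t) && (ratio t < ratio t1)).
      case/andP: ft => ft lt_t; exists t; rewrite ?mem_head //; split=> // s.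
      rewrite inE => /predU1P[-> //|sM fs]; apply: le_trans (t1min s sM fs).
      exact: ltW.
    exists t1; rewrite ?inE ?t1M ?orbT //; split=> // s.
    rewrite inE => /predU1P[-> fs|]; last exact: t1min.
    by move: ft; rewrite fs /= -leNgt.
  rewrite orbF => ft0; exists t; rewrite ?mem_head //; split=> // s.
  rewrite inE => /predU1P[-> //|sM fs].
  by case/hasP: ft; exists s.
pose c := ratio t0.
have c0 : 0 <= c by rewrite divr_ge0 ?uM // ler0z ltW.
have peelE t : meval t (u0 - c * (facet_const f)%:~R)
    (fun i j => u i j - c * (facet_coef f i j)%:~R) = meval t u0 u - c * (facet_eval f t)%:~R.
  exact: meval_peel.
have := branch t0 t0M ft0 x (fun i j => u i j - c * (facet_coef f i j)%:~R)
  (u0 - c * (facet_const f)%:~R) xsym xcor.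
rewrite pairing_peel => H.
have := mulr_ge0 c0 (facet_ge0 xsym xcor fwf).
suff : 0 <= pairing u0 u x - c * pairing (facet_const f)%:~R
    (fun i j => (facet_coef f i j)%:~R) x.
  by move=> h1 h2; have := addr_ge0 h1 h2; rewrite subrK.
apply: H => [i j|t|t tM].
- by rewrite usym facet_sym.
- rewrite inE peelE => /predU1P[->|tE].
    by rewrite divfK ?subrr // intr_eq0 gt_eqF.
  by rewrite uE // (eqP (allP fE _ tE)) mulr0 subrr.
(* Where the facet is positive, minimality of the ratio bounds the loss; elsewhere subtracting a
   nonnegative multiple cannot lower the value. *)
rewrite peelE subr_ge0; have [ft|] := ltP 0 (facet_eval f t).
  by rewrite -ler_pdivlMr ?ltr0z // t0min.
rewrite -(lerz0 R) => ft; apply: le_trans (uM t tM).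
exact: mulr_ge0_le0.
Qed.

(** * Symmetries: relabelling and switching *)

Definition carries (p : seq nat) (neg : seq nat) (t t' : matching) : bool :=
  let s := fun v => v \in neg in
  all (fun i => nth (0%N, false) t' (nth 0%N p i) ==
         (nth 0%N p (partner t i),
          msign t i (+) (parity s (+) s i (+) s (partner t i)))) vertices.

Lemma relabel_sym (K : pzRingType) p s (u : nat -> nat -> K) :
  symmetric_table u -> symmetric_table (relabel p s u).
Proof.
by move=> usym i j; rewrite /relabel usym -!addbA (addbC (s i)).
Qed.

Lemma big_relabel (K : nmodType) (p : seq nat) (F : nat -> K) :
  perm_eq p vertices -> \sum_(i <- vertices) F (nth 0%N p i) = \sum_(i <- vertices) F i.
Proof.
move=> pP; have E : map (nth 0%N p) vertices = p.
  by have := perm_size pP; case: p {pP} => [|? [|? [|? [|? [|? [|? []]]]]]].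
by rewrite -[RHS](perm_big _ pP) /= -[in RHS]E big_map.
Qed.

Lemma nth_relabel_inj (p : seq nat) : perm_eq p vertices -> {in vertices &, injective (nth 0%N p)}.
Proof.
move=> pP i j iV jV /eqP; rewrite nth_uniq ?(perm_uniq pP) ?(perm_size pP) //.
- by move/eqP.
- by move: i iV; apply: vertices_ind.
by move: j jV; apply: vertices_ind.
Qed.

Lemma big_relabel2 (K : nmodType) (p : seq nat) (F : nat -> nat -> K) :
  perm_eq p vertices ->
  \sum_(i <- vertices) \sum_(j <- vertices | j != i) F (nth 0%N p i) (nth 0%N p j)
  = \sum_(i <- vertices) \sum_(j <- vertices | j != i) F i j.
Proof.
move=> pP; rewrite -[RHS](big_relabel _ pP); apply: eq_big_seq => i iV.
rewrite [RHS]big_mkcond -[RHS](big_relabel _ pP) [LHS]big_mkcond; apply: eq_big_seq => j jV /=.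
by rewrite (inj_in_eq (nth_relabel_inj pP)).
Qed.

(** Matchings are pushed forward by the same action under which functionals are pulled back, so
    evaluation is invariant. *)
Lemma carries_meval (K : pzRingType) p neg t t' (u0 : K) u :
  perm_eq p vertices -> carries p neg t t' ->
  meval t u0 (relabel (nth 0%N p) (fun v => v \in neg) u) = meval t' u0 u.
Proof.
move=> pP /allP tt'; rewrite /meval -[in RHS](big_relabel _ pP); congr (_ + _).
apply: eq_big_seq => i iV; have /eqP E := tt' i iV.
by rewrite /relabel mulrA -sgnM /msign /partner E.
Qed.

Lemma pairing_relabel (R : realFieldType) p s (u0 : R) u x :
  perm_eq p vertices ->
  pairing u0 (relabel (nth 0%N p) s u) (relabel (nth 0%N p) s x) = pairing u0 u x.
Proof.
move=> pP; rewrite /pairing -[in RHS](big_relabel2 _ pP); congr (_ + _).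
apply: eq_bigr => i _; apply: eq_bigr => j _.
by rewrite /relabel mulrACA sgn_sq mul1r.
Qed.

Lemma parityE s : parity s = \big[addb/false]_(i <- vertices) s i.
Proof. by rewrite unlock. Qed.

(** Stars and their complements are permuted, and absolute values ignore the switching. The family
    of sign patterns is preserved because switchings compose. *)
Lemma correlations_relabel (R : realFieldType) (p : seq nat) s (x : nat -> nat -> R) :
  perm_eq p vertices -> correlations x -> correlations (relabel (nth 0%N p) s x).
Proof.
move=> pP [Hstar Hfive Hsgn].
have pV i : i \in vertices -> nth 0%N p i \in vertices.
  by move=> iV; rewrite -(perm_mem pP) mem_nth // (perm_size pP); move: i iV; apply: vertices_ind.
have pI := inj_in_eq (nth_relabel_inj pP).
have idx i : i \in vertices -> index (nth 0%N p i) p = i.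
  move=> iV; rewrite index_uniq ?(perm_uniq pP) // (perm_size pP).
  by move: i iV; apply: vertices_ind.
split=> [v vV|v vV|s'].
- apply: le_trans (Hstar _ (pV v vV)); rewrite le_eqVlt; apply/orP; left; apply/eqP.
  rewrite [RHS]big_mkcond -[RHS](big_relabel _ pP) [LHS]big_mkcond.
  apply: eq_big_seq => j jV /=; rewrite pI //.
  by rewrite /relabel normr_sgnM.
- apply: le_trans (Hfive _ (pV v vV)); rewrite le_eqVlt; apply/orP; left; apply/eqP.
  rewrite [RHS]big_mkcond -[RHS](big_relabel _ pP) [LHS]big_mkcond.
  apply: eq_big_seq => i iV /=; rewrite pI //; case: ifP => // _.
  rewrite [RHS]big_mkcond -[RHS](big_relabel _ pP) [LHS]big_mkcond.
  apply: eq_big_seq => j jV /=; rewrite !pI //.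
  by rewrite /relabel normr_sgnM.
(* The composite of [s'] and [s], carried to the new vertex names by the inverse [index _ p] of the
   relabelling. Parity is additive, so the sign tables multiply. *)
pose s2 k := s' (index k p) (+) s (index k p).
have ps2 : parity s2 = parity s' (+) parity s.
  rewrite !parityE -big_split /= -[LHS](perm_big _ pP) /=.
  have E : map (nth 0%N p) vertices = p.
    by have := perm_size pP; case: p {pP pV pI idx s2} => [|? [|? [|? [|? [|? [|? []]]]]]].
  rewrite -[in LHS]E big_map big_seq [RHS]big_seq.
  by apply: eq_bigr => i iV; rewrite /s2 idx.
apply: le_trans (Hsgn s2) _; rewrite -[in leLHS](big_relabel2 _ pP) le_eqVlt.
apply/orP; left; apply/eqP; congr (_ + _).
apply: eq_big_seq => i iV; rewrite big_seq_cond [RHS]big_seq_cond.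
apply: eq_bigr => j /andP[jV _].
rewrite /relabel mulrA -sgnM ps2 /s2 !idx //; congr (sgn _ * _).
by case: (parity s'); case: (parity s); case: (s' i); case: (s i); case: (s' j); case: (s j).
Qed.

(** Further vanishing or nonnegativity conditions only help, so it is enough that the images of [E']
    and [M'] lie in [E] and [M]; they may be proper subsets. *)
Lemma settled_relabel (R : realFieldType) (p neg : seq nat) (E M E' M' : seq matching) :
  perm_eq p vertices ->
  all (fun t => has (carries p neg t) E) E' -> all (fun t => has (carries p neg t) M) M' ->
  settled R E' M' -> settled R E M.
Proof.
move=> pP /allP EE /allP MM H x u u0 xsym xcor usym uE uM.
rewrite -(pairing_relabel (fun v => v \in neg) u0 u x pP); apply: H.
- exact: relabel_sym.
- exact: correlations_relabel.
- exact: relabel_sym.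
- by move=> t /EE /hasP[t' t'E tt']; rewrite (carries_meval _ _ pP tt'); apply: uE.
by move=> t /MM /hasP[t' t'M tt']; rewrite (carries_meval _ _ pP tt'); apply: uM.
Qed.

(** * Exact rank test over the integers *)

Definition dot (K : pzRingType) (a b : seq K) : K :=
  foldr (fun ab z => ab.1 * ab.2 + z) 0 (zip a b).

Definition row_comb (c : int) (r : seq int) (d : int) (r' : seq int) : seq int :=
  map (fun ab => intZmod.addz (intRing.mulz c ab.1) (intRing.mulz d ab.2)) (zip r r').

(** The row [r] is cleared of its first unknown by the pivot row [a :: p]. When its head is [a] or
    the opposite of [a], the rows are subtracted or added unscaled ([Negz 0] is -1), so entries stay
    small. *)
Definition eliminate (a : int) (p r : seq int) : seq int :=
  let h := head (Posz 0) r in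
  if h == Posz 0 then behead r
  else if h == a then row_comb (Posz 1) (behead r) (Negz 0) p
  else if h == intZmod.oppz a then row_comb (Posz 1) (behead r) (Posz 1) p
  else row_comb a (behead r) (intZmod.oppz h) p.

(* Gaussian elimination; unit pivots are preferred to keep the (unary) integers small. *)
Fixpoint full_rank (n : nat) (rows : seq (seq int)) : bool :=
  if n is n'.+1 then
    let pivots := filter (fun r => absz (head (Posz 0) r) == 1%N) rows ++
                  filter (fun r => head (Posz 0) r != Posz 0) rows in
    if pivots is (a :: p) :: _ then full_rank n' (map (eliminate a p) rows) else false
  else true.

Definition intr_row (R : pzRingType) (r : seq int) : seq R := map intr r.

Lemma dot_row_comb (R : realFieldType) c r d r' (b : seq R) :
  size r = size b -> size r' = size b ->
  dot (intr_row R (row_comb c r d r')) b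
  = c%:~R * dot (intr_row R r) b + d%:~R * dot (intr_row R r') b.
Proof.
rewrite /dot; elim: b r r' => [|y b IH] [|m r] [|m' r'] //=.
  by rewrite !mulr0 addr0.
move=> [sr] [sr']; rewrite IH //.
rewrite -[intZmod.addz _ _]/(c * m + d * m') rmorphD !rmorphM /=; ring.
Qed.

(** Every reduced row is a consequence of the equations in which [y] cancels, so induction makes all
    of [b] zero; the pivot equation then reads [a * y = 0] with [a] nonzero. *)
Lemma full_rankP (R : realFieldType) n rows (b : seq R) :
  size b = n -> all (fun r => size r == n) rows -> full_rank n rows ->
  {in rows, forall r, dot (intr_row R r) b = 0} -> all (fun y => y == 0) b.
Proof.
elim: n rows b => [|n IH] rows [|y b] //= [sb] /allP srows.
case E : (_ ++ _) => [|[|a p] ?] //= fr H0.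
have : (a :: p) \in rows /\ a != 0.
  have : (a :: p) \in filter (fun r => absz (head (Posz 0) r) == 1%N) rows ++
                  filter (fun r => head (Posz 0) r != Posz 0) rows by rewrite E mem_head.
  rewrite mem_cat !mem_filter -andb_orl => /andP[] /orP[] /= Ha ->; split=> //.
  by rewrite -absz_eq0 (eqP Ha).
have dotc m r : dot (intr_row R (m :: r)) (y :: b) = m%:~R * y + dot (intr_row R r) b by [].
case=> prows a0; have /eqP[sp] := srows _ prows.
have := H0 _ prows; rewrite dotc => Hp.
have b0 : all (fun y => y == 0) b.
  apply: IH fr _ => //.
    apply/allP => _ /mapP[r rrows ->]; have := srows _ rrows; case: r {rrows} => //= m r /eqP[sr].
    rewrite /eliminate /=; case: ifP => _; first by rewrite sr.
    by do 2?[case: ifP => _]; rewrite /row_comb ?size_map ?size_zip ?sr ?sp ?minnn.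
  move=> _ /mapP[r rrows ->]; have := H0 _ rrows; have := srows _ rrows.
  case: r {rrows} => //= m r /eqP[sr]; rewrite dotc => Hr.
  rewrite /eliminate /=; case: eqP => [m0|_]; first by move: Hr; rewrite m0 mul0r add0r.
  case: eqP => [ma|_].
    by rewrite dot_row_comb ?sr ?sp // -[Negz 0]/(- 1 : int) rmorphN rmorph1; move: Hr; rewrite ma; lra.
  case: eqP => [ma|_].
    rewrite dot_row_comb ?sr ?sp // rmorph1; move: Hr; rewrite ma.
    rewrite -[intZmod.oppz a]/(- a) rmorphN; lra.
  rewrite dot_row_comb ?sr ?sp // -[intZmod.oppz m]/(- m) rmorphN.
  move: Hp Hr; set A := a%:~R; set B := m%:~R; set C := dot _ _; set D := dot _ _ => Hp Hr.
  have -> : A * D + - B * C = A * (B * y + D) - B * (A * y + C) by ring.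
  by rewrite Hp Hr !mulr0 subrr.
rewrite b0 andbT; move: Hp.
suff -> : dot (intr_row R p) b = 0.
  by rewrite addr0 => /eqP; rewrite mulf_eq0 intr_eq0 (negPf a0).
rewrite /dot; elim: b p b0 {IH sb sp E prows fr H0 dotc} => [|z b IHb] [|m p] //= /andP[/eqP -> b0].
by rewrite mulr0 add0r IHb.
Qed.

Definition edges : seq (nat * nat) :=
  [seq e <- [seq (i, j) | i <- vertices, j <- vertices] | (e.1 < e.2)%N].

(** The coordinates are the fifteen edge coefficients and, last, the constant term; hence the 16 in
    [spanning]. *)
Definition matching_row (t : matching) : seq int :=
  rcons [seq if partner t e.1 == e.2 then sgn (msign t e.1) else Posz 0 | e <- edges] (Posz 1).

(** [matching_row] reads an edge at its smaller end only, [meval] at both ends. A fixed-point-free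
    involution with equal signs at both ends makes them agree up to the factor 2. *)
Definition matching_wf (t : matching) : bool :=
  all (fun i => let j := partner t i in
         [&& (j < 6)%N, j != i, partner t j == i & msign t j == msign t i]) vertices.

Definition spanning (E : seq matching) : bool :=
  all matching_wf E && full_rank 16 (map matching_row E).

Lemma dot_rcons (K : pzRingType) (a b : seq K) x y :
  size a = size b -> dot (rcons a x) (rcons b y) = dot a b + x * y.
Proof.
rewrite /dot; elim: a b => [|u a IH] [|v b] //=; first by rewrite addr0 add0r.
by move=> [sab]; rewrite IH // addrA.
Qed.

Lemma dot_map (K : pzRingType) (T : Type) (f g : T -> K) (r : seq T) :
  dot (map f r) (map g r) = \sum_(e <- r) f e * g e.
Proof. by elim: r => [|e r IH]; rewrite ?big_nil // big_cons -IH. Qed.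

Lemma edges_sum (K : comPzRingType) (y : nat -> nat -> K) :
  {in vertices &, forall i j, y i j = y j i} -> {in vertices, forall i, y i i = 0} ->
  \sum_(i <- vertices) \sum_(j <- vertices) y i j = (\sum_(e <- edges) y e.1 e.2) *+ 2.
Proof.
move=> ysym y0; rewrite unlock /=.
rewrite !(ysym 1%N 0%N, ysym 2%N 0%N, ysym 3%N 0%N, ysym 4%N 0%N, ysym 5%N 0%N) //.
rewrite !(ysym 2%N 1%N, ysym 3%N 1%N, ysym 4%N 1%N, ysym 5%N 1%N) //.
rewrite !(ysym 3%N 2%N, ysym 4%N 2%N, ysym 5%N 2%N, ysym 4%N 3%N, ysym 5%N 3%N, ysym 5%N 4%N) //.
rewrite !y0 //; ring.
Qed.

Lemma meval_row (R : realFieldType) t (u0 : R) u :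
  symmetric_table u -> matching_wf t ->
  meval t u0 u = dot (intr_row R (matching_row t)) (rcons [seq u e.1 e.2 | e <- edges] u0) *+ 2.
Proof.
move=> usym /allP wf.
rewrite /matching_row /intr_row map_rcons dot_rcons ?size_map // rmorph1 mul1r.
rewrite mulrnDl /meval [RHS]addrC; congr (_ + _).
rewrite -map_comp dot_map /comp.
pose c i j : R := if partner t i == j then sgn (msign t i) else 0.
have -> : \sum_(e <- edges) (if partner t e.1 == e.2 then sgn (msign t e.1) else Posz 0)%:~R
      * u e.1 e.2 = \sum_(e <- edges) c e.1 e.2 * u e.1 e.2.
  by apply: eq_bigr => e _; rewrite /c; case: ifP => _; rewrite ?sgnR.
rewrite -(edges_sum (y := fun i j => c i j * u i j)).
- apply: eq_big_seq => i iV; have /and4P[q6 _ _ _] := wf i iV.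
  have qV : partner t i \in vertices.
    by move: q6; case: (partner t i) => [|[|[|[|[|[|?]]]]]].
  rewrite (bigD1_seq (partner t i)) //= /c eqxx big1 ?addr0 // => j /negPf.
  by rewrite eq_sym => ->; rewrite mul0r.
- move=> i j iV jV /=; rewrite usym; congr (_ * _); rewrite /c.
  have /and4P[_ _ /eqP qi /eqP bi] := wf i iV.
  have /and4P[_ _ /eqP qj /eqP bj] := wf j jV.
  case: eqP => [E|NE]; first by rewrite -E qi eqxx bi.
  by case: eqP => // E; case: NE; rewrite -E qj.
move=> i iV /=; have /and4P[_ /negPf qi _ _] := wf i iV.
by rewrite /c qi mul0r.
Qed.

(** A leaf of the search: the values on [E] determine the functional, so it is zero off the diagonal
    and the pairing is 0. *)
Lemma settled_spanning (R : realFieldType) E M : spanning E -> settled R E M.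
Proof.
case/andP => /allP wf fr x u u0 xsym xcor usym uE uM.
have [U [uU sU UE]] : exists U, [/\ forall t, t \in E ->
    dot (intr_row R (matching_row t)) U = 0, size U = 16%N
    & U = rcons [seq u e.1 e.2 | e <- edges] u0].
  exists (rcons [seq u e.1 e.2 | e <- edges] u0); split=> //.
  move=> t tE; have := uE t tE; rewrite (meval_row u0 usym (wf t tE)) => /eqP.
  by rewrite mulrn_eq0 /= => /eqP.
have : all (fun y => y == 0) U.
  apply: full_rankP sU _ fr _.
    by rewrite all_map; apply/allP.
  by move=> _ /mapP[t tE ->]; apply: uU.
rewrite UE all_rcons all_map => /andP[/eqP u00 /allP ue].
have uz : {in vertices &, forall i j, j != i -> u i j = 0}.
  move=> i j iV jV ji; wlog ij : i j iV jV ji / (i < j)%N.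
    have [lt_ij|lt_ji|E'] := ltngtP i j; first exact.
      by rewrite usym; apply; rewrite // eq_sym.
    by rewrite E' eqxx in ji.
  by apply/eqP/(ue (i, j)); rewrite mem_filter ij; apply/allpairsP; exists (i, j).
rewrite /pairing u00 mul0rn add0r big_seq big1 // => i iV.
by rewrite big_seq_cond big1 // => j /andP[jV ji]; rewrite uz ?mul0r.
Qed.

(* [Relabel k p neg] refers to the node verified [k.+1] steps earlier, transported by the
   relabelling [p] and the switching at [neg]. [Peel f cs] has one branch for each matching of [M],
   in order, on which [f] is positive. *)
Inductive certificate :=
  | Spanning
  | Relabel of nat & seq nat & seq nat
  | Peel of facet & seq certificate.

Definition node := (seq matching * seq matching)%type.

(** The inner [fix] keeps the recursion through the list of branches structural. Positivity is read
    off the constructor [Posz n.+1], so evaluation does not go through the order on integers. *)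
Fixpoint verify (known : seq node) (c : certificate) (E M : seq matching) : bool :=
  match c with
  | Spanning => spanning E
  | Relabel k p neg =>
      if drop k known is EM :: _ then
        [&& perm_eq p vertices, all (fun t => has (carries p neg t) E) EM.1
          & all (fun t => has (carries p neg t) M) EM.2]
      else false
  | Peel f cs =>
      let pos := filter (fun t => match facet_eval f t with Posz n.+1 => true | _ => false end) M in
      [&& facet_wf f, all (fun t => facet_eval f t == 0) E, pos != [::]
        & (fix branches (cs : seq certificate) (ts : seq matching) :=
             match cs, ts with
             | c :: cs', t :: ts' => verify known c (t :: E) M && branches cs' ts'
             | _, [::] => true
             | _, _ => false
             end) cs pos]
  end.

Lemma verifyP (R : realFieldType) known :
  (forall EM : node, EM \in known -> settled R EM.1 EM.2) ->
  forall c E M, verify known c E M -> settled R E M.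
Proof.
(* Certificates nest through [seq], so the recursion is on the term itself; [IH] is applied only to
   members of [cs]. *)
move=> Hknown; fix IH 1; case=> [|k p neg|f cs] E M.
- exact: settled_spanning.
- rewrite /=; case Dk: (drop k known) => [|EM ?] // /and3P[pP EE MM].
  apply: settled_relabel EE MM _ => //; apply: Hknown.
  by rewrite -(cat_take_drop k known) mem_cat Dk mem_head orbT.
rewrite /=.
have posE t : match facet_eval f t with Posz n.+1 => true | _ => false end = (0 < facet_eval f t).
  by case: (facet_eval f t) => [[]|].
rewrite (eq_filter posE); case/and4P => fwf fE fM branches.
apply: settled_peel fwf fE _ _; first by rewrite has_filter.
move=> t tM ft; have : t \in filter (fun t => 0 < facet_eval f t) M by rewrite mem_filter ft.
elim: cs (filter _ _) branches {fM} => [|c cs IHcs] [|t' ts] //= /andP[H Hs].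
rewrite inE => /predU1P[->|]; last exact: IHcs Hs.
exact: IH H.
Qed.

(** * The certificate as data *)

Fixpoint select (T : Type) (m : positive) (l : seq T) : seq T :=
  match m, l with
  | xI m', x :: l' => x :: select m' l'
  | xO m', _ :: l' => select m' l'
  | xH, x :: _ => [:: x]
  | _, [::] => [::]
  end.

(** A subset of the sixty matchings is coded by one number, whose binary digits, lowest first, tell
    which entries of the list are kept. *)
Definition masked (T : Type) (m : N) (l : seq T) : seq T :=
  if m is Npos p then select p l else [::].

Definition perfect_matchings : seq (seq nat) :=
  [:: [:: 1; 0; 3; 2; 5; 4]; [:: 1; 0; 4; 5; 2; 3]; [:: 1; 0; 5; 4; 3; 2];
      [:: 2; 3; 0; 1; 5; 4]; [:: 2; 4; 0; 5; 1; 3]; [:: 2; 5; 0; 4; 3; 1];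
      [:: 3; 2; 1; 0; 5; 4]; [:: 3; 4; 5; 0; 1; 2]; [:: 3; 5; 4; 0; 2; 1];
      [:: 4; 2; 1; 5; 0; 3]; [:: 4; 3; 5; 1; 0; 2]; [:: 4; 5; 3; 2; 0; 1];
      [:: 5; 2; 1; 4; 3; 0]; [:: 5; 3; 4; 1; 2; 0]; [:: 5; 4; 3; 2; 1; 0]]%N.

Definition bits6 : seq (seq bool) :=
  iter 6 (fun l => [seq b :: s | b <- [:: false; true], s <- l]) [:: [::]].

(* The sixty signed perfect matchings whose three signs have product +1. *)
Definition signed_matchings : seq matching :=
  flatten [seq [seq zip q s | s <- bits6 &
                 all (fun i => nth false s i == nth false s (nth 0%N q i)) vertices &&
                 ~~ odd (count id s)./2] | q <- perfect_matchings].

Fixpoint verify_all (known : seq node) (cs : seq (N * N * certificate)) : bool :=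
  if cs is (e, m, c) :: cs' then
    let E := masked e signed_matchings in
    let M := masked m signed_matchings in
    verify known c E M && verify_all ((E, M) :: known) cs'
  else if known is (E, _) :: _ then nilp E else false.

(** Later nodes may quote earlier ones, so the last node, at the head of [known], must be the root
    with no vanishing condition. Its [M] may be any part of [signed_matchings], since nonnegativity
    on more matchings is a stronger hypothesis. *)
Lemma verify_allP (R : realFieldType) known cs :
  (forall EM : node, EM \in known -> settled R EM.1 EM.2) ->
  (forall EM : node, EM \in known -> {subset EM.2 <= signed_matchings}) ->
  verify_all known cs -> settled R [::] signed_matchings.
Proof.
elim: cs known => [|[[e m] c] cs IH] known Hk Hs /=.
  case: known Hk Hs => [|[[|? ?] M] known] // Hk Hs _ x u u0 xs xc us uE uM.
  apply: (Hk ([::], M)); rewrite ?mem_head // => t tM; apply: uM.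
  by apply: (Hs ([::], M)); rewrite ?mem_head.
case/andP => H; apply: IH => EM; rewrite inE => /predU1P[->|]; try by [apply: Hk|apply: Hs].
  exact: verifyP Hk _ _ _ H.
move=> /= t; rewrite /masked; case: m {H} => //.
elim: signed_matchings => [|t' l IHl] [p|p|] //=; rewrite !inE.
- by case/predU1P=> [->|/IHl->]; rewrite ?eqxx ?orbT.
- by move/IHl ->; rewrite orbT.
by move/eqP ->; rewrite eqxx.
Qed.

(** Edge codes are those of [negative_edge]: 9 is the edge between 1 and 3, 22 the edge between 3
    and 4. The certificate quotes facets by their position here. *)
Definition peeling_facets : seq facet := [::
  Switch [:: 3]; Switch [:: 2; 4]; Switch [:: 1; 4];
  Star 3 [:: 9; 15; 22]; Switch [:: 2; 3]; Switch [:: 1; 2; 5];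
  Star 0 [:: 3; 4; 5]; Star 3 [:: 3; 9; 15; 22; 23]; Star 2 [:: 2; 8; 15; 16; 17];
  Five 3 [:: 2; 4; 5; 8; 11; 16; 17]; Star 5 [:: 5; 11; 17]; Switch [:: 1; 3; 4; 5];
  Star 1 [:: 1; 8; 11]; Switch [:: 1; 3]; Switch [:: 1; 2; 4];
  Star 2 [:: 2; 8; 16]; Switch [:: 5]; Star 1 [:: 8; 9; 11];
  Five 0 [:: 8; 9; 11; 15; 16; 17; 22]; Star 4 [:: 4; 16; 22]; Star 2 [:: 8; 15; 16];
  Five 4 [:: 3; 5; 8; 9; 11; 15; 23]; Star 0 [:: 1; 4; 5]; Star 1 [:: 1; 8; 9; 10; 11];
  Switch [:: 4; 5]; Star 3 [:: 3; 9; 22]; Switch [:: 3; 5];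
  Switch [:: 1]; Switch [:: 1; 2; 3; 4; 5]; Star 2 [:: 8; 16; 17];
  Switch [:: 4]; Switch [:: 2; 3; 4; 5]; Star 0 [:: 1; 2; 3; 4; 5];
  Star 0 [:: 2; 3; 4]; Star 1 [:: 8; 10; 11]; Switch [:: 1; 2; 3; 4];
  Star 3 [:: 3; 22; 23]; Star 5 [:: 5; 11; 17; 23; 29]; Five 3 [:: 4; 5; 8; 11; 16; 17; 29];
  Switch [:: 1; 5]; Switch [:: 1; 4; 5]; Five 2 [:: 3; 4; 5; 9; 11; 22; 23];
  Switch [:: 2]; Star 5 [:: 11; 17; 23]; Star 4 [:: 4; 10; 22];
  Switch [:: 3; 4; 5]; Switch [:: 1; 2; 3; 5]; Switch [:: 1; 3; 4];
  Switch [:: 1; 2]; Switch [:: 2; 3; 5]; Switch [:: 3; 4];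
  Five 5 [:: 3; 4; 8; 10; 15; 16; 22]; Star 2 [:: 2; 8; 17]; Star 0 [:: 1; 3; 4];
  Star 2 [:: 8; 15; 17]; Star 3 [:: 3; 15; 22]; Star 4 [:: 4; 10; 16; 22; 29];
  Star 5 [:: 11; 17; 29]; Five 0 [:: 8; 9; 10; 11; 17; 22; 23]; Switch [:: 2; 5];
  Five 0 [:: 8; 10; 11; 16; 22; 23; 29]; Star 1 [:: 1; 8; 10]; Star 4 [:: 10; 16; 22];
  Star 5 [:: 5; 11; 23]; Five 0 [:: 8; 9; 10; 11; 16; 17; 22]; Star 3 [:: 3; 9; 23];
  Five 0 [:: 8; 9; 10; 11; 15; 17; 22]; Switch [:: 1; 2; 4; 5]; Switch [:: 1; 3; 5];
  Star 4 [:: 4; 10; 16]; Star 2 [:: 2; 15; 17]; Star 4 [:: 10; 22; 29];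
  Switch [:: 1; 2; 3]; Star 2 [:: 2; 16; 17]; Five 1 [:: 2; 3; 4; 5; 17; 22; 29];
  Star 3 [:: 3; 15; 23]; Five 5 [:: 1; 2; 3; 4; 8; 9; 22]; Star 1 [:: 8; 9; 10];
  Five 0 [:: 8; 9; 10; 15; 17; 22; 23]; Star 5 [:: 5; 17; 23]; Five 5 [:: 3; 4; 8; 9; 10; 16; 22];
  Star 5 [:: 11; 23; 29]; Switch [:: 2; 4; 5]]%N.

(* Found by computer search: faces of the dual cone, up to relabelling, each preceded by those it
   refers to. The two numbers are the bit masks of [E] and [M] in [signed_matchings]. *)
Definition peeling : seq (N * N * certificate) :=
  let F := nth (Switch [::]) peeling_facets in [::
    (300357867929888%num, 76596378045775872%num, Peel (F 0) [:: Peel (F 1) [:: Peel (F 2) [:: Peel (F 3) [::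
    Spanning]]]]);
    (282652628240516%num, 22535590322896960%num, Peel (F 4) [:: Peel (F 5) [:: Peel (F 6) [:: Peel (F 7) [::
    Spanning]]]]);
    (282656646908036%num, 22535590322897920%num, Peel (F 4) [:: Peel (F 5) [:: Peel (F 6) [:: Peel (F 7) [::
    Spanning]]]]);
    (281548814295314%num, 189197638715965472%num, Peel (F 4) [:: Relabel 2 [:: 1; 5; 4; 0; 2; 3] [:: 1; 2; 4];
    Relabel 1 [:: 0; 1; 2; 3; 4; 5] [:: 1; 2]; Relabel 0 [:: 0; 1; 2; 3; 5; 4] [:: 1; 2]]);
    (282580999087172%num, 148645244701769728%num, Peel (F 4) [:: Peel (F 5) [:: Peel (F 8) [:: Peel (F 9) [::
    Peel (F 10) [:: Spanning]]]]]);
    (281548544811266%num, 189197638985449520%num, Peel (F 11) [:: Peel (F 5) [:: Peel (F 12) [:: Relabel 1 [::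
    0; 1; 2; 3; 4; 5] [::]; Relabel 0 [:: 1; 2; 0; 5; 4; 3] [:: 0; 1; 3; 4; 5]]]]);
    (282656646908036%num, 580981944116839424%num, Peel (F 4) [:: Peel (F 5) [:: Peel (F 6) [:: Peel (F 7) [::
    Spanning]]]]);
    (281548814360594%num, 190384836398023168%num, Peel (F 13) [:: Relabel 6 [:: 2; 4; 5; 0; 1; 3] [:: 1; 2;
    4]; Relabel 0 [:: 0; 2; 1; 3; 4; 5] [:: 1; 2]; Relabel 5 [:: 0; 2; 1; 3; 5; 4] [:: 1; 2]]);
    (281548544876562%num, 190384836667507200%num, Peel (F 14) [:: Peel (F 15) [:: Relabel 0 [:: 0; 1; 2; 3; 4;
    5] [::]; Relabel 3 [:: 2; 1; 0; 4; 5; 3] [:: 0; 1; 3; 4; 5]]]);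
    (282885941760289%num, 654147845875564544%num, Peel (F 0) [:: Peel (F 1) [:: Peel (F 2) [:: Peel (F 3) [::
    Spanning]]]]);
    (282652091893892%num, 22535590322897920%num, Peel (F 4) [:: Peel (F 5) [:: Peel (F 6) [:: Peel (F 7) [::
    Spanning]]]]);
    (282648065362052%num, 580981944116838464%num, Peel (F 4) [:: Peel (F 5) [:: Peel (F 6) [:: Peel (F 7) [::
    Spanning]]]]);
    (281552572457234%num, 442524842879615008%num, Peel (F 16) [:: Relabel 2 [:: 0; 1; 2; 3; 4; 5] [:: 3; 4];
    Relabel 1 [:: 0; 1; 2; 3; 5; 4] [:: 1; 2]; Relabel 0 [:: 0; 2; 1; 3; 5; 4] [:: 1; 2]]);
    (282580999087172%num, 148636723486654464%num, Peel (F 4) [:: Peel (F 5) [:: Peel (F 8) [:: Peel (F 9) [::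
    Peel (F 10) [:: Spanning]]]]]);
    (281548545345668%num, 653045310603395136%num, Peel (F 17) [:: Relabel 1 [:: 0; 2; 1; 3; 5; 4] [:: 1; 2];
    Relabel 0 [:: 1; 2; 0; 4; 5; 3] [:: 3; 4; 5]]);
    (282580999078212%num, 580982218994769920%num, Peel (F 4) [:: Peel (F 5) [:: Peel (F 18) [:: Peel (F 8) [::
    Peel (F 19) [:: Peel (F 10) [:: Spanning]]]]]]);
    (281548545345540%num, 653045310603395264%num, Peel (F 20) [:: Relabel 1 [:: 0; 1; 2; 3; 4; 5] [::];
    Relabel 0 [:: 5; 4; 3; 2; 1; 0] [::]]);
  (4802740362954884%num, 216177180160294912%num, Peel (F 6) [:: Peel (F 17) [:: Peel (F 21) [:: Spanning]]]);
  (4803853346161170%num, 216172782114832384%num, Peel (F 2) [:: Peel (F 22) [:: Peel (F 23) [:: Spanning]]]);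
    (282579060392264%num, 439206654240653312%num, Peel (F 24) [:: Peel (F 5) [:: Peel (F 25) [:: Peel (F 26)
    [:: Relabel 1 [:: 2; 4; 5; 0; 1; 3] [:: 0; 4]; Relabel 0 [:: 2; 4; 1; 5; 0; 3] [:: 1]]]]]);
    (281548544811026%num, 190393632760726272%num, Peel (F 11) [:: Relabel 11 [:: 0; 1; 2; 3; 4; 5] [::];
    Relabel 3 [:: 0; 1; 2; 3; 5; 4] [:: 1; 2]; Relabel 0 [:: 5; 4; 3; 1; 2; 0] [:: 0; 2; 4]]);
    (282574765687880%num, 148627652532551808%num, Peel (F 24) [:: Peel (F 26) [:: Peel (F 4) [:: Peel (F 27)
    [:: Peel (F 5) [:: Peel (F 28) [:: Peel (F 6) [:: Peel (F 29) [:: Spanning]]]]]]]]);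
    (300443768062305%num, 654147845875564544%num, Peel (F 0) [:: Peel (F 1) [:: Peel (F 2) [:: Peel (F 3) [::
    Spanning]]]]);
    (1407659175584290%num, 9009398278062096%num, Peel (F 16) [:: Peel (F 30) [:: Peel (F 31) [:: Peel (F 11)
    [:: Spanning]]]]);
    (300460947144993%num, 653021945985499136%num, Peel (F 0) [:: Peel (F 1) [:: Peel (F 2) [:: Peel (F 3) [::
    Spanning]]]]);
    (281548814295314%num, 190323263744901152%num, Peel (F 32) [:: Relabel 2 [:: 5; 2; 1; 3; 4; 0] [:: 3; 4];
    Relabel 1 [:: 0; 1; 2; 3; 4; 5] [:: 4; 5]; Relabel 0 [:: 4; 2; 1; 3; 5; 0] [:: 3; 4]]);
    (281548544811266%num, 190323264014385200%num, Peel (F 11) [:: Peel (F 5) [:: Peel (F 12) [:: Relabel 0 [::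
    0; 1; 2; 3; 4; 5] [::]; Relabel 21 [:: 1; 2; 0; 5; 4; 3] [:: 0; 1; 3; 4; 5]]]]);
    (68992188432%num, 384588298250618502%num, Peel (F 30) [:: Peel (F 13) [:: Relabel 21 [:: 3; 4; 1; 5; 2; 0]
    [:: 0; 1; 4]; Relabel 6 [:: 3; 1; 4; 5; 0; 2] [:: 0; 2; 5]; Relabel 5 [:: 4; 1; 3; 0; 2; 5] [:: 0; 1; 5];
    Relabel 0 [:: 1; 3; 5; 4; 2; 0] [::]]]);
    (4376%num, 475527344092151808%num, Peel (F 4) [:: Peel (F 27) [:: Relabel 0 [:: 0; 3; 1; 4; 2; 5] [:: 1;
    2; 3; 5]; Relabel 0 [:: 0; 3; 1; 5; 2; 4] [:: 1; 2; 3; 5]]]);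
    (276%num, 691752902713761792%num, Peel (F 28) [:: Relabel 0 [:: 0; 1; 2; 3; 4; 5] [:: 1; 2; 3]; Relabel 0
    [:: 0; 1; 3; 2; 4; 5] [:: 1; 2; 3]]);
    (73283938372%num, 324542847221039232%num, Peel (F 16) [:: Peel (F 24) [:: Peel (F 4) [:: Peel (F 31) [::
    Peel (F 27) [:: Peel (F 5) [:: Peel (F 33) [:: Peel (F 34) [:: Spanning]]]]]]]]);
    (300460948066592%num, 382805968326492160%num, Peel (F 0) [:: Peel (F 1) [:: Peel (F 2) [:: Peel (F 3) [::
    Spanning]]]]);
    (300460947935552%num, 94575592174780424%num, Peel (F 0) [:: Peel (F 1) [:: Peel (F 2) [:: Peel (F 3) [::
    Spanning]]]]);
    (73183777716838946%num, 708085488549888%num, Peel (F 16) [:: Peel (F 30) [:: Peel (F 31) [:: Peel (F 11)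
    [:: Spanning]]]]);
    (73585991954%num, 732172489517957120%num, Peel (F 35) [:: Peel (F 36) [:: Relabel 2 [:: 2; 4; 5; 0; 1; 3]
    [:: 1; 2; 4]; Relabel 1 [:: 1; 4; 5; 0; 2; 3] [:: 1; 2; 4]; Relabel 0 [:: 0; 1; 2; 3; 4; 5] [:: 4; 5]]]);
    (281548545345668%num, 654170935632330816%num, Peel (F 17) [:: Relabel 22 [:: 0; 1; 2; 3; 4; 5] [:: 1; 2];
    Relabel 21 [:: 1; 2; 0; 4; 5; 3] [:: 3; 4; 5]]);
    (282579073270792%num, 148689225166897280%num, Peel (F 26) [:: Peel (F 5) [:: Peel (F 28) [:: Peel (F 6)
    [:: Peel (F 29) [:: Peel (F 37) [:: Spanning]]]]]]);
    (73316508804%num, 911233455680915456%num, Peel (F 31) [:: Relabel 2 [:: 5; 2; 4; 3; 1; 0] [:: 1; 3; 4];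
    Relabel 1 [:: 3; 0; 1; 5; 2; 4] [:: 0; 2; 3; 4]; Relabel 0 [:: 0; 2; 3; 1; 4; 5] [:: 1; 2; 3; 5]]);
    (282578804835336%num, 148636451024666688%num, Peel (F 26) [:: Peel (F 5) [:: Peel (F 28) [:: Peel (F 6)
    [:: Peel (F 29) [:: Peel (F 38) [:: Peel (F 37) [:: Spanning]]]]]]]);
    (73282954372%num, 911233455714469888%num, Peel (F 34) [:: Relabel 1 [:: 0; 1; 2; 3; 4; 5] [::]; Relabel 0
    [:: 5; 2; 3; 4; 1; 0] [:: 0; 4]]);
    (285282592%num, 316778465425620995%num, Peel (F 39) [:: Peel (F 30) [:: Relabel 9 [:: 0; 2; 3; 1; 4; 5]
    [:: 1; 5]; Relabel 0 [:: 0; 2; 3; 1; 5; 4] [:: 1; 4]]]);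
    (77596799267%num, 10449758510383104%num, Peel (F 16) [:: Peel (F 30) [:: Peel (F 35) [:: Peel (F 32) [::
    Spanning]]]]);
    (286327872%num, 109520502111875084%num, Peel (F 0) [:: Peel (F 1) [:: Peel (F 28) [:: Peel (F 34) [:: Peel
    (F 8) [:: Peel (F 40) [:: Relabel 0 [:: 0; 1; 2; 3; 4; 5] [:: 2; 3; 4]; Relabel 0 [:: 0; 1; 2; 3; 5; 4]
    [:: 2; 3; 4]]]]]]]);
  (4803854491746561%num, 216172782113787904%num, Peel (F 2) [:: Peel (F 28) [:: Peel (F 22) [:: Spanning]]]);
  (300240260843652%num, 166633186212708352%num, Peel (F 5) [:: Peel (F 41) [:: Peel (F 7) [:: Spanning]]]);
    (68988977410%num, 306615331655319680%num, Peel (F 30) [:: Peel (F 24) [:: Peel (F 42) [:: Peel (F 13) [::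
    Peel (F 5) [:: Peel (F 43) [:: Peel (F 44) [:: Relabel 1 [:: 1; 0; 2; 3; 4; 5] [:: 0; 2; 3]; Relabel 0 [::
    2; 5; 0; 1; 3; 4] [:: 3]]]]]]]]);
    (16843010%num, 460895835613311024%num, Peel (F 45) [:: Peel (F 46) [:: Relabel 5 [:: 1; 0; 2; 4; 3; 5]
    [::]; Relabel 3 [:: 1; 0; 2; 4; 3; 5] [:: 2; 3; 4]; Relabel 0 [:: 5; 2; 4; 3; 0; 1] [:: 1; 2; 3]]]);
    (303055142%num, 90372451279831040%num, Peel (F 16) [:: Peel (F 30) [:: Peel (F 13) [:: Peel (F 47) [::
    Peel (F 48) [:: Peel (F 5) [:: Peel (F 44) [:: Peel (F 10) [:: Spanning]]]]]]]]);
    (282656663685252%num, 22570774694985728%num, Peel (F 4) [:: Peel (F 5) [:: Peel (F 6) [:: Peel (F 7) [::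
    Spanning]]]]);
    (300460947149088%num, 94575592174780424%num, Peel (F 0) [:: Peel (F 1) [:: Peel (F 2) [:: Peel (F 3) [::
    Spanning]]]]);
    (282652645017732%num, 148636379890319360%num, Peel (F 4) [:: Peel (F 5) [:: Peel (F 6) [:: Peel (F 7) [::
    Spanning]]]]);
    (69001036034%num, 334683655848853520%num, Peel (F 13) [:: Peel (F 11) [:: Peel (F 5) [:: Peel (F 24) [::
    Relabel 2 [:: 0; 1; 4; 2; 3; 5] [:: 1; 2; 3; 5]; Relabel 1 [:: 1; 3; 5; 0; 4; 2] [:: 1; 4; 5]; Relabel 0
    [:: 0; 1; 4; 2; 5; 3] [:: 1; 2; 3; 4]]]]]);
    (282656386336900%num, 22535590322896904%num, Peel (F 4) [:: Peel (F 5) [:: Peel (F 6) [:: Peel (F 7) [::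
    Spanning]]]]);
    (282648333797380%num, 581017128488927232%num, Peel (F 4) [:: Peel (F 5) [:: Peel (F 6) [:: Peel (F 7) [::
    Spanning]]]]);
    (282887014453537%num, 76596378045775872%num, Peel (F 0) [:: Peel (F 1) [:: Peel (F 2) [:: Peel (F 3) [::
    Spanning]]]]);
    (69000790274%num, 334717732119380016%num, Peel (F 13) [:: Peel (F 11) [:: Peel (F 5) [:: Peel (F 49) [::
    Relabel 2 [:: 0; 1; 4; 2; 3; 5] [:: 1; 2; 3; 5]; Relabel 1 [:: 0; 4; 1; 2; 3; 5] [:: 1; 2; 3; 5]; Relabel
    0 [:: 0; 1; 4; 2; 5; 3] [::]]]]]);
    (268505394%num, 312549245539319808%num, Peel (F 16) [:: Relabel 8 [:: 5; 3; 4; 2; 0; 1] [:: 1; 2; 3];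
    Relabel 4 [:: 1; 4; 0; 3; 5; 2] [:: 0; 1; 3; 4]; Relabel 0 [:: 0; 2; 1; 3; 5; 4] [:: 2; 5]]);
    (1172813382163%num, 6227642449723392%num, Peel (F 16) [:: Peel (F 30) [:: Peel (F 0) [:: Peel (F 11) [::
    Peel (F 35) [:: Peel (F 32) [:: Spanning]]]]]]);
    (81889665298%num, 442806317856326144%num, Peel (F 35) [:: Peel (F 4) [:: Relabel 57 [:: 1; 4; 5; 0; 2; 3]
    [:: 1; 2; 4]; Relabel 51 [:: 0; 1; 2; 3; 4; 5] [:: 1; 2]; Relabel 56 [:: 0; 1; 2; 3; 5; 4] [:: 1; 2]]]);
    (286331186%num, 451878671764946944%num, Peel (F 30) [:: Relabel 1 [:: 0; 1; 4; 2; 3; 5] [::]; Relabel 0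
    [:: 0; 2; 3; 1; 5; 4] [:: 1; 2; 3]]);
    (73299953732%num, 108387657251292160%num, Peel (F 50) [:: Peel (F 5) [:: Peel (F 14) [:: Peel (F 28) [::
    Peel (F 6) [:: Peel (F 34) [:: Peel (F 51) [:: Spanning]]]]]]]);
    (285282594%num, 451878671765995536%num, Peel (F 39) [:: Peel (F 52) [:: Relabel 1 [:: 0; 1; 2; 3; 4; 5]
    [::]; Relabel 0 [:: 0; 1; 3; 2; 4; 5] [:: 1; 2; 4; 5]]]);
    (68992385281%num, 91216584177090608%num, Peel (F 42) [:: Peel (F 49) [:: Peel (F 39) [:: Peel (F 13) [::
    Peel (F 11) [:: Peel (F 28) [:: Peel (F 53) [:: Peel (F 23) [:: Peel (F 54) [:: Spanning]]]]]]]]]);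
    (268505378%num, 456945908591886352%num, Peel (F 47) [:: Relabel 6 [:: 0; 1; 2; 3; 4; 5] [::]; Relabel 1
    [:: 0; 1; 2; 3; 4; 5] [::]; Relabel 0 [:: 0; 2; 1; 3; 5; 4] [:: 1; 3; 5]]);
    (286294336%num, 38588601822609417%num, Peel (F 0) [:: Peel (F 26) [:: Peel (F 1) [:: Peel (F 27) [:: Peel
    (F 5) [:: Peel (F 46) [:: Peel (F 28) [:: Peel (F 55) [:: Peel (F 56) [:: Peel (F 57) [::
    Spanning]]]]]]]]]]);
    (281787570983233%num, 114841790497947648%num, Peel (F 0) [:: Peel (F 1) [:: Peel (F 2) [:: Peel (F 3) [::
    Spanning]]]]);
    (282656403636356%num, 4521191813416192%num, Peel (F 4) [:: Peel (F 5) [:: Peel (F 6) [:: Peel (F 7) [::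
    Spanning]]]]);
    (282648342186116%num, 148636379890319360%num, Peel (F 4) [:: Peel (F 5) [:: Peel (F 6) [:: Peel (F 7) [::
    Spanning]]]]);
    (281557152636946%num, 157668318155639296%num, Peel (F 30) [:: Relabel 2 [:: 0; 1; 2; 3; 5; 4] [:: 3; 4];
    Relabel 1 [:: 0; 1; 2; 3; 4; 5] [:: 1; 2]; Relabel 0 [:: 0; 2; 1; 3; 4; 5] [:: 1; 2]]);
    (282580999087172%num, 148636448877182976%num, Peel (F 4) [:: Peel (F 5) [:: Peel (F 8) [:: Peel (F 9) [::
    Peel (F 10) [:: Spanning]]]]]);
    (286294400%num, 299868247170285577%num, Peel (F 42) [:: Peel (F 13) [:: Peel (F 35) [:: Peel (F 28) [::
    Peel (F 37) [:: Relabel 1 [:: 3; 0; 1; 4; 2; 5] [:: 2; 4]; Relabel 0 [:: 5; 2; 4; 0; 1; 3] [:: 0; 2; 4;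
    5]]]]]]);
    (268505346%num, 456945908591886384%num, Peel (F 4) [:: Relabel 7 [:: 0; 1; 2; 3; 4; 5] [::]; Relabel 6 [::
    5; 3; 4; 2; 0; 1] [::]; Relabel 0 [:: 4; 3; 5; 1; 0; 2] [:: 1; 3; 5]]);
    (268505106%num, 456664437909095168%num, Peel (F 46) [:: Relabel 31 [:: 1; 0; 3; 4; 2; 5] [::]; Relabel 26
    [:: 5; 3; 4; 2; 0; 1] [:: 1; 2; 3]; Relabel 29 [:: 1; 0; 3; 4; 2; 5] [:: 2; 3; 4]]);
    (68989043074%num, 306597735174242304%num, Peel (F 30) [:: Peel (F 24) [:: Peel (F 42) [:: Peel (F 4) [::
    Peel (F 13) [:: Peel (F 58) [:: Peel (F 44) [:: Peel (F 43) [:: Spanning]]]]]]]]);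
    (281549082820632%num, 396389334976038912%num, Peel (F 0) [:: Peel (F 42) [:: Peel (F 59) [:: Peel (F 28)
    [:: Peel (F 60) [:: Peel (F 56) [:: Spanning]]]]]]);
    (72076290317947425%num, 1688987332771840%num, Peel (F 16) [:: Peel (F 30) [:: Peel (F 0) [:: Peel (F 32)
    [:: Spanning]]]]);
    (76579954369761825%num, 1724042822287360%num, Peel (F 16) [:: Peel (F 30) [:: Peel (F 0) [:: Peel (F 32)
    [:: Spanning]]]]);
    (1172543967762%num, 456095015924531200%num, Peel (F 35) [:: Peel (F 30) [:: Relabel 1 [:: 0; 1; 4; 2; 3;
    5] [::]; Relabel 0 [:: 1; 0; 4; 2; 3; 5] [::]]]);
    (69005803810%num, 316715449662316544%num, Peel (F 35) [:: Peel (F 52) [:: Relabel 3 [:: 5; 4; 3; 2; 0; 1]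
    [::]; Relabel 0 [:: 1; 0; 2; 4; 5; 3] [::]]]);
    (269500704%num, 94950822093520902%num, Peel (F 30) [:: Peel (F 48) [:: Peel (F 23) [:: Relabel 5 [:: 0; 2;
    1; 3; 5; 4] [:: 2; 3; 4]; Relabel 0 [:: 3; 4; 5; 0; 1; 2] [:: 2; 5]]]]);
    (69896%num, 484534564821139600%num, Peel (F 45) [:: Relabel 8 [:: 5; 2; 4; 3; 0; 1] [:: 1; 2; 3]; Relabel
    7 [:: 5; 2; 4; 3; 0; 1] [:: 1; 2; 3]; Relabel 0 [:: 0; 2; 1; 5; 4; 3] [:: 2; 5]]);
    (269484097%num, 686966485704675584%num, Peel (F 26) [:: Peel (F 1) [:: Peel (F 40) [:: Peel (F 55) [::
    Relabel 2 [:: 2; 4; 5; 0; 3; 1] [::]; Relabel 7 [:: 0; 1; 3; 2; 5; 4] [:: 1; 2; 3]]]]]);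
    (4416%num, 980071033687375881%num, Peel (F 46) [:: Relabel 35 [:: 5; 2; 4; 3; 0; 1] [:: 3; 5]; Relabel 1
    [:: 1; 0; 3; 4; 2; 5] [:: 0; 2]; Relabel 0 [:: 0; 1; 5; 2; 3; 4] [:: 1; 3; 5]]);
    (282574765687884%num, 148618858587013120%num, Peel (F 24) [:: Peel (F 26) [:: Peel (F 4) [:: Peel (F 27)
    [:: Peel (F 5) [:: Peel (F 28) [:: Peel (F 6) [:: Spanning]]]]]]]);
    (282574765688004%num, 148627652532551680%num, Peel (F 24) [:: Peel (F 26) [:: Peel (F 4) [:: Peel (F 27)
    [:: Peel (F 5) [:: Peel (F 28) [:: Peel (F 6) [:: Spanning]]]]]]]);
    (282656403636356%num, 148636379889271040%num, Peel (F 4) [:: Peel (F 5) [:: Peel (F 6) [:: Peel (F 7) [::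
    Spanning]]]]);
    (300340689109312%num, 76596378045775872%num, Peel (F 0) [:: Peel (F 1) [:: Peel (F 2) [:: Peel (F 3) [::
    Spanning]]]]);
    (281548561604628%num, 76580985153063168%num, Peel (F 16) [:: Peel (F 13) [:: Peel (F 4) [:: Relabel 19 [::
    4; 2; 1; 5; 0; 3] [:: 0; 1; 3]; Relabel 1 [:: 4; 1; 2; 5; 0; 3] [:: 0; 2; 3]; Relabel 0 [:: 0; 1; 2; 5; 3;
    4] [:: 1; 4; 5]]]]);
    (282656395249796%num, 148636379890319360%num, Peel (F 4) [:: Peel (F 5) [:: Peel (F 6) [:: Peel (F 7) [::
    Spanning]]]]);
    (282648350572676%num, 148636379889271040%num, Peel (F 4) [:: Peel (F 5) [:: Peel (F 6) [:: Peel (F 7) [::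
    Spanning]]]]);
    (300340688978272%num, 76563392696942592%num, Peel (F 0) [:: Peel (F 1) [:: Peel (F 2) [:: Peel (F 3) [::
    Spanning]]]]);
    (281548561588246%num, 76580993474562304%num, Peel (F 16) [:: Peel (F 13) [:: Peel (F 4) [:: Relabel 2 [::
    4; 2; 1; 5; 0; 3] [:: 0; 1; 3]; Relabel 1 [:: 4; 1; 2; 5; 0; 3] [:: 0; 2; 3]; Relabel 0 [:: 0; 1; 2; 5; 3;
    4] [:: 1; 4; 5]]]]);
    (69000773648%num, 402283855551136515%num, Peel (F 11) [:: Peel (F 24) [:: Relabel 8 [:: 0; 2; 1; 5; 3; 4]
    [:: 1; 4; 5]; Relabel 7 [:: 0; 2; 1; 3; 5; 4] [:: 1; 3; 5]; Relabel 4 [:: 4; 5; 3; 1; 0; 2] [::]; Relabel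
    0 [:: 4; 3; 5; 1; 0; 2] [:: 1; 2]]]);
    (16782098%num, 456382345213313024%num, Peel (F 16) [:: Relabel 0 [:: 0; 2; 1; 4; 3; 5] [:: 1; 4; 5];
    Relabel 0 [:: 1; 2; 0; 4; 3; 5] [:: 1; 4; 5]]);
    (82159215393%num, 585751625558130688%num, Peel (F 16) [:: Peel (F 30) [:: Peel (F 35) [:: Peel (F 32) [::
    Spanning]]]]);
    (17597304283441%num, 10416773161549824%num, Peel (F 16) [:: Peel (F 30) [:: Peel (F 35) [:: Peel (F 32)
    [:: Spanning]]]]);
    (285287185%num, 118230841819136000%num, Peel (F 0) [:: Peel (F 13) [:: Peel (F 61) [:: Peel (F 35) [::
    Relabel 1 [:: 0; 1; 2; 3; 4; 5] [:: 4; 5]; Relabel 0 [:: 0; 1; 2; 3; 5; 4] [::]]]]]);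
    (300458800714016%num, 382805968326492160%num, Peel (F 0) [:: Peel (F 1) [:: Peel (F 2) [:: Peel (F 3) [::
    Spanning]]]]);
    (5629787869684226%num, 708085488287808%num, Peel (F 16) [:: Peel (F 30) [:: Peel (F 31) [:: Peel (F 11)
    [:: Spanning]]]]);
    (300460947935328%num, 94575592174780424%num, Peel (F 0) [:: Peel (F 1) [:: Peel (F 2) [:: Peel (F 3) [::
    Spanning]]]]);
    (81890713858%num, 459756389108027424%num, Peel (F 35) [:: Peel (F 32) [:: Relabel 2 [:: 5; 2; 1; 3; 4; 0]
    [:: 3; 4]; Relabel 1 [:: 3; 5; 4; 0; 2; 1] [:: 0]; Relabel 0 [:: 4; 2; 1; 3; 5; 0] [:: 3; 4]]]);
    (18764980560403%num, 82192892256387072%num, Peel (F 16) [:: Peel (F 30) [:: Peel (F 0) [:: Peel (F 11) [::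
    Peel (F 35) [:: Peel (F 32) [:: Spanning]]]]]]);
    (4563473170%num, 312513502820433920%num, Peel (F 48) [:: Peel (F 16) [:: Relabel 1 [:: 0; 2; 3; 1; 4; 5]
    [:: 1; 2; 3]; Relabel 0 [:: 0; 1; 5; 2; 3; 4] [::]]]);
    (370164034%num, 293087198184734720%num, Peel (F 16) [:: Peel (F 24) [:: Peel (F 4) [:: Peel (F 47) [::
    Peel (F 48) [:: Peel (F 5) [:: Peel (F 62) [:: Peel (F 10) [:: Spanning]]]]]]]]);
    (16843058%num, 316780647537455104%num, Peel (F 45) [:: Peel (F 39) [:: Relabel 7 [:: 0; 1; 3; 2; 4; 5] [::
    1; 2; 3]; Relabel 1 [:: 0; 1; 3; 2; 4; 5] [::]; Relabel 0 [:: 5; 2; 4; 3; 0; 1] [:: 1; 2; 3]]]);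
    (281803677241633%num, 382805968326492160%num, Peel (F 0) [:: Peel (F 1) [:: Peel (F 2) [:: Peel (F 3) [::
    Spanning]]]]);
    (282652637153412%num, 148636379890319360%num, Peel (F 4) [:: Peel (F 5) [:: Peel (F 6) [:: Peel (F 7) [::
    Spanning]]]]);
    (282656672071812%num, 148636379889271040%num, Peel (F 4) [:: Peel (F 5) [:: Peel (F 6) [:: Peel (F 7) [::
    Spanning]]]]);
    (69001036034%num, 334717740709314576%num, Peel (F 13) [:: Peel (F 11) [:: Peel (F 5) [:: Peel (F 42) [::
    Relabel 2 [:: 0; 1; 4; 2; 3; 5] [:: 4; 5]; Relabel 1 [:: 0; 1; 4; 2; 5; 3] [:: 1; 2; 3; 4]; Relabel 0 [::
    0; 4; 1; 2; 5; 3] [:: 1; 2; 3; 4]]]]]);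
    (282656386336900%num, 22570774694985728%num, Peel (F 4) [:: Peel (F 5) [:: Peel (F 6) [:: Peel (F 7) [::
    Spanning]]]]);
    (69000790274%num, 334717740709314576%num, Peel (F 13) [:: Peel (F 11) [:: Peel (F 5) [:: Peel (F 49) [::
    Relabel 0 [:: 0; 1; 4; 2; 3; 5] [:: 1; 2; 3; 5]; Relabel 56 [:: 0; 4; 1; 2; 3; 5] [:: 1; 2; 3; 5]; Relabel
    55 [:: 0; 1; 4; 2; 5; 3] [::]]]]]);
    (16843538%num, 316780647537455104%num, Peel (F 45) [:: Peel (F 16) [:: Relabel 63 [:: 5; 2; 4; 3; 0; 1]
    [:: 1; 2; 3]; Relabel 2 [:: 1; 4; 0; 2; 5; 3] [:: 0; 1; 3; 4]; Relabel 0 [:: 0; 3; 1; 2; 5; 4] [:: 2;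
    5]]]);
    (336609574%num, 90372451279831040%num, Peel (F 16) [:: Peel (F 30) [:: Peel (F 13) [:: Peel (F 47) [::
    Peel (F 48) [:: Peel (F 5) [:: Peel (F 44) [:: Peel (F 10) [:: Spanning]]]]]]]]);
    (282902047756577%num, 382805968326492160%num, Peel (F 0) [:: Peel (F 1) [:: Peel (F 2) [:: Peel (F 3) [::
    Spanning]]]]);
    (282648350574596%num, 581017128488927232%num, Peel (F 4) [:: Peel (F 5) [:: Peel (F 6) [:: Peel (F 7) [::
    Spanning]]]]);
    (69001052418%num, 334717740709314576%num, Peel (F 13) [:: Peel (F 11) [:: Peel (F 5) [:: Peel (F 39) [::
    Relabel 1 [:: 2; 3; 5; 0; 1; 4] [:: 0; 1; 4]; Relabel 0 [:: 0; 4; 1; 2; 3; 5] [:: 1; 2; 3; 5]; Relabel 29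
    [:: 0; 4; 1; 2; 5; 3] [:: 1; 2; 3; 4]]]]]);
    (16843554%num, 316780647537455104%num, Peel (F 45) [:: Peel (F 16) [:: Relabel 3 [:: 5; 2; 4; 3; 0; 1] [::
    1; 2; 3]; Relabel 0 [:: 1; 4; 0; 2; 5; 3] [:: 0; 1; 3; 4]; Relabel 0 [:: 0; 3; 1; 2; 5; 4] [:: 2; 5]]]);
    (68988961992%num, 324559344156876800%num, Peel (F 24) [:: Peel (F 1) [:: Peel (F 4) [:: Peel (F 31) [::
    Peel (F 27) [:: Peel (F 5) [:: Peel (F 28) [:: Peel (F 33) [:: Peel (F 34) [:: Spanning]]]]]]]]]);
    (282574765689032%num, 148636450773024768%num, Peel (F 24) [:: Peel (F 26) [:: Peel (F 4) [:: Peel (F 27)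
    [:: Peel (F 5) [:: Peel (F 28) [:: Peel (F 6) [:: Spanning]]]]]]]);
    (282652645017732%num, 4521191814463552%num, Peel (F 4) [:: Peel (F 5) [:: Peel (F 6) [:: Peel (F 7) [::
    Spanning]]]]);
    (300495306883360%num, 76596378045775872%num, Peel (F 0) [:: Peel (F 1) [:: Peel (F 2) [:: Peel (F 3) [::
    Spanning]]]]);
    (282656663685252%num, 22535590322897920%num, Peel (F 4) [:: Peel (F 5) [:: Peel (F 6) [:: Peel (F 7) [::
    Spanning]]]]);
    (281548595150870%num, 112609782163638528%num, Peel (F 16) [:: Peel (F 13) [:: Peel (F 11) [:: Relabel 2
    [:: 5; 3; 0; 4; 2; 1] [:: 0; 5]; Relabel 1 [:: 3; 1; 2; 5; 0; 4] [:: 0; 2; 3]; Relabel 0 [:: 5; 3; 0; 4;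
    1; 2] [:: 0; 4]]]]);
    (282579060131980%num, 4512464490250240%num, Peel (F 24) [:: Peel (F 26) [:: Peel (F 4) [:: Peel (F 27) [::
    Peel (F 5) [:: Peel (F 28) [:: Peel (F 6) [:: Spanning]]]]]]]);
    (300323507929441%num, 76561193690464256%num, Peel (F 0) [:: Peel (F 1) [:: Peel (F 2) [:: Peel (F 3) [::
    Spanning]]]]);
    (77986242641281028%num, 2199027515408%num, Peel (F 16) [:: Peel (F 30) [:: Peel (F 31) [:: Peel (F 11) [::
    Spanning]]]]);
    (300340689109280%num, 654147845875564544%num, Peel (F 0) [:: Peel (F 1) [:: Peel (F 2) [:: Peel (F 3) [::
    Spanning]]]]);
    (281548595159058%num, 580988549786503680%num, Peel (F 16) [:: Peel (F 13) [:: Peel (F 63) [:: Relabel 2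
    [:: 2; 0; 3; 4; 1; 5] [:: 0; 4]; Relabel 1 [:: 4; 0; 3; 5; 1; 2] [:: 0; 5]; Relabel 0 [:: 1; 0; 3; 4; 2;
    5] [::]]]]);
    (68992679952%num, 402290426817545475%num, Peel (F 11) [:: Peel (F 24) [:: Relabel 9 [:: 0; 2; 1; 5; 3; 4]
    [:: 1; 4; 5]; Relabel 5 [:: 4; 5; 3; 1; 0; 2] [::]; Relabel 4 [:: 0; 2; 1; 3; 5; 4] [:: 1; 3; 5]; Relabel
    0 [:: 4; 3; 5; 1; 0; 2] [:: 1; 2]]]);
    (282574765688908%num, 6773060396924928%num, Peel (F 24) [:: Peel (F 26) [:: Peel (F 4) [:: Peel (F 27) [::
    Peel (F 5) [:: Peel (F 28) [:: Peel (F 6) [:: Spanning]]]]]]]);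
    (281548561596438%num, 112609782163638528%num, Peel (F 16) [:: Peel (F 13) [:: Peel (F 11) [:: Relabel 10
    [:: 4; 2; 1; 5; 3; 0] [:: 0; 1; 3]; Relabel 129 [:: 3; 1; 2; 5; 0; 4] [:: 0; 2; 3]; Relabel 127 [:: 5; 3;
    0; 4; 1; 2] [:: 0; 4]]]]);
    (282579060132036%num, 148636448626589696%num, Peel (F 24) [:: Peel (F 26) [:: Peel (F 4) [:: Peel (F 27)
    [:: Peel (F 5) [:: Peel (F 28) [:: Peel (F 6) [:: Spanning]]]]]]]);
    (282656654772356%num, 22535590322896960%num, Peel (F 4) [:: Peel (F 5) [:: Peel (F 6) [:: Peel (F 7) [::
    Spanning]]]]);
    (300460946882913%num, 76561193690464256%num, Peel (F 0) [:: Peel (F 1) [:: Peel (F 2) [:: Peel (F 3) [::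
    Spanning]]]]);
    (282652628764676%num, 581017128488927232%num, Peel (F 4) [:: Peel (F 5) [:: Peel (F 6) [:: Peel (F 7) [::
    Spanning]]]]);
    (281548561604626%num, 580984151740058112%num, Peel (F 16) [:: Peel (F 13) [:: Peel (F 30) [:: Relabel 2
    [:: 5; 3; 0; 4; 2; 1] [:: 0; 5]; Relabel 1 [:: 2; 0; 3; 4; 1; 5] [:: 0; 4]; Relabel 0 [:: 5; 0; 3; 4; 2;
    1] [:: 0; 5]]]]);
    (69000790032%num, 402290452587348739%num, Peel (F 11) [:: Peel (F 39) [:: Relabel 6 [:: 0; 2; 3; 4; 1; 5]
    [:: 2; 5]; Relabel 5 [:: 1; 5; 3; 4; 0; 2] [::]; Relabel 4 [:: 0; 2; 5; 4; 1; 3] [::]; Relabel 0 [:: 1; 3;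
    5; 4; 0; 2] [:: 1; 2]]]);
    (68988963016%num, 324559344156876800%num, Peel (F 24) [:: Peel (F 1) [:: Peel (F 4) [:: Peel (F 31) [::
    Peel (F 27) [:: Peel (F 5) [:: Peel (F 28) [:: Peel (F 33) [:: Peel (F 34) [:: Spanning]]]]]]]]]);
    (269485256%num, 430474148242993152%num, Peel (F 40) [:: Relabel 20 [:: 0; 1; 2; 3; 4; 5] [::]; Relabel 9
    [:: 0; 4; 1; 2; 3; 5] [::]; Relabel 1 [:: 0; 2; 1; 3; 5; 4] [::]; Relabel 0 [:: 0; 1; 3; 2; 5; 4] [::]]);
    (336617764%num, 90372451279831040%num, Peel (F 16) [:: Peel (F 30) [:: Peel (F 13) [:: Peel (F 47) [::
    Peel (F 48) [:: Peel (F 5) [:: Peel (F 44) [:: Peel (F 10) [:: Spanning]]]]]]]]);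
    (282647829956740%num, 22570774694985728%num, Peel (F 4) [:: Peel (F 5) [:: Peel (F 6) [:: Peel (F 7) [::
    Spanning]]]]);
    (300598387019840%num, 94575592174780424%num, Peel (F 0) [:: Peel (F 1) [:: Peel (F 2) [:: Peel (F 3) [::
    Spanning]]]]);
    (282647822092420%num, 148636379890319360%num, Peel (F 4) [:: Peel (F 5) [:: Peel (F 6) [:: Peel (F 7) [::
    Spanning]]]]);
    (68992925954%num, 334717740709314576%num, Peel (F 13) [:: Peel (F 11) [:: Peel (F 5) [:: Peel (F 24) [::
    Relabel 2 [:: 0; 1; 4; 2; 3; 5] [:: 1; 2; 3; 5]; Relabel 1 [:: 1; 3; 5; 0; 4; 2] [:: 1; 4; 5]; Relabel 0
    [:: 0; 1; 4; 2; 5; 3] [:: 1; 2; 3; 4]]]]]);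
    (281787571114273%num, 382805968326492160%num, Peel (F 0) [:: Peel (F 1) [:: Peel (F 2) [:: Peel (F 3) [::
    Spanning]]]]);
    (68992680194%num, 334717740709314576%num, Peel (F 13) [:: Peel (F 11) [:: Peel (F 5) [:: Peel (F 42) [::
    Relabel 0 [:: 0; 1; 4; 2; 3; 5] [:: 4; 5]; Relabel 56 [:: 0; 1; 4; 2; 5; 3] [:: 1; 2; 3; 4]; Relabel 55
    [:: 0; 4; 1; 2; 5; 3] [:: 1; 2; 3; 4]]]]]);
    (16843299%num, 316780647537455104%num, Peel (F 45) [:: Peel (F 16) [:: Relabel 6 [:: 5; 2; 4; 3; 0; 1] [::
    1; 2; 3]; Relabel 2 [:: 1; 4; 0; 2; 5; 3] [:: 0; 1; 3; 4]; Relabel 0 [:: 0; 3; 1; 2; 5; 4] [:: 2; 5]]]);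
    (68988961932%num, 324559344156876800%num, Peel (F 24) [:: Peel (F 1) [:: Peel (F 4) [:: Peel (F 31) [::
    Peel (F 27) [:: Peel (F 5) [:: Peel (F 28) [:: Peel (F 33) [:: Peel (F 34) [:: Spanning]]]]]]]]]);
    (76860334681374726%num, 9011597301514256%num, Peel (F 16) [:: Peel (F 30) [:: Peel (F 31) [:: Peel (F 11)
    [:: Spanning]]]]);
    (300460947144993%num, 76561193690464256%num, Peel (F 0) [:: Peel (F 1) [:: Peel (F 2) [:: Peel (F 3) [::
    Spanning]]]]);
    (300478127800672%num, 654147845875564544%num, Peel (F 0) [:: Peel (F 1) [:: Peel (F 2) [:: Peel (F 3) [::
    Spanning]]]]);
    (281548595150870%num, 112614454819555584%num, Peel (F 16) [:: Peel (F 13) [:: Peel (F 19) [:: Relabel 2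
    [:: 4; 0; 3; 5; 1; 2] [:: 0; 5]; Relabel 1 [:: 3; 1; 2; 5; 0; 4] [:: 0; 2; 3]; Relabel 0 [:: 0; 1; 2; 5;
    3; 4] [:: 1; 4; 5]]]]);
    (76860342734446596%num, 9150135766417408%num, Peel (F 16) [:: Peel (F 30) [:: Peel (F 31) [:: Peel (F 11)
    [:: Spanning]]]]);
    (300357867667808%num, 76596378045775872%num, Peel (F 0) [:: Peel (F 1) [:: Peel (F 2) [:: Peel (F 3) [::
    Spanning]]]]);
    (300340689109280%num, 76596378045775872%num, Peel (F 0) [:: Peel (F 1) [:: Peel (F 2) [:: Peel (F 3) [::
    Spanning]]]]);
    (281548595159058%num, 618138840067541504%num, Peel (F 16) [:: Peel (F 13) [:: Peel (F 63) [:: Relabel 2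
    [:: 4; 0; 3; 5; 1; 2] [:: 0; 5]; Relabel 1 [:: 2; 0; 3; 4; 1; 5] [:: 0; 4]; Relabel 0 [:: 1; 0; 3; 4; 2;
    5] [::]]]]);
    (282579060131016%num, 148627652532551680%num, Peel (F 24) [:: Peel (F 26) [:: Peel (F 4) [:: Peel (F 27)
    [:: Peel (F 5) [:: Peel (F 28) [:: Peel (F 6) [:: Spanning]]]]]]]);
    (282574765687948%num, 148636450773024768%num, Peel (F 24) [:: Peel (F 26) [:: Peel (F 4) [:: Peel (F 27)
    [:: Peel (F 5) [:: Peel (F 28) [:: Peel (F 6) [:: Spanning]]]]]]]);
    (68996612112%num, 402290452587348739%num, Peel (F 11) [:: Peel (F 50) [:: Relabel 6 [:: 5; 4; 1; 3; 0; 2]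
    [:: 2; 3; 5]; Relabel 2 [:: 3; 4; 1; 5; 0; 2] [:: 0; 2; 5]; Relabel 1 [:: 2; 0; 1; 5; 3; 4] [:: 0; 2; 4];
    Relabel 0 [:: 2; 0; 1; 3; 5; 4] [:: 0; 2; 3]]]);
    (68988962892%num, 324559344156876800%num, Peel (F 24) [:: Peel (F 1) [:: Peel (F 4) [:: Peel (F 31) [::
    Peel (F 27) [:: Peel (F 5) [:: Peel (F 28) [:: Peel (F 33) [:: Peel (F 34) [:: Spanning]]]]]]]]]);
    (269485196%num, 430474148242993152%num, Peel (F 31) [:: Relabel 12 [:: 0; 1; 2; 3; 4; 5] [:: 1; 2; 3];
    Relabel 31 [:: 0; 3; 1; 2; 4; 5] [:: 1; 2; 3]; Relabel 1 [:: 0; 2; 1; 3; 5; 4] [:: 1; 2; 3]; Relabel 0 [::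
    0; 1; 3; 2; 5; 4] [:: 1; 2; 3]]);
    (4882%num, 459197837187678208%num, Peel (F 30) [:: Relabel 67 [:: 0; 1; 2; 3; 4; 5] [:: 1; 2; 5]; Relabel
    56 [:: 0; 1; 3; 2; 4; 5] [:: 1; 3; 5]; Relabel 49 [:: 0; 1; 3; 2; 5; 4] [:: 1; 3; 4]; Relabel 44 [:: 0; 1;
    2; 4; 3; 5] [:: 1; 2; 3]; Relabel 22 [:: 0; 1; 2; 4; 5; 3] [:: 2; 3; 5]; Relabel 14 [:: 0; 1; 2; 5; 3; 4]
    [:: 1; 2; 5]; Relabel 0 [:: 0; 1; 2; 5; 4; 3] [:: 2; 4; 5]]);
    (16781602%num, 456382345213313536%num, Peel (F 16) [:: Relabel 134 [:: 5; 2; 4; 1; 3; 0] [:: 2; 4];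
    Relabel 134 [:: 5; 2; 4; 0; 3; 1] [:: 2; 4]]);
    (268505874%num, 312549249833238528%num, Peel (F 39) [:: Relabel 66 [:: 0; 1; 2; 3; 4; 5] [:: 1; 2; 3];
    Relabel 60 [:: 0; 1; 2; 3; 4; 5] [::]; Relabel 59 [:: 5; 3; 4; 2; 0; 1] [:: 1; 2; 3]]);
    (336609602%num, 293087198218289152%num, Peel (F 16) [:: Peel (F 24) [:: Peel (F 4) [:: Peel (F 47) [::
    Peel (F 48) [:: Peel (F 5) [:: Peel (F 64) [:: Peel (F 62) [:: Peel (F 10) [:: Spanning]]]]]]]]]);
    (336609602%num, 293087198184742912%num, Peel (F 16) [:: Peel (F 24) [:: Peel (F 4) [:: Peel (F 47) [::
    Peel (F 48) [:: Peel (F 5) [:: Peel (F 64) [:: Peel (F 62) [:: Peel (F 10) [:: Spanning]]]]]]]]]);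
    (16843042%num, 316780647537455120%num, Peel (F 45) [:: Peel (F 52) [:: Relabel 2 [:: 0; 1; 3; 2; 4; 5]
    [::]; Relabel 1 [:: 5; 2; 4; 3; 0; 1] [:: 1; 2; 3]; Relabel 0 [:: 5; 2; 3; 4; 1; 0] [:: 1; 2; 3]]]);
    (268505650%num, 312549249833238528%num, Peel (F 16) [:: Relabel 54 [:: 5; 3; 4; 2; 0; 1] [:: 1; 2; 3];
    Relabel 51 [:: 1; 4; 0; 3; 5; 2] [:: 0; 1; 3; 4]; Relabel 51 [:: 0; 2; 1; 3; 5; 4] [:: 2; 5]]);
    (336609602%num, 293087198184734724%num, Peel (F 16) [:: Peel (F 24) [:: Peel (F 4) [:: Peel (F 47) [::
    Peel (F 48) [:: Peel (F 5) [:: Peel (F 64) [:: Peel (F 62) [:: Peel (F 10) [:: Spanning]]]]]]]]]);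
    (16843042%num, 316780647537455616%num, Peel (F 45) [:: Peel (F 52) [:: Relabel 1 [:: 0; 1; 3; 2; 4; 5]
    [::]; Relabel 0 [:: 5; 2; 4; 3; 0; 1] [:: 1; 2; 3]; Relabel 0 [:: 5; 2; 3; 4; 1; 0] [:: 1; 2; 3]]]);
    (4370%num, 459197837187678720%num, Peel (F 4) [:: Relabel 8 [:: 0; 1; 2; 3; 4; 5] [::]; Relabel 7 [:: 0;
    1; 2; 3; 4; 5] [:: 1; 2; 4]; Relabel 3 [:: 0; 1; 3; 2; 4; 5] [:: 1; 3; 5]; Relabel 0 [:: 0; 1; 3; 2; 5; 4]
    [:: 1; 3; 5]; Relabel 0 [:: 0; 1; 2; 4; 3; 5] [:: 1; 2; 3]; Relabel 3 [:: 1; 0; 2; 3; 5; 4] [:: 0; 2;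
    4]]);
    (268505618%num, 312549249833238560%num, Peel (F 65) [:: Relabel 3 [:: 0; 1; 2; 3; 4; 5] [::]; Relabel 2
    [:: 5; 3; 4; 2; 0; 1] [:: 1; 2; 3]; Relabel 2 [:: 5; 3; 2; 4; 1; 0] [:: 1; 2; 3]]);
    (336609568%num, 90372451279831046%num, Peel (F 16) [:: Peel (F 30) [:: Peel (F 13) [:: Peel (F 47) [::
    Peel (F 48) [:: Peel (F 5) [:: Peel (F 66) [:: Peel (F 23) [:: Peel (F 44) [:: Peel (F 10) [::
    Spanning]]]]]]]]]]);
    (82180%num, 97268975134572688%num, Peel (F 67) [:: Peel (F 28) [:: Relabel 1 [:: 4; 5; 1; 3; 2; 0] [:: 2;
    3; 4]; Relabel 0 [:: 0; 3; 1; 2; 5; 4] [::]]]);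
    (4114%num, 459197837187678976%num, Peel (F 68) [:: Relabel 3 [:: 0; 1; 2; 3; 4; 5] [::]; Relabel 145 [::
    4; 5; 2; 3; 0; 1] [::]; Relabel 127 [:: 0; 1; 3; 2; 4; 5] [::]; Relabel 0 [:: 4; 2; 5; 3; 0; 1] [:: 0; 1;
    3]; Relabel 0 [:: 5; 4; 3; 2; 0; 1] [:: 0; 2; 3]; Relabel 127 [:: 1; 0; 2; 3; 5; 4] [::]]);
    (20%num, 693448351260700416%num, Peel (F 4) [:: Relabel 145 [:: 0; 1; 2; 3; 4; 5] [:: 1; 3; 4]; Relabel 92
    [:: 0; 1; 2; 5; 3; 4] [:: 1; 4; 5]; Relabel 92 [:: 0; 1; 3; 4; 2; 5] [:: 1; 4; 5]; Relabel 92 [:: 0; 1; 4;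
    3; 2; 5] [:: 1; 5]; Relabel 0 [:: 2; 3; 4; 5; 0; 1] [::]; Relabel 92 [:: 0; 1; 5; 2; 3; 4] [:: 1; 5];
    Relabel 0 [:: 3; 2; 5; 4; 0; 1] [::]]);
    (73299935490%num, 289638850559475760%num, Peel (F 16) [:: Peel (F 42) [:: Peel (F 13) [:: Peel (F 11) [::
    Peel (F 5) [:: Peel (F 53) [:: Peel (F 23) [:: Peel (F 29) [:: Spanning]]]]]]]]);
    (73282954260%num, 690204130792177664%num, Peel (F 30) [:: Peel (F 69) [:: Relabel 162 [:: 5; 2; 4; 3; 0;
    1] [:: 2; 3; 5]; Relabel 161 [:: 1; 0; 3; 4; 2; 5] [:: 0; 2; 3]]]);
    (16843144%num, 443965847632908288%num, Peel (F 45) [:: Peel (F 42) [:: Peel (F 35) [:: Relabel 1 [:: 5; 4;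
    3; 2; 1; 0] [:: 0; 2; 4]; Relabel 0 [:: 1; 0; 4; 2; 3; 5] [:: 0; 4; 5]]]]);
    (69005814920%num, 324542860055543808%num, Peel (F 1) [:: Peel (F 4) [:: Peel (F 31) [:: Peel (F 27) [::
    Peel (F 33) [:: Peel (F 34) [:: Spanning]]]]]]);
  (4803852272681250%num, 72057871063318528%num, Peel (F 2) [:: Peel (F 22) [:: Peel (F 23) [:: Spanning]]]);
    (281543982522658%num, 369333661008396288%num, Peel (F 16) [:: Peel (F 0) [:: Peel (F 13) [:: Relabel 0 [::
    0; 2; 1; 5; 3; 4] [:: 1; 4; 5]; Relabel 163 [:: 0; 2; 1; 3; 5; 4] [:: 1; 2]]]]);
    (269488513%num, 677942952688943104%num, Peel (F 26) [:: Peel (F 1) [:: Peel (F 70) [:: Peel (F 30) [::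
    Relabel 2 [:: 5; 4; 3; 2; 1; 0] [:: 2; 3; 4]; Relabel 0 [:: 3; 5; 4; 0; 2; 1] [::]]]]]);
    (72075255231877665%num, 10135306774773760%num, Peel (F 16) [:: Peel (F 30) [:: Peel (F 0) [:: Peel (F 32)
    [:: Spanning]]]]);
    (72357829450732065%num, 10168292123607040%num, Peel (F 16) [:: Peel (F 30) [:: Peel (F 0) [:: Peel (F 32)
    [:: Spanning]]]]);
    (18764980621842%num, 312472408560762880%num, Peel (F 35) [:: Peel (F 30) [:: Relabel 1 [:: 0; 1; 4; 2; 3;
    5] [::]; Relabel 0 [:: 1; 0; 4; 2; 3; 5] [::]]]);
    (269488513%num, 677959445363359744%num, Peel (F 26) [:: Peel (F 1) [:: Peel (F 70) [:: Peel (F 71) [::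
    Relabel 0 [:: 5; 3; 1; 2; 4; 0] [::]; Relabel 111 [:: 1; 2; 0; 4; 3; 5] [::]]]]]);
    (76843841437704450%num, 563087493038080%num, Peel (F 16) [:: Peel (F 30) [:: Peel (F 0) [:: Peel (F 32)
    [:: Spanning]]]]);
    (76861360609304850%num, 563087493038080%num, Peel (F 16) [:: Peel (F 30) [:: Peel (F 0) [:: Peel (F 32)
    [:: Spanning]]]]);
    (73282945300%num, 615050861759979520%num, Peel (F 24) [:: Peel (F 4) [:: Peel (F 13) [:: Peel (F 43) [::
    Peel (F 27) [:: Relabel 1 [:: 3; 1; 2; 0; 4; 5] [::]; Relabel 0 [:: 2; 1; 3; 0; 4; 5] [::]]]]]]);
    (4803839585820930%num, 563087493038080%num, Peel (F 16) [:: Peel (F 30) [:: Peel (F 0) [:: Peel (F 32) [::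
    Spanning]]]]);
    (73283928340%num, 615050861759979520%num, Peel (F 24) [:: Peel (F 4) [:: Peel (F 13) [:: Peel (F 43) [::
    Peel (F 27) [:: Relabel 0 [:: 3; 1; 2; 0; 4; 5] [::]; Relabel 115 [:: 2; 3; 1; 5; 4; 0] [::]]]]]]);
    (269549844%num, 691752861633110016%num, Peel (F 13) [:: Relabel 2 [:: 0; 1; 3; 2; 4; 5] [::]; Relabel 0
    [:: 0; 1; 3; 2; 5; 4] [::]]);
    (70024%num, 173786156172836864%num, Peel (F 27) [:: Relabel 10 [:: 0; 1; 2; 3; 5; 4] [:: 1; 3; 4; 5];
    Relabel 6 [:: 0; 1; 2; 4; 5; 3] [:: 1; 3; 4; 5]; Relabel 0 [:: 0; 1; 2; 5; 3; 4] [:: 2; 4; 5]]);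
    (269484353%num, 686966485704675328%num, Peel (F 26) [:: Peel (F 1) [:: Peel (F 57) [:: Relabel 120 [:: 1;
    0; 5; 4; 3; 2] [:: 0; 4; 5]; Relabel 115 [:: 4; 2; 3; 1; 5; 0] [::]]]]);
    (4417%num, 691735104419397632%num, Peel (F 46) [:: Relabel 16 [:: 0; 1; 3; 2; 4; 5] [:: 1; 2]; Relabel 1
    [:: 1; 0; 3; 2; 4; 5] [:: 0; 2]; Relabel 0 [:: 0; 1; 5; 2; 3; 4] [:: 1; 3; 5]]);
    (1172813381906%num, 149779880572096513%num, Peel (F 16) [:: Peel (F 30) [:: Peel (F 0) [:: Peel (F 4) [::
    Peel (F 11) [:: Peel (F 35) [:: Peel (F 32) [:: Spanning]]]]]]]);
    (73183777716838946%num, 708222927241216%num, Peel (F 16) [:: Peel (F 30) [:: Peel (F 31) [:: Peel (F 11)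
    [:: Spanning]]]]);
    (73585991954%num, 732173039273246720%num, Peel (F 35) [:: Peel (F 36) [:: Relabel 166 [:: 2; 4; 5; 0; 1;
    3] [:: 1; 2; 4]; Relabel 165 [:: 1; 4; 5; 0; 2; 3] [:: 1; 2; 4]; Relabel 0 [:: 0; 1; 2; 3; 4; 5] [:: 4;
    5]]]);
    (282652108671108%num, 6808175999188992%num, Peel (F 4) [:: Peel (F 5) [:: Peel (F 6) [:: Peel (F 7) [::
    Spanning]]]]);
    (281552572457234%num, 442524842879614977%num, Peel (F 16) [:: Relabel 190 [:: 0; 1; 2; 3; 4; 5] [:: 3; 4];
    Relabel 0 [:: 3; 5; 4; 0; 1; 2] [:: 0; 1; 2; 4; 5]; Relabel 188 [:: 0; 2; 1; 3; 5; 4] [:: 1; 2]]);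
    (281548545345668%num, 654170935632330760%num, Peel (F 17) [:: Relabel 0 [:: 0; 1; 2; 3; 4; 5] [:: 1; 2];
    Relabel 187 [:: 1; 2; 0; 4; 5; 3] [:: 3; 4; 5]]);
    (282579073270792%num, 148689225167143040%num, Peel (F 26) [:: Peel (F 5) [:: Peel (F 28) [:: Peel (F 6)
    [:: Peel (F 29) [:: Peel (F 37) [:: Spanning]]]]]]);
    (73316508804%num, 911233464254072832%num, Peel (F 31) [:: Relabel 4 [:: 5; 2; 4; 3; 1; 0] [:: 1; 3; 4];
    Relabel 1 [:: 3; 0; 1; 5; 2; 4] [:: 0; 2; 3; 4]; Relabel 0 [:: 0; 2; 3; 1; 4; 5] [:: 1; 2; 3; 5]]);
    (285282593%num, 316778465425621008%num, Peel (F 39) [:: Peel (F 30) [:: Relabel 7 [:: 0; 1; 4; 2; 3; 5]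
    [::]; Relabel 0 [:: 0; 2; 3; 1; 5; 4] [:: 1; 4]]]);
    (1172811292946%num, 145575339552145408%num, Peel (F 16) [:: Peel (F 30) [:: Peel (F 0) [:: Peel (F 4) [::
    Peel (F 11) [:: Peel (F 35) [:: Peel (F 32) [:: Spanning]]]]]]]);
    (300460947149088%num, 94610776546869248%num, Peel (F 0) [:: Peel (F 1) [:: Peel (F 2) [:: Peel (F 3) [::
    Spanning]]]]);
    (282652645017732%num, 166650778398752768%num, Peel (F 4) [:: Peel (F 5) [:: Peel (F 6) [:: Peel (F 7) [::
    Spanning]]]]);
    (73854427154%num, 442886582203056128%num, Peel (F 35) [:: Peel (F 13) [:: Relabel 1 [:: 2; 4; 5; 0; 1; 3]
    [:: 1; 2; 4]; Relabel 159 [:: 0; 2; 1; 3; 4; 5] [:: 1; 2]; Relabel 0 [:: 0; 2; 1; 3; 5; 4] [:: 1; 2]]]);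
    (282656646908036%num, 725097132192694272%num, Peel (F 4) [:: Peel (F 5) [:: Peel (F 6) [:: Peel (F 7) [::
    Spanning]]]]);
    (282652628240516%num, 22570774694985728%num, Peel (F 4) [:: Peel (F 5) [:: Peel (F 6) [:: Peel (F 7) [::
    Spanning]]]]);
    (300323508191521%num, 76561262393163776%num, Peel (F 0) [:: Peel (F 1) [:: Peel (F 2) [:: Peel (F 3) [::
    Spanning]]]]);
    (281556866375954%num, 513456537077809152%num, Peel (F 4) [:: Relabel 2 [:: 0; 1; 2; 3; 4; 5] [:: 1; 2];
    Relabel 1 [:: 0; 1; 2; 3; 5; 4] [:: 1; 2]; Relabel 0 [:: 1; 4; 5; 0; 2; 3] [:: 1; 2; 4]]);
    (281548545345668%num, 797160232449998848%num, Peel (F 17) [:: Relabel 0 [:: 0; 1; 2; 3; 4; 5] [:: 1; 2];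
    Relabel 208 [:: 1; 2; 0; 4; 5; 3] [:: 3; 4; 5]]);
    (282579073270792%num, 148627652515725504%num, Peel (F 26) [:: Peel (F 5) [:: Peel (F 28) [:: Peel (F 6)
    [:: Peel (F 29) [:: Peel (F 37) [:: Spanning]]]]]]);
    (73316508804%num, 907003084678365248%num, Peel (F 31) [:: Relabel 6 [:: 5; 2; 4; 3; 1; 0] [:: 1; 3; 4];
    Relabel 1 [:: 3; 0; 1; 5; 2; 4] [:: 0; 2; 3; 4]; Relabel 0 [:: 0; 2; 3; 1; 4; 5] [:: 1; 2; 3; 5]]);
    (286331169%num, 388537065312223232%num, Peel (F 30) [:: Relabel 10 [:: 0; 1; 4; 2; 3; 5] [::]; Relabel 0
    [:: 0; 2; 3; 1; 5; 4] [:: 1; 4]]);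
  (4803854491746561%num, 216172782114832384%num, Peel (F 2) [:: Peel (F 28) [:: Peel (F 22) [:: Spanning]]]);
    (68992181380%num, 334420864030212096%num, Peel (F 24) [:: Peel (F 49) [:: Peel (F 14) [:: Peel (F 34) [::
    Peel (F 43) [:: Relabel 173 [:: 0; 1; 2; 3; 4; 5] [:: 1; 3; 4]; Relabel 0 [:: 3; 2; 0; 4; 5; 1] [:: 1; 3;
    4]]]]]]);
    (300460947935552%num, 76561193665300488%num, Peel (F 0) [:: Peel (F 1) [:: Peel (F 2) [:: Peel (F 3) [::
    Spanning]]]]);
    (73585991954%num, 732171390006460416%num, Peel (F 35) [:: Peel (F 4) [:: Relabel 20 [:: 0; 1; 2; 3; 4; 5]
    [:: 1; 2]; Relabel 0 [:: 1; 4; 5; 0; 2; 3] [:: 1; 2; 4]; Relabel 208 [:: 3; 5; 4; 0; 1; 2] [:: 0; 1; 2; 4;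
    5]]]);
    (73316508804%num, 911163087003844616%num, Peel (F 31) [:: Relabel 0 [:: 5; 2; 4; 3; 1; 0] [:: 1; 3; 4];
    Relabel 206 [:: 3; 0; 1; 5; 2; 4] [:: 0; 2; 3; 4]; Relabel 184 [:: 0; 2; 3; 1; 4; 5] [:: 1; 2; 3; 5]]);
    (73282954372%num, 911163087037399048%num, Peel (F 34) [:: Relabel 0 [:: 0; 1; 2; 3; 4; 5] [::]; Relabel
    183 [:: 5; 2; 3; 4; 1; 0] [:: 0; 4]]);
    (286265633%num, 390788865126268928%num, Peel (F 26) [:: Relabel 6 [:: 0; 1; 2; 3; 4; 5] [::]; Relabel 4
    [:: 4; 5; 3; 1; 2; 0] [:: 1; 4]; Relabel 0 [:: 4; 5; 3; 1; 2; 0] [:: 1; 4]]);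
    (300596239405344%num, 94610776546869248%num, Peel (F 0) [:: Peel (F 1) [:: Peel (F 2) [:: Peel (F 3) [::
    Spanning]]]]);
    (300598386888736%num, 94610776546869248%num, Peel (F 0) [:: Peel (F 1) [:: Peel (F 2) [:: Peel (F 3) [::
    Spanning]]]]);
    (1407658940703266%num, 9154533812862976%num, Peel (F 16) [:: Peel (F 30) [:: Peel (F 31) [:: Peel (F 11)
    [:: Spanning]]]]);
    (281548277424402%num, 190341955475996672%num, Peel (F 0) [:: Peel (F 36) [:: Relabel 2 [:: 2; 4; 5; 0; 1;
    3] [:: 1; 2; 4]; Relabel 1 [:: 1; 4; 5; 0; 2; 3] [:: 1; 2; 4]; Relabel 0 [:: 0; 1; 2; 3; 4; 5] [:: 4;
    5]]]);
    (73317490966%num, 612798512089792512%num, Peel (F 16) [:: Peel (F 30) [:: Peel (F 24) [:: Peel (F 4) [::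
    Peel (F 13) [:: Peel (F 43) [:: Spanning]]]]]]);
    (68992386052%num, 406748946535809152%num, Peel (F 5) [:: Peel (F 14) [:: Peel (F 11) [:: Relabel 1 [:: 0;
    1; 4; 2; 3; 5] [:: 2; 4; 5]; Relabel 0 [:: 2; 3; 5; 0; 1; 4] [:: 0; 1; 2; 4]]]]);
    (1407659175584290%num, 9154533812862976%num, Peel (F 16) [:: Peel (F 30) [:: Peel (F 31) [:: Peel (F 11)
    [:: Spanning]]]]);
    (281548277424402%num, 190341955979313152%num, Peel (F 0) [:: Peel (F 32) [:: Relabel 208 [:: 5; 2; 1; 3;
    4; 0] [:: 3; 4]; Relabel 0 [:: 0; 1; 2; 3; 4; 5] [:: 4; 5]; Relabel 206 [:: 4; 2; 1; 3; 5; 0] [:: 3;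
    4]]]);
    (68992386052%num, 406748946535317632%num, Peel (F 5) [:: Peel (F 14) [:: Peel (F 11) [:: Relabel 0 [:: 0;
    1; 4; 2; 3; 5] [:: 2; 4; 5]; Relabel 3 [:: 2; 3; 5; 0; 1; 4] [:: 0; 1; 2; 4]]]]);
    (268505361%num, 927440167053033474%num, Peel (F 16) [:: Relabel 28 [:: 5; 4; 2; 3; 1; 0] [::]; Relabel 9
    [:: 5; 3; 4; 2; 0; 1] [::]; Relabel 28 [:: 5; 2; 4; 3; 0; 1] [::]; Relabel 3 [:: 1; 4; 0; 3; 5; 2] [:: 3;
    4; 5]; Relabel 0 [:: 0; 2; 1; 3; 5; 4] [:: 3; 4; 5]]);
    (1126188240216614%num, 594477349840355328%num, Peel (F 16) [:: Peel (F 30) [:: Peel (F 31) [:: Peel (F 11)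
    [:: Spanning]]]]);
    (281556883153170%num, 229729760492650500%num, Peel (F 36) [:: Relabel 0 [:: 0; 1; 2; 3; 4; 5] [:: 4; 5];
    Relabel 212 [:: 2; 4; 5; 0; 1; 3] [:: 1; 2; 4]; Relabel 210 [:: 1; 4; 5; 0; 2; 3] [:: 1; 2; 4]]);
    (69008983176%num, 369949400337743888%num, Peel (F 35) [:: Peel (F 37) [:: Relabel 231 [:: 5; 3; 4; 2; 0;
    1] [:: 1; 3]; Relabel 0 [:: 1; 0; 2; 4; 3; 5] [:: 0; 2; 3; 5]]]);
    (69005804744%num, 324559344140034048%num, Peel (F 1) [:: Peel (F 4) [:: Peel (F 31) [:: Peel (F 27) [::
    Peel (F 28) [:: Peel (F 33) [:: Peel (F 34) [:: Spanning]]]]]]]);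
    (68989026564%num, 633064723398549632%num, Peel (F 4) [:: Peel (F 13) [:: Peel (F 16) [:: Relabel 1 [:: 0;
    4; 1; 2; 3; 5] [:: 2; 3; 4]; Relabel 0 [:: 2; 5; 3; 0; 1; 4] [:: 0; 1; 5]]]]);
    (268505105%num, 927440167057229568%num, Peel (F 48) [:: Relabel 52 [:: 0; 2; 1; 3; 5; 4] [::]; Relabel 5
    [:: 4; 5; 1; 2; 3; 0] [::]; Relabel 198 [:: 0; 3; 1; 2; 5; 4] [::]; Relabel 0 [:: 2; 3; 0; 4; 5; 1]
    [::]]);
    (1172813381906%num, 149779880572157953%num, Peel (F 16) [:: Peel (F 30) [:: Peel (F 0) [:: Peel (F 4) [::
    Peel (F 11) [:: Peel (F 35) [:: Peel (F 32) [:: Spanning]]]]]]]);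
    (282648082139268%num, 581017128488927232%num, Peel (F 4) [:: Peel (F 5) [:: Peel (F 6) [:: Peel (F 7) [::
    Spanning]]]]);
    (282652108671108%num, 150888179702956032%num, Peel (F 4) [:: Peel (F 5) [:: Peel (F 6) [:: Peel (F 7) [::
    Spanning]]]]);
    (73585991954%num, 765950036478525440%num, Peel (F 35) [:: Peel (F 13) [:: Relabel 211 [:: 2; 4; 5; 0; 1;
    3] [:: 1; 2; 4]; Relabel 1 [:: 0; 2; 1; 3; 4; 5] [:: 1; 2]; Relabel 0 [:: 0; 2; 1; 3; 5; 4] [:: 1; 2]]]);
    (73316508804%num, 974283859037259776%num, Peel (F 31) [:: Relabel 0 [:: 5; 2; 4; 3; 1; 0] [:: 1; 3; 4];
    Relabel 42 [:: 3; 0; 1; 5; 2; 4] [:: 0; 2; 3; 4]; Relabel 41 [:: 0; 2; 3; 1; 4; 5] [:: 1; 2; 3; 5]]);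
    (285282593%num, 316779496217772048%num, Peel (F 39) [:: Peel (F 30) [:: Relabel 4 [:: 0; 1; 4; 2; 3; 5]
    [::]; Relabel 0 [:: 0; 2; 3; 1; 5; 4] [:: 1; 4]]]);
    (1172811292946%num, 149797464202805248%num, Peel (F 16) [:: Peel (F 30) [:: Peel (F 0) [:: Peel (F 4) [::
    Peel (F 11) [:: Peel (F 35) [:: Peel (F 32) [:: Spanning]]]]]]]);
    (282652108671108%num, 581017128488927232%num, Peel (F 4) [:: Peel (F 5) [:: Peel (F 6) [:: Peel (F 7) [::
    Spanning]]]]);
    (282648082139268%num, 22570774694985728%num, Peel (F 4) [:: Peel (F 5) [:: Peel (F 6) [:: Peel (F 7) [::
    Spanning]]]]);
    (299378683285793%num, 653022014688198656%num, Peel (F 0) [:: Peel (F 1) [:: Peel (F 2) [:: Peel (F 3) [::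
    Spanning]]]]);
    (73585991954%num, 442886582203056128%num, Peel (F 35) [:: Peel (F 30) [:: Relabel 2 [:: 0; 1; 2; 3; 4; 5]
    [:: 1; 2]; Relabel 1 [:: 0; 2; 1; 3; 4; 5] [:: 1; 2]; Relabel 0 [:: 0; 1; 2; 3; 5; 4] [:: 3; 4]]]);
    (300357868716352%num, 653022014688198656%num, Peel (F 0) [:: Peel (F 1) [:: Peel (F 2) [:: Peel (F 3) [::
    Spanning]]]]);
    (281552572457234%num, 513456537077809152%num, Peel (F 13) [:: Relabel 0 [:: 2; 4; 5; 0; 1; 3] [:: 1; 2;
    4]; Relabel 241 [:: 0; 2; 1; 3; 4; 5] [:: 1; 2]; Relabel 240 [:: 0; 2; 1; 3; 5; 4] [:: 1; 2]]);
    (281548545345668%num, 797160223868452864%num, Peel (F 17) [:: Relabel 0 [:: 0; 1; 2; 3; 4; 5] [:: 1; 2];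
    Relabel 239 [:: 1; 2; 0; 4; 5; 3] [:: 3; 4; 5]]);
    (282579073270792%num, 148689225166880960%num, Peel (F 26) [:: Peel (F 5) [:: Peel (F 28) [:: Peel (F 6)
    [:: Peel (F 29) [:: Peel (F 37) [:: Spanning]]]]]]);
    (73316508804%num, 907011331015573568%num, Peel (F 31) [:: Relabel 4 [:: 5; 2; 4; 3; 1; 0] [:: 1; 3; 4];
    Relabel 1 [:: 3; 0; 1; 5; 2; 4] [:: 0; 2; 3; 4]; Relabel 0 [:: 0; 2; 3; 1; 4; 5] [:: 1; 2; 3; 5]]);
    (286331169%num, 316760946251005952%num, Peel (F 30) [:: Relabel 9 [:: 0; 1; 4; 2; 3; 5] [::]; Relabel 0
    [:: 0; 2; 3; 1; 5; 4] [:: 1; 4]]);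
    (286265633%num, 319012746065051648%num, Peel (F 26) [:: Relabel 0 [:: 0; 1; 2; 3; 4; 5] [::]; Relabel 38
    [:: 4; 5; 3; 1; 2; 0] [:: 1; 4]; Relabel 34 [:: 4; 5; 3; 1; 2; 0] [:: 1; 4]]);
    (1172813381906%num, 145557755921436673%num, Peel (F 16) [:: Peel (F 30) [:: Peel (F 0) [:: Peel (F 4) [::
    Peel (F 11) [:: Peel (F 35) [:: Peel (F 32) [:: Spanning]]]]]]]);
    (281907830067233%num, 367043369630695424%num, Peel (F 0) [:: Peel (F 1) [:: Peel (F 2) [:: Peel (F 3) [::
    Spanning]]]]);
    (282656672073732%num, 150888179702956032%num, Peel (F 4) [:: Peel (F 5) [:: Peel (F 6) [:: Peel (F 7) [::
    Spanning]]]]);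
    (282652645017732%num, 150888179702956032%num, Peel (F 4) [:: Peel (F 5) [:: Peel (F 6) [:: Peel (F 7) [::
    Spanning]]]]);
    (73854427154%num, 732173039273246720%num, Peel (F 35) [:: Peel (F 16) [:: Relabel 2 [:: 0; 1; 2; 3; 4; 5]
    [:: 3; 4]; Relabel 1 [:: 0; 1; 2; 3; 5; 4] [:: 1; 2]; Relabel 0 [:: 0; 2; 1; 3; 5; 4] [:: 1; 2]]]);
    (282903120580897%num, 654147845875564544%num, Peel (F 0) [:: Peel (F 1) [:: Peel (F 2) [:: Peel (F 3) [::
    Spanning]]]]);
    (1407663200150050%num, 144117387100160001%num, Peel (F 16) [:: Peel (F 30) [:: Peel (F 31) [:: Peel (F 11)
    [:: Spanning]]]]);
    (299362509918497%num, 94575660894257152%num, Peel (F 0) [:: Peel (F 1) [:: Peel (F 2) [:: Peel (F 3) [::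
    Spanning]]]]);
    (281556866375954%num, 442524842879614977%num, Peel (F 32) [:: Relabel 2 [:: 0; 1; 2; 3; 4; 5] [:: 3; 4];
    Relabel 1 [:: 0; 1; 2; 3; 4; 5] [:: 4; 5]; Relabel 0 [:: 0; 1; 2; 3; 5; 4] [:: 3; 4]]);
    (281548545345668%num, 654170944213876744%num, Peel (F 17) [:: Relabel 0 [:: 0; 1; 2; 3; 4; 5] [:: 1; 2];
    Relabel 262 [:: 1; 2; 0; 4; 5; 3] [:: 3; 4; 5]]);
    (282579073270792%num, 148627652515987584%num, Peel (F 26) [:: Peel (F 5) [:: Peel (F 28) [:: Peel (F 6)
    [:: Peel (F 29) [:: Peel (F 37) [:: Spanning]]]]]]);
    (73316508804%num, 911225217916864512%num, Peel (F 31) [:: Relabel 6 [:: 5; 2; 4; 3; 1; 0] [:: 1; 3; 4];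
    Relabel 1 [:: 3; 0; 1; 5; 2; 4] [:: 0; 2; 3; 4]; Relabel 0 [:: 0; 2; 3; 1; 4; 5] [:: 1; 2; 3; 5]]);
    (285282593%num, 388554584486838288%num, Peel (F 39) [:: Peel (F 30) [:: Relabel 11 [:: 0; 1; 4; 2; 3; 5]
    [::]; Relabel 0 [:: 0; 2; 3; 1; 5; 4] [:: 1; 4]]]);
    (282652393883652%num, 22570774694985728%num, Peel (F 4) [:: Peel (F 5) [:: Peel (F 6) [:: Peel (F 7) [::
    Spanning]]]]);
    (282652393359492%num, 581017128488927232%num, Peel (F 4) [:: Peel (F 5) [:: Peel (F 6) [:: Peel (F 7) [::
    Spanning]]]]);
    (282868896108577%num, 94610776546869248%num, Peel (F 0) [:: Peel (F 1) [:: Peel (F 2) [:: Peel (F 3) [::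
    Spanning]]]]);
    (73334333698%num, 765958282815733760%num, Peel (F 35) [:: Peel (F 30) [:: Relabel 2 [:: 0; 1; 2; 3; 4; 5]
    [:: 1; 2]; Relabel 1 [:: 0; 2; 1; 3; 4; 5] [:: 1; 2]; Relabel 0 [:: 0; 1; 2; 3; 5; 4] [:: 3; 4]]]);
    (300254725947456%num, 725079544310005764%num, Peel (F 24) [:: Peel (F 2) [:: Peel (F 5) [:: Peel (F 72)
    [:: Peel (F 28) [:: Peel (F 17) [:: Spanning]]]]]]);
    (68992386052%num, 406732453861392512%num, Peel (F 5) [:: Peel (F 14) [:: Peel (F 31) [:: Relabel 1 [:: 2;
    3; 5; 0; 1; 4] [:: 0; 1; 2; 4]; Relabel 0 [:: 2; 4; 0; 3; 5; 1] [:: 0; 1; 3]]]]);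
    (73183778253578786%num, 710284511543296%num, Peel (F 16) [:: Peel (F 30) [:: Peel (F 31) [:: Peel (F 11)
    [:: Spanning]]]]);
    (73854361874%num, 732181285610455040%num, Peel (F 35) [:: Peel (F 36) [:: Relabel 180 [:: 2; 4; 5; 0; 1;
    3] [:: 1; 2; 4]; Relabel 178 [:: 1; 4; 5; 0; 2; 3] [:: 1; 2; 4]; Relabel 0 [:: 0; 1; 2; 3; 4; 5] [:: 4;
    5]]]);
    (300186073579584%num, 725079544301880320%num, Peel (F 24) [:: Peel (F 2) [:: Peel (F 5) [:: Peel (F 72)
    [:: Peel (F 28) [:: Peel (F 17) [:: Spanning]]]]]]);
    (68992386052%num, 406748942240350400%num, Peel (F 5) [:: Peel (F 14) [:: Peel (F 31) [:: Relabel 1 [:: 2;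
    3; 5; 0; 1; 4] [:: 0; 1; 2; 4]; Relabel 0 [:: 2; 4; 0; 3; 5; 1] [:: 0; 1; 3]]]]);
    (268505361%num, 927440162759114754%num, Peel (F 16) [:: Relabel 35 [:: 5; 4; 2; 3; 1; 0] [::]; Relabel 23
    [:: 5; 3; 4; 2; 0; 1] [::]; Relabel 10 [:: 5; 2; 4; 3; 0; 1] [::]; Relabel 4 [:: 1; 4; 0; 3; 5; 2] [:: 3;
    4; 5]; Relabel 0 [:: 0; 2; 1; 3; 5; 4] [:: 3; 4; 5]]);
    (73283938372%num, 324558240383828096%num, Peel (F 16) [:: Peel (F 24) [:: Peel (F 4) [:: Peel (F 31) [::
    Peel (F 27) [:: Peel (F 5) [:: Peel (F 33) [:: Peel (F 34) [:: Spanning]]]]]]]]);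
    (282652108671108%num, 148636379889271040%num, Peel (F 4) [:: Peel (F 5) [:: Peel (F 6) [:: Peel (F 7) [::
    Spanning]]]]);
    (73585991954%num, 765949486723235840%num, Peel (F 35) [:: Peel (F 13) [:: Relabel 252 [:: 2; 4; 5; 0; 1;
    3] [:: 1; 2; 4]; Relabel 42 [:: 0; 2; 1; 3; 4; 5] [:: 1; 2]; Relabel 0 [:: 0; 2; 1; 3; 5; 4] [:: 1; 2]]]);
    (73316508804%num, 974283850464102400%num, Peel (F 31) [:: Relabel 0 [:: 5; 2; 4; 3; 1; 0] [:: 1; 3; 4];
    Relabel 249 [:: 3; 0; 1; 5; 2; 4] [:: 0; 2; 3; 4]; Relabel 248 [:: 0; 2; 3; 1; 4; 5] [:: 1; 2; 3; 5]]);
    (73282954372%num, 974283850497656832%num, Peel (F 34) [:: Relabel 0 [:: 0; 1; 2; 3; 4; 5] [::]; Relabel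
    247 [:: 5; 2; 3; 4; 1; 0] [:: 0; 4]]);
    (285282592%num, 316779496217772035%num, Peel (F 39) [:: Peel (F 30) [:: Relabel 4 [:: 0; 2; 3; 1; 4; 5]
    [:: 1; 5]; Relabel 0 [:: 0; 2; 3; 1; 5; 4] [:: 1; 4]]]);
    (281556884201730%num, 173444660746780800%num, Peel (F 36) [:: Relabel 188 [:: 2; 4; 5; 0; 1; 3] [:: 1; 2;
    4]; Relabel 190 [:: 1; 4; 5; 0; 2; 3] [:: 1; 2; 4]; Relabel 189 [:: 0; 1; 2; 3; 4; 5] [:: 4; 5]]);
    (73318605828%num, 618738082492973072%num, Peel (F 27) [:: Peel (F 69) [:: Relabel 0 [:: 0; 1; 2; 3; 4; 5]
    [:: 2; 3; 4]; Relabel 284 [:: 4; 5; 3; 1; 2; 0] [:: 0; 2; 3]]]);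
    (282578801395784%num, 288318474789327104%num, Peel (F 26) [:: Peel (F 31) [:: Peel (F 2) [:: Peel (F 5)
    [:: Peel (F 28) [:: Peel (F 25) [:: Peel (F 56) [:: Spanning]]]]]]]);
    (68989026564%num, 633064719103582352%num, Peel (F 4) [:: Peel (F 13) [:: Peel (F 30) [:: Relabel 1 [:: 4;
    1; 0; 3; 5; 2] [:: 1; 4]; Relabel 0 [:: 0; 4; 1; 2; 5; 3] [:: 2; 3; 5]]]]);
    (268505105%num, 994994161467787008%num, Peel (F 48) [:: Relabel 109 [:: 0; 2; 1; 3; 5; 4] [::]; Relabel 10
    [:: 4; 5; 1; 2; 3; 0] [::]; Relabel 4 [:: 0; 3; 1; 2; 5; 4] [::]; Relabel 0 [:: 2; 3; 0; 4; 5; 1] [::]]);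
    (76579954353046289%num, 1688987332771840%num, Peel (F 16) [:: Peel (F 30) [:: Peel (F 0) [:: Peel (F 32)
    [:: Spanning]]]]);
    (72076359020643089%num, 1691048917073920%num, Peel (F 16) [:: Peel (F 30) [:: Peel (F 0) [:: Peel (F 32)
    [:: Spanning]]]]);
    (4504703719248147%num, 451591415795810304%num, Peel (F 16) [:: Relabel 1 [:: 1; 0; 5; 2; 3; 4] [::];
    Relabel 0 [:: 0; 1; 5; 2; 3; 4] [::]]);
    (4803839317446674%num, 144150373051924480%num, Peel (F 16) [:: Peel (F 30) [:: Peel (F 0) [:: Peel (F 32)
    [:: Spanning]]]]);
    (76842741942788114%num, 144150647359406080%num, Peel (F 16) [:: Peel (F 30) [:: Peel (F 0) [:: Peel (F 32)
    [:: Spanning]]]]);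
    (76579958378533392%num, 569565882875904%num, Peel (F 16) [:: Relabel 1 [:: 1; 0; 5; 2; 3; 4] [::]; Relabel
    0 [:: 0; 1; 5; 2; 3; 4] [::]]);
    (4522364340613394%num, 144150372548608000%num, Peel (F 16) [:: Peel (F 30) [:: Peel (F 0) [:: Peel (F 32)
    [:: Spanning]]]]);
    (76842741941739794%num, 144150372548608000%num, Peel (F 16) [:: Peel (F 30) [:: Peel (F 0) [:: Peel (F 32)
    [:: Spanning]]]]);
    (4522364340605457%num, 1695448546934784%num, Peel (F 16) [:: Relabel 1 [:: 1; 0; 5; 2; 3; 4] [::]; Relabel
    0 [:: 0; 1; 5; 2; 3; 4] [::]]);
    (76861429078102529%num, 9009398881976320%num, Peel (F 16) [:: Peel (F 30) [:: Peel (F 0) [:: Peel (F 32)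
    [:: Spanning]]]]);
    (76861429076005377%num, 9013815184195584%num, Peel (F 42) [:: Relabel 0 [:: 0; 1; 2; 3; 4; 5] [::];
    Relabel 6 [:: 1; 0; 2; 5; 3; 4] [::]]);
    (72339137752019729%num, 9009398881976320%num, Peel (F 16) [:: Peel (F 30) [:: Peel (F 0) [:: Peel (F 32)
    [:: Spanning]]]]);
    (299135900136209%num, 9009398881976320%num, Peel (F 16) [:: Peel (F 30) [:: Peel (F 0) [:: Peel (F 32) [::
    Spanning]]]]);
    (72339137752011537%num, 9013815182106624%num, Peel (F 42) [:: Relabel 1 [:: 0; 1; 2; 3; 4; 5] [::];
    Relabel 0 [:: 1; 0; 2; 3; 4; 5] [::]]);
    (17596767342849%num, 994812419895205920%num, Peel (F 35) [:: Peel (F 0) [:: Relabel 11 [:: 0; 3; 1; 2; 4;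
    5] [::]; Relabel 8 [:: 5; 3; 1; 0; 4; 2] [::]; Relabel 5 [:: 3; 4; 0; 1; 2; 5] [::]; Relabel 3 [:: 1; 3;
    0; 2; 4; 5] [::]; Relabel 0 [:: 2; 3; 0; 1; 4; 5] [::]]]);
    (73304145992%num, 365129119886755840%num, Peel (F 50) [:: Peel (F 6) [:: Peel (F 5) [:: Relabel 123 [:: 2;
    1; 4; 5; 0; 3] [:: 0; 1; 2; 3]; Relabel 124 [:: 1; 2; 4; 5; 0; 3] [:: 0; 1; 2; 3]]]]);
    (72357833996378370%num, 9007336794357760%num, Peel (F 16) [:: Peel (F 30) [:: Peel (F 0) [:: Peel (F 32)
    [:: Spanning]]]]);
    (76860265392644370%num, 563087493038080%num, Peel (F 16) [:: Peel (F 30) [:: Peel (F 0) [:: Peel (F 32)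
    [:: Spanning]]]]);
    (73304146952%num, 365129119886753920%num, Peel (F 50) [:: Peel (F 6) [:: Peel (F 28) [:: Relabel 1 [:: 1;
    3; 2; 5; 4; 0] [:: 0; 2; 3; 4]; Relabel 0 [:: 2; 3; 1; 5; 4; 0] [:: 0; 2; 3; 4]]]]);
    (4785143342633235%num, 144150381104988160%num, Peel (F 16) [:: Peel (F 30) [:: Peel (F 0) [:: Peel (F 32)
    [:: Spanning]]]]);
    (282643226890515%num, 144150381104988160%num, Peel (F 16) [:: Peel (F 30) [:: Peel (F 0) [:: Peel (F 32)
    [:: Spanning]]]]);
    (69009179720%num, 78024643641884676%num, Peel (F 50) [:: Peel (F 6) [:: Peel (F 0) [:: Relabel 1 [:: 1; 0;
    2; 3; 5; 4] [:: 0; 2; 4; 5]; Relabel 0 [:: 2; 0; 1; 3; 5; 4] [:: 0; 2; 4; 5]]]]);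
    (4564521217%num, 994975422510800928%num, Peel (F 48) [:: Peel (F 46) [:: Relabel 7 [:: 0; 1; 2; 3; 4; 5]
    [::]; Relabel 6 [:: 0; 1; 2; 3; 5; 4] [:: 1; 2; 4; 5]; Relabel 3 [:: 0; 1; 3; 2; 5; 4] [:: 1; 2; 4; 5];
    Relabel 0 [:: 0; 2; 3; 1; 5; 4] [:: 1; 2; 4; 5]]]);
    (4563472664%num, 475245759315312640%num, Peel (F 4) [:: Peel (F 46) [:: Peel (F 35) [:: Peel (F 73) [::
    Peel (F 42) [:: Relabel 3 [:: 5; 2; 4; 0; 1; 3] [::]; Relabel 2 [:: 4; 2; 5; 0; 1; 3] [::]]]]]]);
    (73283993860%num, 615050312004165760%num, Peel (F 24) [:: Peel (F 4) [:: Peel (F 13) [:: Peel (F 43) [::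
    Peel (F 27) [:: Relabel 7 [:: 3; 1; 2; 0; 4; 5] [::]; Relabel 6 [:: 2; 1; 3; 0; 4; 5] [::]]]]]]);
    (73283928340%num, 615050312004689920%num, Peel (F 24) [:: Peel (F 4) [:: Peel (F 13) [:: Peel (F 43) [::
    Peel (F 30) [:: Relabel 134 [:: 3; 2; 4; 0; 5; 1] [::]; Relabel 133 [:: 2; 3; 4; 0; 5; 1] [::]]]]]]);
    (17891600%num, 1075778471990439947%num, Peel (F 45) [:: Peel (F 46) [:: Relabel 3 [:: 3; 0; 5; 4; 1; 2]
    [::]; Relabel 2 [:: 3; 4; 0; 5; 1; 2] [::]; Relabel 1 [:: 4; 2; 1; 3; 5; 0] [::]; Relabel 0 [:: 4; 1; 2;
    3; 5; 0] [::]]]);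
    (76578790164337185%num, 144117662513889280%num, Peel (F 16) [:: Peel (F 30) [:: Peel (F 0) [:: Peel (F 32)
    [:: Spanning]]]]);
    (76860333859410465%num, 144117662513889280%num, Peel (F 16) [:: Peel (F 30) [:: Peel (F 0) [:: Peel (F 32)
    [:: Spanning]]]]);
    (73283993860%num, 615050861759979520%num, Peel (F 24) [:: Peel (F 4) [:: Peel (F 13) [:: Peel (F 43) [::
    Peel (F 30) [:: Relabel 1 [:: 3; 2; 4; 0; 1; 5] [::]; Relabel 0 [:: 2; 3; 4; 0; 1; 5] [::]]]]]]);
    (76860334112121090%num, 563087493038080%num, Peel (F 16) [:: Peel (F 30) [:: Peel (F 0) [:: Peel (F 32)
    [:: Spanning]]]]);
    (72357765276901650%num, 563087493038080%num, Peel (F 16) [:: Peel (F 30) [:: Peel (F 0) [:: Peel (F 32)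
    [:: Spanning]]]]);
    (73283993620%num, 615050861759979520%num, Peel (F 24) [:: Peel (F 4) [:: Peel (F 13) [:: Peel (F 43) [::
    Peel (F 27) [:: Relabel 1 [:: 3; 1; 2; 0; 4; 5] [::]; Relabel 0 [:: 2; 1; 3; 0; 4; 5] [::]]]]]]);
    (4564516884%num, 691752861633110016%num, Peel (F 13) [:: Relabel 3 [:: 0; 1; 3; 2; 4; 5] [::]; Relabel 0
    [:: 0; 1; 3; 2; 5; 4] [::]]);
    (76579885650285329%num, 1688987332771840%num, Peel (F 16) [:: Peel (F 30) [:: Peel (F 0) [:: Peel (F 32)
    [:: Spanning]]]]);
    (72076290317882129%num, 1688987332771840%num, Peel (F 16) [:: Peel (F 30) [:: Peel (F 0) [:: Peel (F 32)
    [:: Spanning]]]]);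
    (76579885648188177%num, 1688987339341824%num, Peel (F 42) [:: Relabel 1 [:: 0; 1; 2; 3; 4; 5] [::];
    Relabel 0 [:: 1; 0; 2; 3; 4; 5] [::]]);
    (72357834013024289%num, 9009681745838080%num, Peel (F 16) [:: Peel (F 30) [:: Peel (F 0) [:: Peel (F 32)
    [:: Spanning]]]]);
    (76861360609366049%num, 9007345350737920%num, Peel (F 16) [:: Peel (F 30) [:: Peel (F 0) [:: Peel (F 32)
    [:: Spanning]]]]);
    (76579958378533377%num, 1693386459316224%num, Peel (F 0) [:: Relabel 1 [:: 0; 1; 3; 2; 4; 5] [::]; Relabel
    0 [:: 1; 0; 3; 2; 4; 5] [::]]);
    (76579958380565009%num, 563087493038080%num, Peel (F 16) [:: Peel (F 30) [:: Peel (F 0) [:: Peel (F 32)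
    [:: Spanning]]]]);
    (76860265408307729%num, 10135298721710080%num, Peel (F 16) [:: Peel (F 30) [:: Peel (F 0) [:: Peel (F 32)
    [:: Spanning]]]]);
    (76579958378467857%num, 567503795257344%num, Peel (F 42) [:: Relabel 1 [:: 0; 1; 2; 3; 4; 5] [::]; Relabel
    0 [:: 1; 0; 2; 3; 4; 5] [::]]);
    (4802671088309009%num, 563087493038080%num, Peel (F 16) [:: Peel (F 30) [:: Peel (F 0) [:: Peel (F 32) [::
    Spanning]]]]);
    (76842737649914114%num, 145276280944721920%num, Peel (F 16) [:: Peel (F 30) [:: Peel (F 0) [:: Peel (F 32)
    [:: Spanning]]]]);
    (4802671086211857%num, 567503795257344%num, Peel (F 42) [:: Relabel 1 [:: 0; 1; 2; 3; 4; 5] [::]; Relabel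
    0 [:: 1; 2; 0; 3; 4; 5] [::]]);
    (300239708819714%num, 145276280944721920%num, Peel (F 16) [:: Peel (F 30) [:: Peel (F 0) [:: Peel (F 32)
    [:: Spanning]]]]);
    (300239706722562%num, 451591424352190464%num, Peel (F 42) [:: Relabel 0 [:: 0; 1; 2; 3; 4; 5] [::];
    Relabel 2 [:: 1; 0; 2; 3; 4; 5] [::]]);
    (17596767277329%num, 994812419895205890%num, Peel (F 35) [:: Peel (F 16) [:: Relabel 11 [:: 4; 5; 0; 1; 2;
    3] [::]; Relabel 8 [:: 3; 5; 0; 1; 2; 4] [::]; Relabel 5 [:: 2; 5; 0; 1; 3; 4] [::]; Relabel 2 [:: 1; 5;
    0; 2; 3; 4] [::]; Relabel 0 [:: 0; 5; 1; 2; 3; 4] [::]]]);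
    (4522360063529235%num, 144150373051924480%num, Peel (F 16) [:: Peel (F 30) [:: Peel (F 0) [:: Peel (F 32)
    [:: Spanning]]]]);
    (4786247149162515%num, 144150373051924480%num, Peel (F 16) [:: Peel (F 30) [:: Peel (F 0) [:: Peel (F 32)
    [:: Spanning]]]]);
    (73299952712%num, 365129119886753796%num, Peel (F 50) [:: Peel (F 6) [:: Peel (F 0) [:: Relabel 1 [:: 1;
    0; 2; 3; 4; 5] [:: 0; 2; 4; 5]; Relabel 0 [:: 2; 0; 1; 3; 4; 5] [:: 0; 2; 4; 5]]]]);
    (300235412869395%num, 144150373051924480%num, Peel (F 16) [:: Peel (F 30) [:: Peel (F 0) [:: Peel (F 32)
    [:: Spanning]]]]);
    (4785147637534995%num, 144150373051924480%num, Peel (F 16) [:: Peel (F 30) [:: Peel (F 0) [:: Peel (F 32)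
    [:: Spanning]]]]);
    (69009179720%num, 365129119886753796%num, Peel (F 50) [:: Peel (F 6) [:: Peel (F 0) [:: Relabel 1 [:: 1;
    0; 2; 3; 4; 5] [:: 0; 2; 4; 5]; Relabel 0 [:: 2; 0; 1; 3; 4; 5] [:: 0; 2; 4; 5]]]]);
    (4786242855244035%num, 144150373051924480%num, Peel (F 16) [:: Peel (F 30) [:: Peel (F 0) [:: Peel (F 32)
    [:: Spanning]]]]);
    (4786174135767315%num, 144150373051924480%num, Peel (F 16) [:: Peel (F 30) [:: Peel (F 0) [:: Peel (F 32)
    [:: Spanning]]]]);
    (73304146952%num, 78024643641884676%num, Peel (F 50) [:: Peel (F 6) [:: Peel (F 0) [:: Relabel 1 [:: 1; 0;
    2; 3; 4; 5] [:: 0; 2; 4; 5]; Relabel 0 [:: 2; 0; 1; 3; 4; 5] [:: 0; 2; 4; 5]]]]);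
    (4564455697%num, 994975422510800898%num, Peel (F 48) [:: Peel (F 46) [:: Relabel 9 [:: 0; 1; 2; 3; 4; 5]
    [::]; Relabel 6 [:: 0; 1; 2; 3; 5; 4] [:: 1; 2; 4; 5]; Relabel 3 [:: 0; 1; 3; 2; 5; 4] [:: 1; 2; 4; 5];
    Relabel 0 [:: 0; 2; 3; 1; 5; 4] [:: 1; 2; 4; 5]]]);
    (4803839317451010%num, 144150372548608000%num, Peel (F 16) [:: Peel (F 30) [:: Peel (F 0) [:: Peel (F 32)
    [:: Spanning]]]]);
    (4803770597974290%num, 144150372548608000%num, Peel (F 16) [:: Peel (F 30) [:: Peel (F 0) [:: Peel (F 32)
    [:: Spanning]]]]);
    (269553944%num, 475245759315312640%num, Peel (F 4) [:: Peel (F 46) [:: Peel (F 35) [:: Peel (F 73) [::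
    Peel (F 27) [:: Relabel 1 [:: 5; 1; 4; 0; 2; 3] [::]; Relabel 0 [:: 4; 1; 5; 0; 2; 3] [::]]]]]]);
    (4564451601%num, 1003984820788834306%num, Peel (F 13) [:: Relabel 3 [:: 0; 1; 2; 3; 4; 5] [::]; Relabel 0
    [:: 0; 3; 1; 2; 4; 5] [::]; Relabel 29 [:: 3; 5; 4; 0; 2; 1] [::]; Relabel 165 [:: 3; 4; 5; 0; 2; 1]
    [::]]);
    (72076354725679889%num, 563087493038080%num, Peel (F 16) [:: Peel (F 30) [:: Peel (F 0) [:: Peel (F 32)
    [:: Spanning]]]]);
    (72076354740364049%num, 10135298721710080%num, Peel (F 16) [:: Peel (F 30) [:: Peel (F 0) [:: Peel (F 32)
    [:: Spanning]]]]);
    (4504703720231187%num, 308004130738151424%num, Peel (F 16) [:: Relabel 1 [:: 1; 0; 5; 2; 3; 4] [::];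
    Relabel 0 [:: 0; 1; 5; 2; 3; 4] [::]]);
    (4522364340736274%num, 144150373051924480%num, Peel (F 16) [:: Peel (F 30) [:: Peel (F 0) [:: Peel (F 32)
    [:: Spanning]]]]);
    (4522364340605457%num, 567503795257344%num, Peel (F 16) [:: Relabel 0 [:: 1; 0; 5; 2; 3; 4] [::]; Relabel
    62 [:: 0; 5; 1; 2; 3; 4] [::]]);
    (4803839602589984%num, 144115600929587200%num, Peel (F 16) [:: Peel (F 30) [:: Peel (F 0) [:: Peel (F 32)
    [:: Spanning]]]]);
    (76843772718289184%num, 144115600929587200%num, Peel (F 16) [:: Peel (F 30) [:: Peel (F 0) [:: Peel (F 32)
    [:: Spanning]]]]);
    (76861429076988417%num, 9013815182106624%num, Peel (F 30) [:: Relabel 1 [:: 1; 0; 4; 2; 3; 5] [::];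
    Relabel 0 [:: 0; 1; 4; 2; 3; 5] [::]]);
    (17596767342849%num, 994812419895205890%num, Peel (F 35) [:: Peel (F 42) [:: Relabel 5 [:: 0; 2; 1; 3; 4;
    5] [::]; Relabel 3 [:: 2; 5; 0; 1; 3; 4] [::]; Relabel 0 [:: 1; 2; 0; 3; 4; 5] [::]; Relabel 65 [:: 2; 4;
    0; 1; 3; 5] [::]; Relabel 57 [:: 2; 3; 0; 1; 4; 5] [::]]]);
    (73304145992%num, 365129119886753796%num, Peel (F 50) [:: Peel (F 6) [:: Peel (F 28) [:: Relabel 174 [::
    1; 3; 2; 5; 4; 0] [:: 0; 2; 3; 4]; Relabel 289 [:: 2; 1; 3; 0; 4; 5] [:: 0; 1; 4; 5]]]]);
    (73304146952%num, 365129119886753796%num, Peel (F 50) [:: Peel (F 6) [:: Peel (F 5) [:: Relabel 44 [:: 2;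
    1; 4; 5; 3; 0] [:: 0; 1; 2; 3]; Relabel 45 [:: 1; 2; 4; 5; 3; 0] [:: 0; 1; 2; 3]]]]);
    (4564521217%num, 994975422510800898%num, Peel (F 48) [:: Peel (F 46) [:: Relabel 2 [:: 0; 1; 2; 3; 4; 5]
    [::]; Relabel 1 [:: 0; 1; 2; 3; 5; 4] [:: 1; 2; 4; 5]; Relabel 0 [:: 0; 1; 3; 2; 5; 4] [:: 1; 2; 4; 5];
    Relabel 52 [:: 0; 2; 3; 1; 5; 4] [:: 1; 2; 4; 5]]]);
    (4564516881%num, 1003984820788834306%num, Peel (F 46) [:: Relabel 0 [:: 1; 0; 5; 4; 2; 3] [::]; Relabel 45
    [:: 4; 3; 2; 1; 5; 0] [::]; Relabel 176 [:: 4; 2; 3; 1; 5; 0] [::]; Relabel 51 [:: 1; 4; 0; 5; 2; 3]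
    [::]]);
    (269549840%num, 1152921436139089935%num, Peel (F 16) [:: Relabel 176 [:: 0; 1; 2; 3; 4; 5] [:: 1; 2; 3];
    Relabel 176 [:: 0; 2; 1; 3; 5; 4] [:: 1; 2; 3]; Relabel 42 [:: 0; 3; 1; 2; 4; 5] [:: 1; 2; 3]; Relabel 13
    [:: 3; 5; 0; 4; 1; 2] [:: 0; 4; 5]; Relabel 13 [:: 2; 5; 4; 0; 1; 3] [:: 0; 4; 5]; Relabel 0 [:: 1; 5; 0;
    4; 2; 3] [:: 0; 4; 5]; Relabel 176 [:: 3; 4; 5; 0; 1; 2] [::]; Relabel 42 [:: 2; 4; 0; 5; 1; 3] [::];
    Relabel 176 [:: 1; 4; 0; 5; 3; 2] [::]]);
    (69649%num, 1071856711313133312%num, Peel (F 45) [:: Relabel 176 [:: 0; 1; 2; 3; 4; 5] [:: 2; 3; 4];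
    Relabel 176 [:: 0; 2; 1; 4; 3; 5] [:: 2; 3; 4]; Relabel 176 [:: 5; 4; 3; 2; 1; 0] [:: 2; 3; 4]; Relabel
    130 [:: 0; 1; 2; 3; 4; 5] [::]; Relabel 77 [:: 0; 2; 1; 3; 4; 5] [::]; Relabel 176 [:: 5; 3; 4; 1; 2; 0]
    [:: 2; 3; 4]; Relabel 77 [:: 0; 1; 2; 4; 3; 5] [::]; Relabel 130 [:: 0; 2; 1; 4; 3; 5] [::]; Relabel 50
    [:: 0; 1; 2; 5; 3; 4] [:: 1; 2; 3]; Relabel 0 [:: 0; 1; 2; 5; 3; 4] [::]]);
    (268505473%num, 677942952698314752%num, Peel (F 1) [:: Peel (F 27) [:: Relabel 194 [:: 5; 4; 2; 3; 1; 0]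
    [:: 0; 1; 3; 4]; Relabel 193 [:: 1; 0; 4; 3; 2; 5] [:: 0; 2; 3; 5]]]);
    (282583364669736%num, 171172107651121152%num, Peel (F 26) [:: Peel (F 1) [:: Peel (F 74) [:: Peel (F 52)
    [:: Peel (F 25) [:: Spanning]]]]]);
    (17665490453644%num, 73464969458352128%num, Peel (F 50) [:: Peel (F 5) [:: Peel (F 28) [:: Peel (F 6) [::
    Spanning]]]]);
    (18765002048652%num, 5910975047794688%num, Peel (F 50) [:: Peel (F 5) [:: Peel (F 28) [:: Peel (F 6) [::
    Spanning]]]]);
    (72357847756980228%num, 10133099430543360%num, Peel (F 24) [:: Peel (F 31) [:: Peel (F 72) [:: Peel (F 28)
    [:: Spanning]]]]);
    (17665490453640%num, 83107685897142336%num, Peel (F 6) [:: Relabel 2 [:: 5; 3; 4; 1; 2; 0] [:: 0; 1; 2];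
    Relabel 1 [:: 5; 1; 2; 3; 4; 0] [:: 1; 2]; Relabel 0 [:: 0; 5; 1; 2; 3; 4] [::]]);
    (69005805704%num, 326812252055319552%num, Peel (F 1) [:: Peel (F 27) [:: Peel (F 33) [:: Relabel 4 [:: 0;
    2; 3; 1; 4; 5] [:: 1; 2; 4]; Relabel 0 [:: 1; 0; 2; 4; 5; 3] [:: 0; 2; 5]]]]);
  (299155289833745%num, 648518346341351456%num, Peel (F 2) [:: Peel (F 28) [:: Peel (F 22) [:: Spanning]]]);
  (300240260843652%num, 148618787711614976%num, Peel (F 5) [:: Peel (F 41) [:: Peel (F 7) [:: Spanning]]]);
    (69009441921%num, 82781139533627392%num, Peel (F 39) [:: Peel (F 35) [:: Peel (F 75) [:: Peel (F 54) [::
    Relabel 1 [:: 5; 2; 3; 4; 1; 0] [:: 0; 2; 3]; Relabel 0 [:: 4; 0; 1; 5; 3; 2] [:: 3]]]]]);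
    (17665490453644%num, 73464977511415808%num, Peel (F 50) [:: Peel (F 5) [:: Peel (F 28) [:: Peel (F 6) [::
    Spanning]]]]);
    (18765002048712%num, 5910975047794688%num, Peel (F 50) [:: Peel (F 5) [:: Peel (F 28) [:: Peel (F 6) [::
    Spanning]]]]);
    (72357847756980228%num, 9007474401116160%num, Peel (F 24) [:: Peel (F 31) [:: Peel (F 72) [:: Peel (F 28)
    [:: Spanning]]]]);
    (17665490453640%num, 83037334332835840%num, Peel (F 6) [:: Relabel 2 [:: 5; 3; 4; 1; 2; 0] [:: 0; 1; 2];
    Relabel 1 [:: 5; 1; 2; 3; 4; 0] [:: 1; 2]; Relabel 0 [:: 0; 5; 1; 2; 3; 4] [::]]);
    (73300773000%num, 326812239707287556%num, Peel (F 27) [:: Peel (F 33) [:: Relabel 12 [:: 0; 2; 3; 1; 4; 5]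
    [:: 1; 2; 4]; Relabel 0 [:: 1; 0; 2; 4; 5; 3] [:: 0; 2; 5]]]);
    (18764733646024%num, 5910975047794688%num, Peel (F 50) [:: Peel (F 5) [:: Peel (F 28) [:: Peel (F 6) [::
    Spanning]]]]);
    (18765002081412%num, 73464977511415808%num, Peel (F 50) [:: Peel (F 5) [:: Peel (F 28) [:: Peel (F 6) [::
    Spanning]]]]);
    (76579972407640068%num, 1688884220067840%num, Peel (F 24) [:: Peel (F 31) [:: Peel (F 72) [:: Peel (F 28)
    [:: Spanning]]]]);
    (1172816037000%num, 150694665656483856%num, Peel (F 6) [:: Relabel 2 [:: 5; 3; 4; 1; 2; 0] [:: 0; 1; 2];
    Relabel 1 [:: 5; 1; 2; 3; 4; 0] [:: 1; 2]; Relabel 0 [:: 0; 5; 1; 2; 3; 4] [::]]);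
    (1172799242514%num, 348008624380969984%num, Peel (F 29) [:: Relabel 0 [:: 0; 1; 3; 2; 4; 5] [:: 1; 2; 3;
    5]; Relabel 17 [:: 2; 4; 0; 5; 3; 1] [:: 1; 3; 5]]);
    (282583096234274%num, 162164840482209792%num, Peel (F 16) [:: Peel (F 30) [:: Peel (F 32) [:: Peel (F 52)
    [:: Peel (F 25) [:: Peel (F 76) [:: Spanning]]]]]]);
    (1172547568776%num, 150677074275749888%num, Peel (F 65) [:: Relabel 1 [:: 0; 4; 1; 3; 2; 5] [:: 1; 2; 3];
    Relabel 0 [:: 1; 2; 0; 5; 3; 4] [:: 0; 1; 3; 4]]);
    (69009441920%num, 83063168561315853%num, Peel (F 39) [:: Relabel 12 [:: 5; 4; 3; 2; 1; 0] [:: 0; 1; 2];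
    Relabel 7 [:: 3; 5; 4; 0; 1; 2] [:: 1; 2; 4; 5]; Relabel 0 [:: 0; 2; 1; 3; 4; 5] [::]]);
    (286328968%num, 407957103538385920%num, Peel (F 40) [:: Relabel 16 [:: 0; 1; 2; 3; 4; 5] [::]; Relabel 0
    [:: 0; 2; 1; 3; 5; 4] [:: 2; 3; 4]]);
    (282652091368580%num, 76737115593637888%num, Peel (F 77) [:: Peel (F 6) [:: Relabel 16 [:: 2; 0; 1; 5; 4;
    3] [:: 5]; Relabel 15 [:: 5; 3; 4; 2; 1; 0] [:: 0; 1; 4]]]);
    (282652074656132%num, 90212730136428544%num, Peel (F 4) [:: Peel (F 78) [:: Peel (F 7) [:: Peel (F 44) [::
    Peel (F 79) [:: Spanning]]]]]);
    (68992181252%num, 397471258813399184%num, Peel (F 24) [:: Peel (F 49) [:: Peel (F 14) [:: Peel (F 75) [::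
    Relabel 1 [:: 1; 5; 4; 2; 0; 3] [:: 3]; Relabel 0 [:: 2; 0; 3; 1; 5; 4] [:: 0; 3; 4; 5]]]]]);
    (1172816053384%num, 293050635127881728%num, Peel (F 50) [:: Peel (F 5) [:: Peel (F 28) [:: Peel (F 6) [::
    Spanning]]]]);
    (18765001819272%num, 360571644189605888%num, Peel (F 50) [:: Peel (F 5) [:: Peel (F 28) [:: Peel (F 6) [::
    Spanning]]]]);
    (76579972407641088%num, 1688884220067840%num, Peel (F 24) [:: Peel (F 31) [:: Peel (F 72) [:: Peel (F 28)
    [:: Spanning]]]]);
    (1172816037000%num, 437799141901352976%num, Peel (F 37) [:: Relabel 2 [:: 0; 1; 2; 3; 4; 5] [::]; Relabel
    1 [:: 0; 3; 4; 1; 2; 5] [:: 5]; Relabel 0 [:: 0; 5; 1; 2; 3; 4] [::]]);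
    (1172799242514%num, 487620212829455360%num, Peel (F 29) [:: Relabel 0 [:: 0; 1; 3; 2; 4; 5] [:: 1; 2; 3;
    5]; Relabel 29 [:: 2; 4; 0; 5; 3; 1] [:: 1; 3; 5]]);
    (68989035524%num, 902154792527200448%num, Peel (F 1) [:: Peel (F 4) [:: Peel (F 8) [:: Relabel 0 [:: 5; 3;
    1; 2; 4; 0] [:: 2; 4]; Relabel 11 [:: 1; 4; 5; 0; 2; 3] [:: 1; 2; 4]]]]);
    (69008917633%num, 82781156714020864%num, Peel (F 39) [:: Peel (F 35) [:: Peel (F 54) [:: Relabel 8 [:: 4;
    5; 3; 1; 0; 2] [:: 0; 1; 5]; Relabel 7 [:: 1; 0; 2; 4; 5; 3] [:: 2; 5]]]]);
    (300357868716352%num, 76561262384777216%num, Peel (F 0) [:: Peel (F 1) [:: Peel (F 2) [:: Peel (F 3) [::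
    Spanning]]]]);
    (281552572457234%num, 441398943039881248%num, Peel (F 13) [:: Relabel 0 [:: 2; 4; 5; 0; 1; 3] [:: 1; 2;
    4]; Relabel 395 [:: 0; 2; 1; 3; 4; 5] [:: 1; 2]; Relabel 394 [:: 0; 2; 1; 3; 5; 4] [:: 1; 2]]);
    (281548545345668%num, 653045035792597056%num, Peel (F 17) [:: Relabel 0 [:: 0; 1; 2; 3; 4; 5] [:: 1; 2];
    Relabel 393 [:: 1; 2; 0; 4; 5; 3] [:: 3; 4; 5]]);
    (69008983168%num, 82782251930615817%num, Peel (F 35) [:: Peel (F 37) [:: Relabel 392 [:: 2; 0; 1; 5; 3; 4]
    [:: 0; 3; 5]; Relabel 0 [:: 4; 3; 5; 1; 0; 2] [:: 0; 2; 5]]]);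
    (281548528568340%num, 653046135334633472%num, Peel (F 13) [:: Peel (F 20) [:: Relabel 12 [:: 0; 1; 2; 3;
    5; 4] [::]; Relabel 13 [:: 3; 5; 4; 0; 1; 2] [:: 0; 1; 2]]]);
    (281548595677204%num, 580988541229596672%num, Peel (F 13) [:: Peel (F 19) [:: Peel (F 20) [:: Relabel 30
    [:: 3; 1; 0; 5; 4; 2] [:: 3; 4; 5]; Relabel 31 [:: 5; 2; 4; 3; 0; 1] [:: 0; 1; 3]]]]);
  (4803853346161170%num, 72059797356150784%num, Peel (F 2) [:: Peel (F 22) [:: Peel (F 23) [:: Spanning]]]);
    (282579077171272%num, 292769366309650688%num, Peel (F 5) [:: Peel (F 56) [:: Peel (F 28) [:: Relabel 0 [::
    0; 3; 5; 1; 2; 4] [:: 2; 4]; Relabel 394 [:: 0; 3; 1; 2; 5; 4] [:: 2; 4; 5]]]]);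
    (282652074590596%num, 99237521577803776%num, Peel (F 7) [:: Relabel 17 [:: 2; 5; 4; 1; 0; 3] [:: 0; 2; 3;
    5]; Relabel 16 [:: 1; 0; 3; 2; 5; 4] [:: 0; 2; 4]]);
    (281548595677188%num, 725103729326424272%num, Peel (F 4) [:: Relabel 3 [:: 3; 4; 5; 0; 1; 2] [:: 0; 1; 2];
    Relabel 1 [:: 2; 1; 0; 5; 4; 3] [:: 1; 3]; Relabel 0 [:: 0; 3; 4; 2; 1; 5] [:: 1; 2; 3; 4]]);
    (282652075114884%num, 81223123017401344%num, Peel (F 54) [:: Peel (F 5) [:: Relabel 3 [:: 3; 5; 1; 4; 0;
    2] [:: 2; 3]; Relabel 397 [:: 3; 5; 4; 0; 1; 2] [:: 0; 1; 2]]]);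
    (300173185130564%num, 148618856422704384%num, Peel (F 5) [:: Peel (F 8) [:: Peel (F 9) [:: Peel (F 19) [::
    Peel (F 10) [:: Spanning]]]]]);
    (282579077169224%num, 436884554385508608%num, Peel (F 5) [:: Peel (F 25) [:: Relabel 1 [:: 3; 1; 0; 4; 5;
    2] [:: 3]; Relabel 0 [:: 3; 1; 0; 5; 4; 2] [:: 1; 5]]]);
    (281548528568324%num, 797162422943088848%num, Peel (F 6) [:: Relabel 8 [:: 0; 1; 2; 3; 4; 5] [::]; Relabel
    8 [:: 0; 2; 1; 3; 5; 4] [::]; Relabel 3 [:: 0; 1; 2; 3; 4; 5] [::]; Relabel 0 [:: 5; 4; 3; 2; 1; 0] [:: 0;
    2; 3]; Relabel 0 [:: 4; 5; 3; 1; 2; 0] [:: 0; 2; 3]]);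
    (69008917632%num, 83064835009216525%num, Peel (F 35) [:: Relabel 14 [:: 5; 4; 3; 2; 1; 0] [:: 0; 1; 2];
    Relabel 10 [:: 3; 4; 5; 0; 1; 2] [:: 0; 2; 4]; Relabel 14 [:: 3; 4; 5; 0; 1; 2] [:: 0; 2; 4]; Relabel 0
    [:: 1; 0; 2; 4; 3; 5] [:: 2; 4]]);
    (286265632%num, 463146625838546955%num, Peel (F 0) [:: Relabel 25 [:: 0; 3; 1; 2; 4; 5] [:: 2; 3; 4];
    Relabel 22 [:: 5; 4; 2; 1; 3; 0] [:: 1; 4]; Relabel 16 [:: 4; 5; 3; 1; 2; 0] [:: 1; 4]; Relabel 0 [:: 0;
    1; 3; 2; 5; 4] [:: 1; 2; 4; 5]]);
    (268505345%num, 1004001373604282544%num, Peel (F 0) [:: Relabel 49 [:: 0; 1; 2; 3; 4; 5] [::]; Relabel 49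
    [:: 0; 2; 1; 3; 5; 4] [::]; Relabel 49 [:: 4; 5; 1; 3; 2; 0] [::]; Relabel 0 [:: 0; 3; 1; 2; 5; 4] [::];
    Relabel 0 [:: 5; 3; 4; 2; 0; 1] [::]; Relabel 49 [:: 2; 5; 0; 3; 4; 1] [::]; Relabel 0 [:: 2; 3; 0; 5; 4;
    1] [::]; Relabel 0 [:: 4; 3; 5; 1; 0; 2] [::]; Relabel 0 [:: 1; 3; 0; 4; 5; 2] [::]; Relabel 49 [:: 1; 4;
    0; 3; 5; 2] [::]]);
    (73283159112%num, 293051734664677376%num, Peel (F 24) [:: Peel (F 50) [:: Peel (F 31) [:: Peel (F 5) [::
    Peel (F 14) [:: Peel (F 28) [:: Peel (F 6) [:: Peel (F 29) [:: Spanning]]]]]]]]);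
    (73287091272%num, 293051734656811136%num, Peel (F 24) [:: Peel (F 50) [:: Peel (F 31) [:: Peel (F 5) [::
    Peel (F 14) [:: Peel (F 28) [:: Peel (F 6) [:: Peel (F 29) [:: Spanning]]]]]]]]);
    (4564520978%num, 456663875268379136%num, Peel (F 42) [:: Relabel 321 [:: 0; 2; 1; 3; 4; 5] [:: 1; 2; 3];
    Relabel 1 [:: 0; 2; 1; 3; 4; 5] [:: 1; 2; 4; 5]; Relabel 0 [:: 0; 2; 1; 3; 5; 4] [:: 1; 2; 4; 5]]);
    (73283158088%num, 293051734664678400%num, Peel (F 24) [:: Peel (F 50) [:: Peel (F 31) [:: Peel (F 5) [::
    Peel (F 14) [:: Peel (F 28) [:: Peel (F 6) [:: Peel (F 29) [:: Peel (F 80) [:: Spanning]]]]]]]]]);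
    (73283158088%num, 293051734668871680%num, Peel (F 24) [:: Peel (F 50) [:: Peel (F 31) [:: Peel (F 5) [::
    Peel (F 14) [:: Peel (F 28) [:: Peel (F 6) [:: Peel (F 29) [:: Peel (F 80) [:: Spanning]]]]]]]]]);
    (16847232%num, 750351359782420489%num, Peel (F 45) [:: Peel (F 71) [:: Relabel 2 [:: 5; 2; 3; 4; 0; 1] [::
    1; 2; 3]; Relabel 1 [:: 5; 3; 2; 4; 0; 1] [:: 0; 1; 2]; Relabel 0 [:: 5; 2; 3; 4; 0; 1] [:: 0; 3]]]);
    (69889%num, 1004282920857239728%num, Peel (F 45) [:: Relabel 249 [:: 4; 5; 3; 1; 2; 0] [:: 2; 3; 4];
    Relabel 6 [:: 0; 1; 2; 3; 4; 5] [::]; Relabel 0 [:: 5; 3; 4; 2; 1; 0] [:: 2; 3; 4]; Relabel 135 [:: 1; 0;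
    3; 4; 2; 5] [::]; Relabel 0 [:: 4; 3; 5; 1; 2; 0] [:: 2; 3; 4]; Relabel 135 [:: 2; 0; 3; 5; 1; 4] [::]]);
    (16843009%num, 931663335465726128%num, Peel (F 45) [:: Peel (F 1) [:: Relabel 195 [:: 1; 0; 4; 2; 3; 5]
    [::]; Relabel 388 [:: 5; 3; 4; 2; 0; 1] [::]; Relabel 242 [:: 5; 2; 4; 3; 0; 1] [::]; Relabel 190 [:: 2;
    3; 5; 1; 0; 4] [::]]]);
    (68989042946%num, 306615331655254144%num, Peel (F 30) [:: Peel (F 24) [:: Peel (F 42) [:: Peel (F 13) [::
    Peel (F 43) [:: Peel (F 44) [:: Relabel 386 [:: 1; 0; 2; 3; 4; 5] [:: 0; 2; 3]; Relabel 385 [:: 2; 5; 0;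
    1; 3; 4] [:: 3]]]]]]]);
    (69005805576%num, 326848527349096640%num, Peel (F 1) [:: Peel (F 27) [:: Peel (F 56) [:: Relabel 28 [:: 3;
    5; 0; 4; 2; 1] [:: 0; 1; 3; 5]; Relabel 39 [:: 0; 2; 3; 1; 4; 5] [:: 1; 2; 4]]]]);
    (72357847756980352%num, 27021598033182720%num, Peel (F 24) [:: Peel (F 31) [:: Peel (F 72) [:: Peel (F 28)
    [:: Spanning]]]]);
    (17665490453640%num, 117949010358108224%num, Peel (F 6) [:: Relabel 34 [:: 5; 4; 3; 1; 2; 0] [:: 0; 1; 2];
    Relabel 33 [:: 5; 1; 2; 4; 3; 0] [:: 1; 2]; Relabel 0 [:: 0; 5; 1; 2; 3; 4] [::]]);
    (69005805704%num, 326848527349097472%num, Peel (F 1) [:: Peel (F 27) [:: Peel (F 33) [:: Relabel 61 [:: 0;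
    2; 3; 1; 4; 5] [:: 1; 2; 4]; Relabel 0 [:: 1; 0; 2; 4; 5; 3] [:: 0; 2; 5]]]]);
    (74106083336%num, 329912861960699984%num, Peel (F 59) [:: Peel (F 28) [:: Peel (F 15) [:: Peel (F 81) [::
    Relabel 390 [:: 0; 2; 3; 4; 1; 5] [:: 3]; Relabel 391 [:: 4; 3; 0; 1; 5; 2] [:: 1; 4; 5]]]]]);
    (17665490453644%num, 648799821854932992%num, Peel (F 50) [:: Peel (F 5) [:: Peel (F 28) [:: Peel (F 6) [::
    Spanning]]]]);
    (18765002048652%num, 581245827444375552%num, Peel (F 50) [:: Peel (F 5) [:: Peel (F 28) [:: Peel (F 6) [::
    Spanning]]]]);
    (72357847756981248%num, 10133101577502720%num, Peel (F 24) [:: Peel (F 31) [:: Peel (F 72) [:: Peel (F 28)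
    [:: Spanning]]]]);
    (17665490453640%num, 370212162142273536%num, Peel (F 6) [:: Relabel 2 [:: 5; 3; 4; 1; 2; 0] [:: 0; 1; 2];
    Relabel 1 [:: 5; 1; 2; 3; 4; 0] [:: 1; 2]; Relabel 0 [:: 0; 5; 1; 2; 3; 4] [::]]);
    (73303884936%num, 370229754328842240%num, Peel (F 14) [:: Peel (F 34) [:: Relabel 0 [:: 0; 1; 2; 3; 4; 5]
    [::]; Relabel 67 [:: 1; 2; 5; 0; 3; 4] [:: 0; 1; 2; 5]]]);
    (1172547568776%num, 167565572878389248%num, Peel (F 65) [:: Relabel 38 [:: 0; 4; 1; 3; 2; 5] [:: 1; 2; 3];
    Relabel 49 [:: 1; 2; 0; 5; 3; 4] [:: 0; 1; 3; 4]]);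
    (69008917640%num, 370266059687395328%num, Peel (F 14) [:: Relabel 6 [:: 0; 2; 1; 3; 4; 5] [:: 1; 3; 4];
    Relabel 1 [:: 5; 4; 3; 2; 1; 0] [:: 0; 1; 2]; Relabel 0 [:: 0; 1; 2; 4; 3; 5] [::]]);
    (68989034754%num, 460901010894749856%num, Peel (F 35) [:: Relabel 8 [:: 5; 4; 3; 2; 1; 0] [::]; Relabel 0
    [:: 2; 0; 1; 5; 3; 4] [:: 0; 3]]);
    (68988961026%num, 460901010894839968%num, Peel (F 5) [:: Peel (F 35) [:: Relabel 13 [:: 0; 1; 2; 3; 4; 5]
    [::]; Relabel 12 [:: 1; 2; 0; 4; 5; 3] [:: 0; 1; 5]; Relabel 0 [:: 3; 5; 4; 0; 2; 1] [:: 0; 4; 5]]]);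
    (268505104%num, 1071555355133085451%num, Peel (F 35) [:: Relabel 250 [:: 0; 2; 3; 1; 4; 5] [::]; Relabel
    372 [:: 4; 2; 1; 5; 0; 3] [::]; Relabel 250 [:: 3; 5; 1; 0; 2; 4] [::]; Relabel 372 [:: 1; 3; 4; 0; 5; 2]
    [::]; Relabel 0 [:: 1; 4; 0; 3; 5; 2] [:: 0; 4; 5]; Relabel 205 [:: 2; 4; 0; 5; 1; 3] [::]]);
    (4113%num, 1071856711313854208%num, Peel (F 82) [:: Relabel 250 [:: 0; 1; 2; 3; 5; 4] [:: 1; 2; 4];
    Relabel 75 [:: 0; 1; 2; 3; 4; 5] [::]; Relabel 17 [:: 0; 1; 2; 3; 5; 4] [::]; Relabel 250 [:: 5; 4; 3; 2;
    0; 1] [:: 0; 3; 5]; Relabel 16 [:: 0; 1; 3; 2; 4; 5] [:: 1; 3; 5]; Relabel 365 [:: 4; 2; 5; 3; 0; 1] [::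
    0; 1; 5]; Relabel 17 [:: 5; 4; 3; 2; 0; 1] [::]; Relabel 365 [:: 1; 3; 0; 2; 5; 4] [:: 0; 1; 5]; Relabel 0
    [:: 0; 2; 1; 4; 3; 5] [::]; Relabel 16 [:: 1; 0; 2; 3; 5; 4] [::]]);
    (16781632%num, 907943070754275337%num, Peel (F 1) [:: Relabel 19 [:: 0; 1; 3; 2; 5; 4] [::]; Relabel 19
    [:: 1; 0; 3; 2; 5; 4] [::]]);
    (4368%num, 1071836920100356107%num, Peel (F 45) [:: Relabel 0 [:: 4; 5; 2; 3; 0; 1] [:: 2; 3; 5]; Relabel
    18 [:: 1; 0; 3; 4; 2; 5] [::]; Relabel 18 [:: 1; 0; 3; 5; 2; 4] [::]; Relabel 401 [:: 0; 1; 2; 4; 3; 5]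
    [:: 1; 2; 3]; Relabel 19 [:: 1; 0; 3; 4; 2; 5] [::]; Relabel 401 [:: 0; 1; 2; 5; 3; 4] [:: 1; 2; 3];
    Relabel 19 [:: 1; 0; 3; 5; 2; 4] [::]]);
    (17%num, 1152921504606846720%num, Peel (F 0) [:: Relabel 419 [:: 0; 1; 2; 5; 3; 4] [:: 1; 4; 5]; Relabel
    274 [:: 0; 1; 2; 3; 4; 5] [:: 2; 4]; Relabel 2 [:: 0; 1; 2; 4; 3; 5] [:: 2; 3; 4; 5]; Relabel 0 [:: 0; 1;
    2; 5; 3; 4] [:: 2; 3; 4; 5]; Relabel 274 [:: 0; 1; 3; 2; 5; 4] [:: 3; 5]; Relabel 0 [:: 0; 1; 3; 4; 2; 5]
    [:: 1; 2; 3]; Relabel 274 [:: 0; 1; 3; 5; 2; 4] [:: 3; 5]; Relabel 2 [:: 0; 1; 4; 2; 5; 3] [:: 2; 3; 4;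
    5]; Relabel 0 [:: 0; 1; 4; 3; 2; 5] [:: 1; 4; 5]; Relabel 2 [:: 0; 1; 4; 5; 2; 3] [:: 2; 3; 4; 5]; Relabel
    0 [:: 0; 1; 5; 2; 3; 4] [:: 2; 3; 4; 5]; Relabel 274 [:: 0; 1; 5; 3; 4; 2] [:: 2; 4]; Relabel 2 [:: 0; 1;
    5; 4; 3; 2] [:: 2; 3; 4; 5]]);
    (16843008%num, 1075778523541582011%num, Peel (F 45) [:: Peel (F 4) [:: Relabel 210 [:: 0; 1; 3; 2; 4; 5]
    [::]; Relabel 377 [:: 1; 0; 4; 2; 3; 5] [::]; Relabel 377 [:: 4; 5; 1; 3; 2; 0] [::]; Relabel 255 [:: 0;
    3; 1; 2; 5; 4] [::]; Relabel 255 [:: 2; 5; 0; 1; 4; 3] [::]; Relabel 5 [:: 1; 4; 2; 0; 3; 5] [:: 0; 4;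
    5]]]);
    (4112%num, 1071856711313854219%num, Peel (F 45) [:: Relabel 368 [:: 0; 1; 2; 3; 4; 5] [:: 1; 3]; Relabel
    368 [:: 0; 2; 1; 4; 3; 5] [:: 1; 3]; Relabel 368 [:: 4; 5; 2; 3; 0; 1] [:: 2; 3; 5]; Relabel 0 [:: 0; 1;
    3; 2; 4; 5] [::]; Relabel 2 [:: 2; 4; 0; 5; 1; 3] [::]; Relabel 368 [:: 3; 5; 1; 4; 0; 2] [:: 2; 3; 5];
    Relabel 2 [:: 1; 3; 0; 5; 2; 4] [::]; Relabel 0 [:: 0; 2; 4; 1; 3; 5] [::]; Relabel 0 [:: 0; 1; 2; 5; 3;
    4] [:: 1; 2; 3]; Relabel 4 [:: 1; 3; 0; 5; 2; 4] [::]]);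
    (1%num, 1152921504606846960%num, Peel (F 49) [:: Relabel 276 [:: 0; 1; 2; 3; 4; 5] [:: 3; 4; 5]; Relabel
    276 [:: 0; 1; 2; 3; 5; 4] [:: 3]; Relabel 2 [:: 4; 5; 0; 1; 2; 3] [::]; Relabel 0 [:: 0; 1; 2; 4; 3; 5]
    [:: 3; 5]; Relabel 0 [:: 0; 1; 2; 5; 3; 4] [::]; Relabel 2 [:: 4; 5; 0; 1; 3; 2] [::]; Relabel 0 [:: 0; 1;
    3; 4; 2; 5] [:: 3; 5]; Relabel 0 [:: 0; 1; 3; 5; 2; 4] [::]; Relabel 0 [:: 0; 1; 4; 2; 5; 3] [:: 2; 4];
    Relabel 0 [:: 0; 1; 4; 3; 5; 2] [:: 2; 4]; Relabel 276 [:: 2; 3; 0; 1; 4; 5] [:: 1; 4]; Relabel 0 [:: 0;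
    1; 5; 2; 4; 3] [::]; Relabel 0 [:: 0; 1; 5; 3; 4; 2] [::]; Relabel 276 [:: 2; 3; 0; 1; 5; 4] [:: 1; 5]]);
    (0%num, 1152921504606846975%num, Peel (F 11) [:: Relabel 0 [:: 0; 1; 2; 3; 4; 5] [:: 5]; Relabel 0 [:: 0;
    1; 2; 4; 3; 5] [:: 5]; Relabel 0 [:: 0; 1; 2; 5; 3; 4] [:: 5]; Relabel 0 [:: 0; 2; 1; 3; 4; 5] [::];
    Relabel 0 [:: 0; 2; 1; 4; 3; 5] [::]; Relabel 0 [:: 0; 2; 1; 5; 3; 4] [::]; Relabel 0 [:: 0; 3; 1; 2; 4;
    5] [:: 5]; Relabel 0 [:: 0; 3; 1; 4; 2; 5] [:: 3]; Relabel 0 [:: 0; 3; 1; 5; 2; 4] [:: 3]; Relabel 0 [::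
    0; 4; 1; 2; 3; 5] [:: 5]; Relabel 0 [:: 0; 4; 1; 3; 2; 5] [:: 1; 5]; Relabel 0 [:: 0; 4; 1; 5; 2; 3] [::
    3]; Relabel 0 [:: 0; 5; 1; 2; 3; 4] [:: 5]; Relabel 0 [:: 0; 5; 1; 3; 2; 4] [:: 1; 5]; Relabel 0 [:: 0; 5;
    1; 4; 2; 3] [:: 3]])
]%N.

Lemma peeling_verified : verify_all [::] peeling.
Proof. by vm_compute. Qed.

Lemma settled_all (R : realFieldType) : settled R [::] signed_matchings.
Proof. exact: verify_allP peeling_verified. Qed.

(** * Farkas' lemma *)

Definition inner (R : comPzRingType) (I : finType) (w v : I -> R) : R := \sum_i w i * v i.

Lemma innerBZ (R : comPzRingType) (I : finType) (w v v' : I -> R) a :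
  inner w (fun i => v i - a * v' i) = inner w v - a * inner w v'.
Proof.
rewrite /inner mulr_sumr -sumrB; apply: eq_bigr => i _; ring.
Qed.

Lemma innerBZl (R : comPzRingType) (I : finType) (w w' v : I -> R) a :
  inner (fun i => w i - a * w' i) v = inner w v - a * inner w' v.
Proof.
rewrite /inner mulr_sumr -sumrB; apply: eq_bigr => i _; ring.
Qed.

(* By induction on the number of generators: if a separating functional for the others is negative
   on v ord0, project everything along v ord0 onto its kernel. *)
Lemma farkas_alternative (R : realFieldType) (I : finType) m (v : 'I_m -> I -> R) (b : I -> R) :
  (exists2 c : 'I_m -> R, forall k, 0 <= c k & forall i, b i = \sum_k c k * v k i) \/
  (exists2 w : I -> R, forall k, 0 <= inner w (v k) & inner w b < 0).
Proof.
elim: m v b => [|m IH] v b.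
  have [b0|/existsP[i bi]] := boolP [forall i, b i == 0].
    left; exists (fun _ => 0) => // i; rewrite big_ord0; exact/eqP/(forallP b0).
  right; exists (fun i => - b i) => [[]//|].
  rewrite /inner (eq_bigr (fun j => - (b j * b j))) => [|j _]; last by rewrite mulNr.
  have sq0 j : 0 <= b j * b j by rewrite -expr2 sqr_ge0.
  rewrite sumrN oppr_lt0 lt0r sumr_ge0 // andbT psumr_eq0 //.
  by apply/allPn; exists i; rewrite ?mem_index_enum // mulf_eq0 orbb.
pose v0 := v ord0; pose vs k := v (lift ord0 k).
have [[c c0 cb]|[w wv wb]] := IH vs b.
  left; exists (fun k => if unlift ord0 k is Some k' then c k' else 0) => [k|i].
    by case: unliftP.
  rewrite big_ord_recl unlift_none mul0r add0r cb; apply: eq_bigr => k _.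
  by rewrite liftK.
have [wv0|wv0] := lerP 0 (inner w v0).
  right; exists w => // k; case: (unliftP ord0 k) => [j ->|->]; [exact: wv|exact: wv0].
have w0 : inner w v0 != 0 by rewrite lt_eqF.
pose proj (y : I -> R) i := y i - inner w y / inner w v0 * v0 i.
have [[c c0 cb]|[w' wv' wb']] := IH (fun k => proj (vs k)) (proj b).
  (* The coefficient of [v0] undoes the projections. It is nonnegative because [inner w] is negative
     on [v0] and on [b] but nonnegative on every [vs j]. *)
  left; exists (fun k => if unlift ord0 k is Some k' then c k' else
                 inner w b / inner w v0 - \sum_j c j * (inner w (vs j) / inner w v0)).
    move=> k; case: unliftP => // _; rewrite subr_ge0; apply: (@le_trans _ _ 0).
      apply: sumr_le0 => j _; rewrite mulr_ge0_le0 // mulr_ge0_le0 ?wv //.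
      by rewrite invr_le0 ltW.
    by rewrite mulr_le0 ?invr_le0 ?ltW.
  move=> i; rewrite big_ord_recl unlift_none.
  have := cb i; rewrite /proj => /eqP; rewrite subr_eq => /eqP ->.
  under eq_bigr do rewrite mulrBr.
  rewrite [X in _ = _ + X](eq_bigr (fun j => c j * vs j i)); last by move=> j _; rewrite liftK.
  have -> : \sum_j (c j * vs j i - c j * (inner w (vs j) / inner w v0 * v0 i))
      = \sum_j c j * vs j i - (\sum_j c j * (inner w (vs j) / inner w v0)) * v0 i.
    by rewrite sumrB mulr_suml; congr (_ - _); apply: eq_bigr => j _; rewrite mulrA.
  by rewrite -/v0; ring.
(* This is [w'] composed with the projection, so it vanishes on [v0]. *)
right; exists (fun i => w' i - inner w' v0 / inner w v0 * w i).
  have E y : inner (fun i => w' i - inner w' v0 / inner w v0 * w i) y = inner w' (proj y).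
    by rewrite innerBZl innerBZ; field.
  move=> k; rewrite E; case: (unliftP ord0 k) => [j ->|->]; first exact: wv'.
  by rewrite -/v0 innerBZ divff // mul1r subrr.
by rewrite innerBZl; move: wb'; rewrite innerBZ; congr (_ < 0); field.
Qed.

(** * Bell projections and Pauli operators *)

Definition pauli (R : realType) (a : nat) : 'M[R[i]]_2 :=
  match a with 0 => 1%:M | 1 => sigma_x R | 2 => sigma_y R | _ => sigma_z R end%N.

(* Eigenvalue signs of S_a (x) S_a on the Bell vectors. *)
Definition bell_sign (k a : nat) : bool :=
  nth false (nth [::] [:: [:: false; false; true; false]; [:: false; true; false; false];
                          [:: false; false; false; true]; [:: false; true; true; true]] k) a.

(* [Defs] uses two different terms for the imaginary unit in [sigma_y]. *)
Lemma sigma_yE (R : realType) : sigma_y R = mx2 0 (- 'i) 'i 0.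
Proof. by rewrite /sigma_y complexiE. Qed.

Lemma adjmxE (R : realType) m n (A : 'M[R[i]]_(m, n)) i j : adjmx A i j = (A j i)^*.
Proof. by rewrite !mxE. Qed.

Lemma adjmxM (R : realType) m n p (A : 'M[R[i]]_(m, n)) (B : 'M[R[i]]_(n, p)) :
  adjmx (A *m B) = adjmx B *m adjmx A.
Proof. by rewrite /adjmx map_mxM trmx_mul. Qed.

Lemma adjmxK (R : realType) m n (A : 'M[R[i]]_(m, n)) : adjmx (adjmx A) = A.
Proof. by apply/matrixP => i j; rewrite !adjmxE conjCK. Qed.

Lemma adjmx_tens (R : realType) m n p q (A : 'M[R[i]]_(m, n)) (B : 'M[R[i]]_(p, q)) :
  adjmx (A *t B) = adjmx A *t adjmx B.
Proof. by rewrite /adjmx map_mxT trmx_tens. Qed.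

Lemma pauli_adj (R : realType) a : adjmx (pauli R a) = pauli R a.
Proof.
apply/matrixP => i j; rewrite adjmxE.
case: a => [|[|[|a]]]; rewrite /pauli ?sigma_yE !mxE.
- by rewrite rmorph_nat eq_sym.
all: by case: i => [[|[|//]] ?]; case: j => [[|[|//]] ?] /=;
  rewrite ?conjC0 ?conjC1 ?rmorphN /= ?conjCi ?opprK ?conjC1.
Qed.

Lemma pauli_sq (R : realType) a : pauli R a *m pauli R a = 1%:M.
Proof.
case: a => [|[|[|a]]]; rewrite /pauli ?sigma_yE; first by rewrite mulmx1.
all: apply/matrixP => i j; rewrite !mxE !big_ord_recl big_ord0 !mxE /=.
all: have ii : ('i : R[i]) * 'i = -1 by rewrite -expr2 sqrCi.
all: by case: i => [[|[|//]] ?]; case: j => [[|[|//]] ?] /=;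
  rewrite ?mulNr ?mulrN ?ii ?opprK ?mul0r ?mulr0 ?mul1r ?mulr1 ?addr0 ?add0r ?oppr0 ?subr0 ?addr0 ?opprK.
Qed.

Definition bell_entry (k i : nat) : int :=
  nth 0 (nth [::] [:: [:: 1; 0; 0; 1]; [:: 1; 0; 0; -1];
                      [:: 0; 1; 1; 0]; [:: 0; 1; -1; 0]] k) i.

Lemma ket_tensE (R : realType) a b (i : 'I_(2 * 2)) :
  (ket R a *t ket R b) i 0 = (((mxtens_unindex i).1 == a) && ((mxtens_unindex i).2 == b))%:R.
Proof. by rewrite !mxE /= !andbT -natrM mulnb. Qed.

Lemma oppmxE (V : zmodType) m n (A : 'M[V]_(m, n)) i j : (- A) i j = - A i j.
Proof. by rewrite mxE. Qed.

Lemma addmxE (V : nmodType) m n (A B : 'M[V]_(m, n)) i j : (A + B) i j = A i j + B i j.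
Proof. by rewrite mxE. Qed.

Lemma scalemxE (K : pzRingType) m n (c : K) (A : 'M[K]_(m, n)) i j : (c *: A) i j = c * A i j.
Proof. by rewrite mxE. Qed.

Lemma bell_vecE (R : realType) (k : 'I_4) i :
  bell_vec R k i 0 = (bell_entry k i)%:~R.
Proof.
rewrite /bell_vec; case: k => [[|[|[|[|//]]]] pk] /=; rewrite addmxE ?oppmxE !ket_tensE.
all: by case: i => [[|[|[|[|//]]]] pi]; rewrite /bell_entry /=; ring.
Qed.

Lemma bell_vec_real (R : realType) k : adjmx (bell_vec R k) = (bell_vec R k)^T.
Proof. by apply/matrixP => i j; rewrite adjmxE mxE ord1 bell_vecE rmorph_int. Qed.

Lemma bell_vec_orth (R : realType) (k l : 'I_4) :
  adjmx (bell_vec R k) *m bell_vec R l = (2 *+ (k == l))%:M.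
Proof.
rewrite bell_vec_real; apply/matrixP => i j; rewrite !ord1 !mxE eqxx.
under eq_bigr do rewrite mxE !bell_vecE.
rewrite !big_ord_recl !big_ord0.
by case: k => [[|[|[|[|//]]]] pk]; case: l => [[|[|[|[|//]]]] pl]; rewrite /bell_entry /=; ring.
Qed.

(** The tables are integral, since the entries of sigma_y multiply in pairs to real numbers; later
    identities become finite checks by [ring]. [minn a 3] mirrors the default branch of [pauli]. *)
Lemma pauli_tens (R : realType) a i j :
  (pauli R a *t pauli R a) i j =
  nth 0 (nth [::] (nth [::] [::
    [:: [:: 1; 0; 0; 0]; [:: 0; 1; 0; 0]; [:: 0; 0; 1; 0]; [:: 0; 0; 0; 1]];
    [:: [:: 0; 0; 0; 1]; [:: 0; 0; 1; 0]; [:: 0; 1; 0; 0]; [:: 1; 0; 0; 0]];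
    [:: [:: 0; 0; 0; -1]; [:: 0; 0; 1; 0]; [:: 0; 1; 0; 0]; [:: -1; 0; 0; 0]];
    [:: [:: 1; 0; 0; 0]; [:: 0; -1; 0; 0]; [:: 0; 0; -1; 0]; [:: 0; 0; 0; 1]]]
    (minn a 3)) i) j.
Proof.
have ii : ('i : R[i]) * 'i = -1 by rewrite -expr2 sqrCi.
rewrite mxE; case: a => [|[|[|a]]]; rewrite /pauli ?sigma_yE !mxE.
all: case: i => [[|[|[|[|//]]]] pi]; case: j => [[|[|[|[|//]]]] pj].
all: by rewrite /=; ring: ii.
Qed.

(** The four operators commute, and a Bell vector is determined by its signs; averaging the signed
    operators projects onto that line. *)
Lemma bell_projE (R : realType) (k : 'I_4) :
  bell_proj R k = 4^-1 *: \sum_(a < 4) sgn (bell_sign k a) *: (pauli R a *t pauli R a).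
Proof.
have half : (2^-1 : R[i]) = 4^-1 * 2 by field.
rewrite /bell_proj bell_vec_real half -scalerA !big_ord_recl big_ord0 addr0; congr (_ *: _).
apply/matrixP => i j; rewrite scalemxE [(_ *m _) i j]mxE big_ord_recl big_ord0 [_^T _ _]mxE !bell_vecE.
rewrite !addmxE !scalemxE !pauli_tens.
case: k => [[|[|[|[|//]]]] pk].
all: case: i => [[|[|[|[|//]]]] pi]; case: j => [[|[|[|[|//]]]] pj].
all: by rewrite /bell_entry /bell_sign /sgn /=; ring.
Qed.

Lemma sum_tens (V : nmodType) m n (F : 'I_(m * n) -> V) :
  \sum_k F k = \sum_i \sum_j F (mxtens_index (i, j)).
Proof.
rewrite pair_bigA; apply: (reindex (fun p => mxtens_index (p.1, p.2))).
by exists (@mxtens_unindex m n) => k _; rewrite ?mxtens_unindexK ?mxtens_indexK -?surjective_pairing.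
Qed.

Lemma tensmxDl (K : pzRingType) m n p q (A A' : 'M[K]_(m, n)) (B : 'M[K]_(p, q)) :
  (A + A') *t B = A *t B + A' *t B.
Proof. by apply/matrixP => i j; rewrite !mxE mulrDl. Qed.

Lemma tensmxDr (K : pzRingType) m n p q (A : 'M[K]_(m, n)) (B B' : 'M[K]_(p, q)) :
  A *t (B + B') = A *t B + A *t B'.
Proof. by apply/matrixP => i j; rewrite !mxE mulrDr. Qed.

Lemma tensmxZ (K : comPzRingType) m n p q (a b : K) (A : 'M[K]_(m, n)) (B : 'M[K]_(p, q)) :
  (a *: A) *t (b *: B) = (a * b) *: (A *t B).
Proof. by apply/matrixP => i j; rewrite !mxE mulrACA. Qed.

Lemma tensmx_suml (K : pzRingType) m n p q (I : finType) (A : I -> 'M[K]_(m, n)) (B : 'M[K]_(p, q)) :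
  (\sum_i A i) *t B = \sum_i A i *t B.
Proof.
by apply: (big_morph (fun A => A *t B)) => [A1 A2|]; rewrite ?tensmxDl ?tens0mx.
Qed.

Lemma tensmx_sumr (K : pzRingType) m n p q (I : finType) (A : 'M[K]_(m, n)) (B : I -> 'M[K]_(p, q)) :
  A *t (\sum_i B i) = \sum_i A *t B i.
Proof.
by apply: (big_morph (fun B => A *t B)) => [B1 B2|]; rewrite ?tensmxDr ?tensmx0.
Qed.

Lemma tensmx1 (K : pzRingType) m n : (1%:M : 'M[K]_m) *t (1%:M : 'M[K]_n) = 1%:M.
Proof.
apply/matrixP => i j; case: (mxtens_indexP i) => a b; case: (mxtens_indexP j) => c d.
rewrite tensmxE !mxE (can_eq (@mxtens_indexK m n)) xpair_eqE.
by rewrite -natrM mulnb.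
Qed.

Definition index4 (a b c d : 'I_2) : 'I_(2 * 2 * 2 * 2) :=
  mxtens_index (mxtens_index (mxtens_index (a, b), c), d).

Lemma index4P (i : 'I_(2 * 2 * 2 * 2)) : exists a b c d, i = index4 a b c d.
Proof.
case: (mxtens_indexP i) => i3 d; case: (mxtens_indexP i3) => i2 c.
by case: (mxtens_indexP i2) => a b; exists a, b, c, d.
Qed.

Lemma unidx4K a b c d : unidx4 (index4 a b c d) = (a, b, c, d).
Proof. by rewrite /unidx4 /index4 !mxtens_indexK. Qed.

Lemma sum_index4 (V : nmodType) (F : 'I_(2 * 2 * 2 * 2) -> V) :
  \sum_k F k = \sum_a \sum_b \sum_c \sum_d F (index4 a b c d).
Proof. by rewrite sum_tens sum_tens sum_tens. Qed.

Lemma prodABE (R : realType) (X Y : 'M[R[i]]_(2 * 2)) a b c d a' b' c' d' :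
  prodAB X Y (index4 a b c d) (index4 a' b' c' d') =
  X (mxtens_index (a, c)) (mxtens_index (a', c')) *
  Y (mxtens_index (b, d)) (mxtens_index (b', d')).
Proof. by rewrite mxE !unidx4K. Qed.

Lemma tens4E (R : realType) (A B C D : 'M[R[i]]_2) :
  tens4 A B C D = prodAB (A *t C) (B *t D).
Proof.
apply/matrixP => i j; have [a [b [c [d ->]]]] := index4P i.
have [a' [b' [c' [d' ->]]]] := index4P j.
by rewrite prodABE /tens4 /index4 !tensmxE -!mulrA; congr (_ * _); rewrite mulrCA.
Qed.

Lemma prodAB_mul (R : realType) (X Y X' Y' : 'M[R[i]]_(2 * 2)) :
  prodAB X Y *m prodAB X' Y' = prodAB (X *m X') (Y *m Y').
Proof.
apply/matrixP => i j; have [a [b [c [d ->]]]] := index4P i.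
have [a' [b' [c' [d' ->]]]] := index4P j.
rewrite prodABE !mxE sum_index4 !sum_tens mulr_suml; apply: eq_bigr => k _.
rewrite mulr_suml exchange_big /=; apply: eq_bigr => l _.
rewrite mulr_sumr; apply: eq_bigr => k2 _; rewrite mulr_sumr; apply: eq_bigr => l2 _.
by rewrite !prodABE mulrACA.
Qed.

Lemma prodAB_trace (R : realType) (X Y : 'M[R[i]]_(2 * 2)) :
  \tr (prodAB X Y) = \tr X * \tr Y.
Proof.
rewrite /mxtrace sum_index4 !sum_tens mulr_suml; apply: eq_bigr => k _.
rewrite mulr_suml exchange_big /=; apply: eq_bigr => l _.
rewrite mulr_sumr; apply: eq_bigr => k2 _; rewrite mulr_sumr; apply: eq_bigr => l2 _.
by rewrite !prodABE.
Qed.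

(* The two sides live in ['M_(2 * 2 * (2 * 2))] and ['M_(2 * 2 * 2 * 2)]: as in the definition of
   [bell_state], the equation typechecks because both dimensions evaluate to 16. *)
Lemma tens4_assoc (R : realType) (A B C D : 'M[R[i]]_2) :
  (A *t B) *t (C *t D) = tens4 A B C D :> 'M_(2 * 2 * 2 * 2).
Proof.
apply/matrixP => i j; rewrite /tens4 !mxE -!mulrA.
have E1 (k : nat) : (k %/ 4 %/ 2 = k %/ 2 %/ 2 %/ 2)%N by rewrite -!divnMA.
have E2 (k : nat) : (k %/ 4 %% 2 = k %/ 2 %/ 2 %% 2)%N by rewrite -!divnMA.
have E3 (k : nat) : ((k %% 4) %/ 2 = k %/ 2 %% 2)%N by rewrite modn_divl.
have E4 (k : nat) : ((k %% 4) %% 2 = k %% 2)%N by rewrite modn_dvdm.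
by congr (A _ _ * (B _ _ * (C _ _ * D _ _))); apply: val_inj; rewrite /= ?E1 ?E2 ?E3 ?E4.
Qed.

(** * Bell pairs diagonalise the invariant states *)

Definition bell_pair (R : realType) (k l : 'I_4) : 'M[R[i]]_(2 * 2 * 2 * 2) :=
  bell_proj R k *t bell_proj R l.

Definition bell_pair_vec (R : realType) (k l : 'I_4) : 'cV[R[i]]_(2 * 2 * 2 * 2) :=
  bell_vec R k *t bell_vec R l.

Definition pauli_pair (R : realType) (a b : nat) : 'M[R[i]]_(2 * 2) := pauli R a *t pauli R b.

Definition pauli4 (R : realType) (a b : nat) : 'M[R[i]]_(2 * 2 * 2 * 2) :=
  prodAB (pauli_pair R a b) (pauli_pair R a b).

Definition pair_sign (k l a b : nat) : bool := bell_sign k a (+) bell_sign l b.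

Lemma bell_pairE (R : realType) k l :
  bell_pair R k l = 16^-1 *: \sum_(a < 4) \sum_(b < 4) sgn (pair_sign k l a b) *: pauli4 R a b.
Proof.
rewrite /bell_pair !bell_projE tensmxZ; congr (_ *: _); first by rewrite -invfM -natrM.
rewrite tensmx_suml; apply: eq_bigr => a _; rewrite tensmx_sumr; apply: eq_bigr => b _.
rewrite tensmxZ -sgnM; congr (_ *: _).
by rewrite /pauli4 /pauli_pair -tens4E -tens4_assoc.
Qed.

Lemma pauli4C (R : realType) (rho : 'M[R[i]]_(2 * 2 * 2 * 2)) a b :
  in_varrho rho -> pauli4 R a b *m rho = rho *m pauli4 R a b.
Proof.
case=> _ Hcomm; rewrite /pauli4 -tens4E; apply: Hcomm.
  exists ord0, (pauli R a); rewrite expr0 scale1r; split=> //.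
  by case: a => [|[|[|a]]]; [left|right; left|right; right; left|right; right; right].
exists ord0, (pauli R b); rewrite expr0 scale1r; split=> //.
by case: b => [|[|[|b]]]; [left|right; left|right; right; left|right; right; right].
Qed.

(** [bell_pairE] places the projections in the linear span of the symmetry operators. *)
Lemma bell_pairC (R : realType) (rho : 'M[R[i]]_(2 * 2 * 2 * 2)) k l :
  in_varrho rho -> bell_pair R k l *m rho = rho *m bell_pair R k l.
Proof.
move=> Hrho; rewrite bell_pairE -scalemxAl -scalemxAr; congr (_ *: _).
rewrite mulmx_suml mulmx_sumr; apply: eq_bigr => a _.
rewrite mulmx_suml mulmx_sumr; apply: eq_bigr => b _.
by rewrite -scalemxAl -scalemxAr pauli4C.
Qed.

Lemma sum_bell_sign (K : comNzRingType) a : (a < 4)%N ->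
  \sum_(k < 4) sgn (bell_sign k a) = 4 *+ (a == 0)%N :> K.
Proof.
by case: a => [|[|[|[|//]]]] _; rewrite !big_ord_recl big_ord0 /bell_sign /sgn /=; ring.
Qed.

Lemma bell_proj_sum (R : realType) : \sum_(k < 4) bell_proj R k = 1%:M.
Proof.
under eq_bigr do rewrite bell_projE.
rewrite -scaler_sumr exchange_big /=.
under eq_bigr do rewrite -scaler_suml sum_bell_sign ?ltn_ord //.
rewrite big_ord_recl big1 => [|a _]; last by rewrite scale0r.
by rewrite addr0 /= tensmx1 scalerA mulr1n mulVf ?scale1r // pnatr_eq0.
Qed.

Lemma bell_pair_sum (R : realType) : \sum_k \sum_l bell_pair R k l = 1%:M.
Proof.
have E k : \sum_l bell_pair R k l = bell_proj R k *t (1%:M : 'M[R[i]]_(2 * 2)) :> 'M_(2 * 2 * 2 * 2).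
  by rewrite -bell_proj_sum tensmx_sumr.
under eq_bigr do rewrite E.
transitivity ((1%:M : 'M[R[i]]_(2 * 2)) *t (1%:M : 'M[R[i]]_(2 * 2))); last first.
  exact: (@tensmx1 R[i] (2 * 2) (2 * 2)).
by rewrite -bell_proj_sum tensmx_suml.
Qed.

Lemma mul_tens_scalar (K : comPzRingType) (a b : K) :
  (a%:M : 'M[K]_1) *t (b%:M : 'M[K]_1) = (a * b)%:M :> 'M_1.
Proof.
apply/matrixP => i j; rewrite !mxE.
have eq1 (x y : 'I_1) : (x == y) = true by rewrite !ord1 eqxx.
by rewrite !eq1 !mulr1n.
Qed.

Lemma bell_pair_orth (R : realType) (k l k' l' : 'I_4) :
  adjmx (bell_pair_vec R k l) *m bell_pair_vec R k' l' = (4 *+ ((k == k') && (l == l')))%:M.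
Proof.
have -> : adjmx (bell_pair_vec R k l) = adjmx (bell_vec R k) *t adjmx (bell_vec R l).
  exact: (@adjmx_tens R (2 * 2) 1 (2 * 2) 1 (bell_vec R k) (bell_vec R l)).
(* Dimensions are supplied by hand: the tensor product has dimension [1 * 1], which is [1] only by
   computation. *)
have := @tensmx_mul R[i] 1 (2 * 2) 1 (2 * 2) 1 1 (adjmx (bell_vec R k)) (adjmx (bell_vec R l))
  (bell_vec R k') (bell_vec R l').
rewrite !bell_vec_orth mul_tens_scalar => /(@etrans _ _ _ _); apply.
by congr (_%:M); case: (k == k'); case: (l == l'); rewrite ?mulr0 ?mul0r // -natrM.
Qed.

Lemma bell_pair_rank1 (R : realType) k l :
  bell_pair R k l = 4^-1 *: (bell_pair_vec R k l *m adjmx (bell_pair_vec R k l)).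
Proof.
have -> : adjmx (bell_pair_vec R k l) = adjmx (bell_vec R k) *t adjmx (bell_vec R l).
  exact: (@adjmx_tens R (2 * 2) 1 (2 * 2) 1 (bell_vec R k) (bell_vec R l)).
have E := @tensmx_mul R[i] (2 * 2) 1 (2 * 2) 1 (2 * 2) (2 * 2) (bell_vec R k) (bell_vec R l)
  (adjmx (bell_vec R k)) (adjmx (bell_vec R l)).
rewrite [X in _ *: X]E /bell_pair /bell_proj tensmxZ; congr (_ *: _).
by rewrite -invfM -natrM.
Qed.

Definition bell_weight (R : realType) (rho : 'M[R[i]]_(2 * 2 * 2 * 2)) k l : R[i] :=
  \tr (bell_pair R k l *m rho).

Lemma bell_weightE (R : realType) (rho : 'M[R[i]]_(2 * 2 * 2 * 2)) k l :
  bell_weight rho k l =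
  4^-1 * (adjmx (bell_pair_vec R k l) *m rho *m bell_pair_vec R k l) 0 0.
Proof.
rewrite /bell_weight bell_pair_rank1 -scalemxAl mxtraceZ -mulmxA mxtrace_mulC.
by rewrite /mxtrace big_ord_recl big_ord0 addr0.
Qed.

Lemma bell_weight_pair (R : realType) k l k' l' :
  bell_weight (bell_pair R k l) k' l' = ((k == k') && (l == l'))%:R.
Proof.
rewrite bell_weightE bell_pair_rank1 -scalemxAr -scalemxAl mulmxA bell_pair_orth.
rewrite -mulmxA bell_pair_orth -scalar_mxM scalemxE mxE eqxx mulr1n.
rewrite ![_ == k']eq_sym ![_ == l']eq_sym.
by case: (_ && _); rewrite ?mulr0n ?mulr1n; field.
Qed.

Lemma bell_stateE (R : realType) (r : 'M[R[i]]_4) :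
  bell_state r = \sum_k \sum_l r k l *: bell_pair R k l.
Proof. by []. Qed.

Lemma bell_weight_state (R : realType) (r : 'M[R[i]]_4) k l :
  bell_weight (bell_state r) k l = r k l.
Proof.
rewrite bell_stateE /bell_weight mulmx_sumr raddf_sum /= (bigD1 k) //= [X in _ + X]big1 => [|k' kk'].
  rewrite addr0 mulmx_sumr raddf_sum /= (bigD1 l) //= [X in _ + X]big1 => [|l' ll'].
    by rewrite addr0 -scalemxAr mxtraceZ -/(bell_weight _ _ _) bell_weight_pair !eqxx mulr1.
  by rewrite -scalemxAr mxtraceZ -/(bell_weight _ _ _) bell_weight_pair (negPf ll') andbF mulr0.
rewrite mulmx_sumr raddf_sum /= big1 // => l' _.
by rewrite -scalemxAr mxtraceZ -/(bell_weight _ _ _) bell_weight_pair (negPf kk') mulr0.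
Qed.

Lemma sandwich_rank1 (K : comPzRingType) n (v : 'cV[K]_n) (w : 'rV[K]_n) (A : 'M[K]_n) :
  v *m w *m (A *m (v *m w)) = (w *m A *m v) 0 0 *: (v *m w).
Proof.
rewrite -mulmxA; have -> : w *m (A *m (v *m w)) = (w *m A *m v) *m w by rewrite !mulmxA.
by rewrite {1}[w *m A *m v]mx11_scalar mul_scalar_mx -scalemxAr.
Qed.

(** Inserting the resolution of the identity writes [rho] as a sum of terms P rho = P rho P, as each
    P is idempotent and commutes with [rho]; since P has rank one, P rho P is a multiple of P. *)
Lemma varrho_bell_state (R : realType) (rho : 'M[R[i]]_(2 * 2 * 2 * 2)) :
  in_varrho rho -> rho = bell_state (\matrix_(k, l) bell_weight rho k l).
Proof.
move=> Hrho; rewrite -[LHS]mul1mx -bell_pair_sum mulmx_suml bell_stateE.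
apply: eq_bigr => k _; rewrite mulmx_suml; apply: eq_bigr => l _; rewrite mxE.
have idem : bell_pair R k l *m bell_pair R k l = bell_pair R k l.
  rewrite bell_pair_rank1 -scalemxAl -scalemxAr scalerA -mulmxA.
  rewrite [X in _ *m X]mulmxA bell_pair_orth !eqxx mulr1n mul_scalar_mx -scalemxAr scalerA.
  by congr (_ *: _); field.
rewrite -[in LHS]idem -mulmxA (bell_pairC _ _ Hrho) bell_weightE bell_pair_rank1.
rewrite -scalemxAr -scalemxAl -scalemxAr sandwich_rank1 !scalerA.
by rewrite mulrAC.
Qed.

Lemma bell_weight_ge0 (R : realType) (rho : 'M[R[i]]_(2 * 2 * 2 * 2)) k l :
  in_varrho rho -> 0 <= bell_weight rho k l.
Proof.
by case=> [[_ pos _] _]; rewrite bell_weightE mulr_ge0 // invr_ge0 ler0n.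
Qed.

Lemma bell_weight_sum (R : realType) (rho : 'M[R[i]]_(2 * 2 * 2 * 2)) :
  in_varrho rho -> \sum_k \sum_l bell_weight rho k l = 1.
Proof.
case=> [[_ _ <-] _]; rewrite -[in RHS](mul1mx rho) -bell_pair_sum mulmx_suml raddf_sum /=.
by apply: eq_bigr => k _; rewrite mulmx_suml raddf_sum.
Qed.

(** * Correlations of product states *)

(** Spectral theorem: the eigenvectors are the adjoint rows of the diagonalising unitary, and the
    eigenvalues are nonnegative as values of the quadratic form on them. *)
Lemma density_pure (R : realType) n (X : 'M[R[i]]_n) : is_density X ->
  exists (p : 'I_n -> R[i]) (a : 'I_n -> 'cV[R[i]]_n),
    [/\ forall k, 0 <= p k, forall k, adjmx (a k) *m a k = 1%:M
      & X = \sum_k p k *: (a k *m adjmx (a k))].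
Proof.
case=> herm pos _.
have tE m q (A : 'M[R[i]]_(m, q)) : map_mx Num.conj A^T = adjmx A by rewrite /adjmx map_trmx.
have Xn : X \is normalmx by apply/normalmxP; rewrite tE herm.
have /orthomx_spectralP := Xn; have Pu := spectral_unitarymx X.
rewrite invmx_unitary //; move: Pu => /unitarymxP; rewrite !tE.
move: (spectralmx X) (spectral_diag X) => P d PP XE.
pose a k := adjmx (row k P).
have aa k : adjmx (a k) *m a k = 1%:M.
  rewrite /a adjmxK; apply/matrixP => i j; rewrite !ord1.
  have := congr1 (fun M : 'M[R[i]]_n => M k k) PP; rewrite !mxE !eqxx => <-.
  by apply: eq_bigr => l _; rewrite !mxE.
have XE' : X = \sum_k d 0 k *: (a k *m adjmx (a k)).
  apply/matrixP => i j; rewrite [in LHS]XE mxE summxE; apply: eq_bigr => k _.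
  by rewrite mul_mx_diag /a adjmxK !mxE big_ord_recl big_ord0 addr0 !mxE mulrA (mulrC (d 0 k)).
exists (fun k => d 0 k), a; split=> // k.
suff <- : (adjmx (a k) *m X *m a k) 0 0 = d 0 k by [].
rewrite XE' mulmx_sumr mulmx_suml summxE (bigD1 k) //= big1 => [|l lk].
  by rewrite addr0 -scalemxAr -scalemxAl mulmxA aa mul1mx aa !mxE eqxx mulr1.
rewrite -scalemxAr -scalemxAl mulmxA.
suff -> : adjmx (a k) *m a l = 0 by rewrite mul0mx mul0mx scaler0 mxE.
rewrite /a adjmxK; apply/matrixP => i j; rewrite !ord1.
have := congr1 (fun M : 'M[R[i]]_n => M k l) PP; rewrite !mxE eq_sym (negPf lk) mulr0n.
by apply: etrans; apply: eq_bigr => m _; rewrite !mxE.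
Qed.

Definition expectation (R : realType) (v : 'cV[R[i]]_(2 * 2)) (a b : nat) : R[i] :=
  (adjmx v *m pauli_pair R a b *m v) 0 0.

Lemma expectation_trace (R : realType) (v : 'cV[R[i]]_(2 * 2)) a b :
  \tr (pauli_pair R a b *m (v *m adjmx v)) = expectation v a b.
Proof.
by rewrite mulmxA mxtrace_mulC /expectation mulmxA /mxtrace big_ord_recl big_ord0 addr0.
Qed.

Lemma expectation_real (R : realType) (v : 'cV[R[i]]_(2 * 2)) a b :
  expectation v a b \is Num.real.
Proof.
apply/CrealP; rewrite -[LHS]adjmxE /expectation !adjmxM adjmxK /pauli_pair adjmx_tens.
by rewrite !pauli_adj mulmxA.
Qed.

Definition pure_product (R : realType) (v w : 'cV[R[i]]_(2 * 2)) : 'M[R[i]]_(2 * 2 * 2 * 2) :=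
  prodAB (v *m adjmx v) (w *m adjmx w).

Lemma bell_weight_pure (R : realType) (v w : 'cV[R[i]]_(2 * 2)) k l :
  bell_weight (pure_product v w) k l =
  16^-1 * \sum_(a < 4) \sum_(b < 4)
            sgn (pair_sign k l a b) * (expectation v a b * expectation w a b).
Proof.
rewrite /bell_weight bell_pairE -scalemxAl mxtraceZ mulmx_suml raddf_sum /=; congr (_ * _).
apply: eq_bigr => a _; rewrite mulmx_suml raddf_sum /=; apply: eq_bigr => b _.
by rewrite -scalemxAl mxtraceZ /pauli4 prodAB_mul prodAB_trace !expectation_trace.
Qed.

Lemma bell_weight_pure_ge0 (R : realType) (v w : 'cV[R[i]]_(2 * 2)) k l :
  0 <= bell_weight (pure_product v w) k l.
Proof.
(* The product vector of the two parties, with its factors reordered as A' B' A'' B''. The weight is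
   then a quarter of a squared modulus. *)
pose V : 'cV[R[i]]_(2 * 2 * 2 * 2) := \col_i let: (a, b, c, d) := unidx4 i in
  v (mxtens_index (a, c)) 0 * w (mxtens_index (b, d)) 0.
have -> : pure_product v w = V *m adjmx V.
  apply/matrixP => i j; have [a [b [c [d ->]]]] := index4P i.
  have [a' [b' [c' [d' ->]]]] := index4P j.
  rewrite prodABE !mxE !big_ord_recl !big_ord0 !addr0 !mxE !unidx4K rmorphM; ring.
rewrite bell_weightE mulr_ge0 ?invr_ge0 ?ler0n //.
set phi := bell_pair_vec R k l; rewrite mulmxA -mulmxA.
have -> : adjmx V *m phi = adjmx (adjmx phi *m V) by rewrite adjmxM adjmxK.
by rewrite mxE big_ord_recl big_ord0 addr0 adjmxE mul_conjC_ge0.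
Qed.

(** * Pauli expectations as polynomials *)

Definition pauli_entry (R : realType) (a i j : nat) : R[i] :=
  nth 0 (nth [::] (nth [::] [:: [:: [:: 1; 0]; [:: 0; 1]]; [:: [:: 0; 1]; [:: 1; 0]];
    [:: [:: 0; - 'i]; [:: 'i; 0]]; [:: [:: 1; 0]; [:: 0; -1]]] (minn a 3)) i) j.

Lemma pauliE (R : realType) a (i j : 'I_2) : pauli R a i j = pauli_entry R a i j.
Proof.
case: a => [|[|[|a]]]; rewrite /pauli ?sigma_yE !mxE.
all: by case: i => [[|[|//]] ?]; case: j => [[|[|//]] ?].
Qed.

Lemma expectationE (R : realType) (v : 'cV[R[i]]_(2 * 2)) a b :
  let x := fun i j => v (mxtens_index (inord i, inord j)) 0 in
  expectation v a b =
  \sum_(i1 <- [:: 0; 1]%N) \sum_(i2 <- [:: 0; 1]%N) \sum_(j1 <- [:: 0; 1]%N) \sum_(j2 <- [:: 0; 1]%N)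
    (x i1 i2)^* * (pauli_entry R a i1 j1 * pauli_entry R b i2 j2) * x j1 j2.
Proof.
move=> x; rewrite /expectation -mulmxA mxE sum_tens.
have sum2 (F : 'I_2 -> R[i]) : \sum_i F i = \sum_(i <- [:: 0; 1]%N) F (inord i).
  rewrite !big_ord_recl big_ord0 !big_cons big_nil; congr (F _ + (F _ + _));
  by apply/val_inj; rewrite /= inordK.
rewrite sum2; apply: eq_big_seq => i1 Hi1; rewrite sum2; apply: eq_big_seq => i2 Hi2.
rewrite adjmxE mxE sum_tens mulr_sumr sum2; apply: eq_big_seq => j1 Hj1.
rewrite sum2 mulr_sumr; apply: eq_big_seq => j2 Hj2.
have lt2 m : m \in [:: 0; 1]%N -> (m < 2)%N by rewrite !inE => /orP[] /eqP ->.
by rewrite tensmxE !pauliE !inordK ?mulrA ?lt2.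
Qed.

(* Vertex [c < 3] stands for the anticommuting pentad consisting of sigma_a (x) 1 for a <> c + 1
   and of sigma_(c+1) (x) sigma_b, vertex [c + 3] for the one with the tensor factors exchanged;
   an edge is the common element of its two pentads. *)
Definition pauli_edge (i j : nat) : nat * nat :=
  (if (i < 3)%N then if (j < 3)%N then (4 - i - j, 0) else (i.+1, j - 2)
   else if (j < 3)%N then (j.+1, i - 2) else (0, 10 - i - j))%N.

(** [y] stands for the conjugate of [x] but is kept independent of it. Identities between
    expectations thus become polynomial identities in eight variables, decided by [ring] with
    ['i * 'i = -1], and transposition is the exchange of [x] and [y]. *)
Definition pauli_form (R : realType) (y x : nat -> nat -> R[i]) (a b : nat) : R[i] :=
  \sum_(i1 <- [:: 0; 1]%N) \sum_(i2 <- [:: 0; 1]%N) \sum_(j1 <- [:: 0; 1]%N) \sum_(j2 <- [:: 0; 1]%N)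
    y i1 i2 * (pauli_entry R a i1 j1 * pauli_entry R b i2 j2) * x j1 j2.

(** A Fierz-type identity for five anticommuting matrices of size four, valid even for independent
    [x] and [y]. When [y] is the conjugate of a unit vector, the right side is 1. *)
Lemma pauli_form_star (R : realType) (y x : nat -> nat -> R[i]) v : v \in vertices ->
  \sum_(j <- vertices | j != v)
     pauli_form y x (pauli_edge v j).1 (pauli_edge v j).2 ^+ 2 = pauli_form y x 0 0 ^+ 2.
Proof.
have ii : ('i : R[i]) * 'i = -1 by rewrite -expr2 sqrCi.
move: v; apply: vertices_ind; rewrite /pauli_form /pauli_entry unlock /=.
all: ring: ii.
Qed.

Lemma pauli_form_transpose (R : realType) (y x : nat -> nat -> R[i]) a b :
  (a < 4)%N -> (b < 4)%N ->
  pauli_form x y a b = sgn ((a == 2%N) (+) (b == 2%N)) * pauli_form y x a b.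
Proof.
by case: a => [|[|[|[|//]]]] _; case: b => [|[|[|[|//]]]] _;
  rewrite /pauli_form /pauli_entry unlock /=; ring.
Qed.

Lemma pauli_edgeC i j : pauli_edge i j = pauli_edge j i.
Proof. by rewrite /pauli_edge (subnAC 4) (subnAC 10); case: ltnP; case: ltnP. Qed.

Lemma pauli_edges_total (K : comPzRingType) (F : nat -> nat -> K) :
  F 0%N 0%N *+ 2 + \sum_(i <- vertices) \sum_(j <- vertices | j != i) F (pauli_edge i j).1 (pauli_edge i j).2
  = (\sum_(a < 4) \sum_(b < 4) F a b) *+ 2.
Proof. by rewrite !big_ord_recl !big_ord0 unlock /=; ring. Qed.

Lemma vertex_split (K : comPzRingType) (y : nat -> nat -> K) v :
  v \in vertices -> symmetric_table y ->
  \sum_(i <- vertices) \sum_(j <- vertices | j != i) y i j =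
  \sum_(i <- vertices | i != v) \sum_(j <- vertices | (j != v) && (j != i)) y i j
  + (\sum_(j <- vertices | j != v) y v j) *+ 2.
Proof.
move=> vV ysym; rewrite -star_sum // -five_sum -big_split /=; apply: eq_bigr => i _.
rewrite -big_split /=; apply: eq_bigr => j _.
case: eqP => [->|_] /=; first by rewrite add0r.
by case: eqP => [->|_]; rewrite ?add0r ?addr0.
Qed.

Definition pauli_mean (R : realType) (v : 'cV[R[i]]_(2 * 2)) (a b : nat) : R :=
  complex.Re (expectation v a b).

Lemma pauli_meanE (R : realType) (v : 'cV[R[i]]_(2 * 2)) a b : (pauli_mean v a b)%:C%C = expectation v a b.
Proof. exact/RRe_real/expectation_real. Qed.

Lemma expectation_form (R : realType) (v : 'cV[R[i]]_(2 * 2)) :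
  exists x : nat -> nat -> R[i],
    forall a b, expectation v a b = pauli_form (fun i j => (x i j)^*) x a b.
Proof.
by exists (fun i j => v (mxtens_index (inord i, inord j)) 0) => a b; rewrite expectationE.
Qed.

Lemma pauli_mean00 (R : realType) (v : 'cV[R[i]]_(2 * 2)) :
  adjmx v *m v = 1%:M -> pauli_mean v 0 0 = 1.
Proof. by move=> vv; rewrite /pauli_mean /expectation /pauli_pair tensmx1 mulmx1 vv mxE. Qed.

Lemma pauli_mean_star (R : realType) (v : 'cV[R[i]]_(2 * 2)) i :
  adjmx v *m v = 1%:M -> i \in vertices ->
  \sum_(j <- vertices | j != i) pauli_mean v (pauli_edge i j).1 (pauli_edge i j).2 ^+ 2 = 1.
Proof.
move=> vv iV; apply: (@complexI R); rewrite rmorph_sum rmorph1 /=.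
under eq_bigr do rewrite rmorphXn /= pauli_meanE.
have [x xE] := expectation_form v; under eq_bigr do rewrite xE.
by rewrite pauli_form_star // -xE -pauli_meanE pauli_mean00 // expr1n.
Qed.

(** Each of the six stars sums to 1 and together they meet every edge twice, giving 6; the star at
    [k], counted from both ends, takes 2 away. *)
Lemma pauli_mean_five (R : realType) (v : 'cV[R[i]]_(2 * 2)) k :
  adjmx v *m v = 1%:M -> k \in vertices ->
  \sum_(i <- vertices | i != k) \sum_(j <- vertices | (j != k) && (j != i))
     pauli_mean v (pauli_edge i j).1 (pauli_edge i j).2 ^+ 2 = 4.
Proof.
move=> vv kV; have := vertex_split (y := fun i j =>
  pauli_mean v (pauli_edge i j).1 (pauli_edge i j).2 ^+ 2) kV.
rewrite (pauli_mean_star vv kV) (eq_big_seq _ (fun i => @pauli_mean_star R v i vv)) => H.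
have {}H := H (fun i j => congr1 (fun e => pauli_mean v e.1 e.2 ^+ 2) (pauli_edgeC i j)).
have six : \sum_(i <- vertices) (1 : R) = 6 by rewrite unlock /=; ring.
by move: H; rewrite six; set S := \sum_(i <- _ | _) _; lra.
Qed.

(** Conjugating the vector transposes its pure state, so the partial transpose of a pure product is
    again a pure product. *)
Definition conj_vec (R : realType) n (v : 'cV[R[i]]_n) : 'cV[R[i]]_n := map_mx Num.conj v.

Lemma pauli_mean_conj (R : realType) (v : 'cV[R[i]]_(2 * 2)) a b : (a < 4)%N -> (b < 4)%N ->
  pauli_mean (conj_vec v) a b = sgn ((a == 2%N) (+) (b == 2%N)) * pauli_mean v a b.
Proof.
move=> a4 b4; apply: (@complexI R); rewrite rmorphM /= !pauli_meanE !expectationE.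
rewrite -[in RHS]/(pauli_form _ _ a b).
set x := fun i j => v (mxtens_index (inord i, inord j)) 0.
have -> : (sgn ((a == 2%N) (+) (b == 2%N)))%:C%C = sgn ((a == 2%N) (+) (b == 2%N)) :> R[i].
  by case: (_ (+) _); rewrite /sgn ?rmorphN rmorph1.
rewrite -pauli_form_transpose // /pauli_form.
by do 4!(apply: eq_bigr => ? _); rewrite /x !mxE conjCK.
Qed.

Lemma bell_weight_mean (R : realType) (v w : 'cV[R[i]]_(2 * 2)) k l :
  bell_weight (pure_product v w) k l =
  (16^-1 * \sum_(a < 4) \sum_(b < 4) sgn (pair_sign k l a b) * (pauli_mean v a b * pauli_mean w a b))%:C%C.
Proof.
rewrite bell_weight_pure rmorphM fmorphV rmorph_nat rmorph_sum /=; congr (_ * _).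
apply: eq_bigr => a _; rewrite rmorph_sum /=; apply: eq_bigr => b _.
rewrite !rmorphM /= !pauli_meanE; congr (_ * _).
by case: pair_sign; rewrite /sgn ?rmorphN rmorph1.
Qed.

Definition product_table (R : realType) (v w : 'cV[R[i]]_(2 * 2)) (i j : nat) : R :=
  pauli_mean v (pauli_edge i j).1 (pauli_edge i j).2 * pauli_mean w (pauli_edge i j).1 (pauli_edge i j).2.

Definition edge_sign (k l i j : nat) : bool :=
  pair_sign k l (pauli_edge i j).1 (pauli_edge i j).2.

Definition transpose_sign (i j : nat) : bool :=
  ((pauli_edge i j).1 == 2%N) (+) ((pauli_edge i j).2 == 2%N).

(** 32 is the 16 of the Pauli expansion times 2, because every edge is met from both ends. The
    leading 2 on the right comes from the identity operator. *)
Lemma product_weight (R : realType) (v w : 'cV[R[i]]_(2 * 2)) k l :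
  adjmx v *m v = 1%:M -> adjmx w *m w = 1%:M ->
  (16^-1 * \sum_(a < 4) \sum_(b < 4) sgn (pair_sign k l a b) * (pauli_mean v a b * pauli_mean w a b)) *+ 32
  = 2 + \sum_(i <- vertices) \sum_(j <- vertices | j != i) sgn (edge_sign k l i j) * product_table v w i j.
Proof.
move=> vv ww.
have := pauli_edges_total (fun a b => sgn (pair_sign k l a b) * (pauli_mean v a b * pauli_mean w a b)).
rewrite !pauli_mean00 //.
have -> : pair_sign k l 0 0 = false.
  have bs0 m : bell_sign m 0 = false.
    by case: m => [|[|[|[|m]]]]; rewrite /bell_sign //= nth_nil.
  by rewrite /pair_sign !bs0.
rewrite /edge_sign /product_table [sgn false]/(1 : R) !mulr1.
set S := \sum_(a < 4) _; set T := \sum_(i <- vertices) _ => H.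
have -> : 2 + T = S *+ 2 by rewrite -H.
by field.
Qed.

(** A pattern and its complement give the same signs, so the 64 patterns make 32 sign tables: those
    of the sixteen Bell pairs, with and without partial transposition. *)
Definition sign_covered (s : seq bool) : bool :=
  has (fun kl => has (fun tr => all (fun i => all (fun j => (j == i) ||
      (parity (nth false s) (+) nth false s i (+) nth false s j ==
       edge_sign kl.1 kl.2 i j (+) (tr && transpose_sign i j))) vertices) vertices) [:: false; true])
    [seq (k, l) | k <- iota 0 4, l <- iota 0 4].

Lemma sign_cover : all sign_covered bits6.
Proof. by vm_compute. Qed.

(* Transposing the second factor flips the sign of every Pauli operator with an odd number of
   sigma_y, which turns half of the sign patterns into Bell weights. *)
Lemma product_correlations (R : realType) (v w : 'cV[R[i]]_(2 * 2)) :
  adjmx v *m v = 1%:M -> adjmx w *m w = 1%:M -> correlations (product_table v w).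
Proof.
move=> vv ww.
(* Both families of expectations have the same sum of squares, so the termwise inequality between
   geometric and arithmetic mean already gives the Cauchy-Schwarz bound. *)
have amgm i j : `|product_table v w i j| <=
    2^-1 * pauli_mean v (pauli_edge i j).1 (pauli_edge i j).2 ^+ 2 +
    2^-1 * pauli_mean w (pauli_edge i j).1 (pauli_edge i j).2 ^+ 2.
  rewrite /product_table; move: (pauli_mean v _ _) (pauli_mean w _ _) => a b.
  have := sqr_ge0 (a + b); have := sqr_ge0 (a - b).
  by rewrite sqrrB sqrrD ler_norml => ? ?; apply/andP; split; lra.
split=> [k kV|k kV|s].
- apply: le_trans (ler_sum _ (fun j _ => amgm k j)) _.
  by rewrite big_split -!mulr_sumr !pauli_mean_star //=; lra.
- apply: le_trans (ler_sum _ (fun i _ => ler_sum _ (fun j _ => amgm i j))) _.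
  under eq_bigr do rewrite big_split -!mulr_sumr /=.
  by rewrite big_split -!mulr_sumr !pauli_mean_five //=; lra.
have sB : map s vertices \in bits6.
  by rewrite /=; case: (s 0%N); case: (s 1%N); case: (s 2%N); case: (s 3%N); case: (s 4%N); case: (s 5%N).
have nthS i : i \in vertices -> nth false (map s vertices) i = s i.
  by move: i; apply: vertices_ind.
have /hasP[[k l] /allpairsP[[k' l'] [Hk Hl [-> ->]]] /hasP[tr _ /allP Htr]] := allP sign_cover _ sB.
pose w' := if tr then conj_vec w else w.
have ww' : adjmx w' *m w' = 1%:M.
  rewrite /w'; case: tr {Htr w'} => //; rewrite /conj_vec.
  have -> : adjmx (map_mx Num.conj w) = map_mx Num.conj (adjmx w).
    by rewrite /adjmx map_trmx.
  by rewrite -map_mxM ww map_mx1.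
have k4 : (k' < 4)%N by move: Hk; rewrite mem_iota.
have l4 : (l' < 4)%N by move: Hl; rewrite mem_iota.
have := bell_weight_pure_ge0 v w' (Ordinal k4) (Ordinal l4).
rewrite bell_weight_mean lecR => H.
have := product_weight k' l' vv ww' => E.
have : 0 <= 2 + \sum_(i <- vertices) \sum_(j <- vertices | j != i)
    sgn (edge_sign k' l' i j) * product_table v w' i j.
  by rewrite -E mulrn_wge0.
congr (_ <= _ + _); apply: eq_big_seq => i iV; rewrite big_seq_cond [RHS]big_seq_cond.
apply: eq_bigr => j /andP[jV ji].
have := allP (Htr i iV) j jV; rewrite (negPf ji) /= => /eqP.
have -> : parity (nth false [seq s i | i <- vertices]) = parity s by [].
rewrite !nthS // => ->; rewrite sgnM -mulrA; congr (_ * _).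
rewrite /product_table mulrCA; congr (_ * _); rewrite /w'.
case: (tr); last by rewrite mul1r.
have /allP/(_ i iV)/allP/(_ j jV) : all (fun i => all (fun j => (j == i) ||
    ((pauli_edge i j).1 < 4)%N && ((pauli_edge i j).2 < 4)%N) vertices) vertices by [].
by rewrite (negPf ji) => /andP[e1 e2]; rewrite pauli_mean_conj.
Qed.

(* The Bell pairs (k, l) that are joint eigenvectors of the three operators of [t] with eigenvalues
   given by the signs of [t]: an affine Lagrangian plane in the sixteen-point phase space. *)
Definition lagrangian (t : matching) (k l : nat) : bool :=
  all (fun i => edge_sign k l i (partner t i) == msign t i) vertices.

Definition agreement (t : matching) (k l : nat) : int :=
  foldr (fun i z => intZmod.addz z
           (if edge_sign k l i (partner t i) (+) msign t i then Negz 0 else Posz 1)) (Posz 2) vertices.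

Lemma agreementE (R : realFieldType) t k l :
  (agreement t k l)%:~R = meval t (1 : R) (fun i j => sgn (edge_sign k l i j)).
Proof.
rewrite /agreement /meval; elim: vertices => [|i r IH]; first by rewrite big_nil addr0.
rewrite big_cons [foldr _ _ _]/=.
set z := foldr _ _ r in IH *; set c := if _ then _ else _.
rewrite -[intZmod.addz z c]/(z + c) rmorphD /= IH -addrA; congr (_ + _); rewrite addrC.
by congr (_ + _); rewrite -sgnM addbC /c; case: (_ (+) _).
Qed.

(** The three signs multiply to +1 both for [t] and for a Bell pair, so disagreements come in pairs:
    none gives 2 + 6 = 8, two edges give 2 + 2 - 4 = 0. Hence evaluation at a matching is 8 times
    the indicator of its plane. *)
Lemma agreement_lagrangian : all (fun t => all (fun k => all (fun l =>
    agreement t k l == if lagrangian t k l then Posz 8 else Posz 0) (iota 0 4)) (iota 0 4))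
  signed_matchings.
Proof. by vm_compute. Qed.

Lemma meval_edge_sign (R : realFieldType) t (k l : 'I_4) : t \in signed_matchings ->
  meval t (1 : R) (fun i j => sgn (edge_sign k l i j)) = (if lagrangian t k l then 1 else 0) *+ 8.
Proof.
have iota4 (m : 'I_4) : (m : nat) \in iota 0 4 by rewrite mem_iota ltn_ord.
move=> /(allP agreement_lagrangian)/allP/(_ k (iota4 k))/allP/(_ l (iota4 l))/eqP H.
by rewrite -agreementE H; case: ifP; rewrite ?mul0rn.
Qed.

Lemma meval_sum (K : comPzRingType) (I : finType) (c : I -> K) (s : I -> nat -> nat -> K) t :
  meval t (\sum_p c p) (fun i j => \sum_p c p * s p i j) = \sum_p c p * meval t 1 (s p).
Proof.
rewrite /meval; under [RHS]eq_bigr do rewrite mulrDr mulr_natr mulr_sumr.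
rewrite big_split sumrMnl /= exchange_big /=; congr (_ + _).
by apply: eq_bigr => i _; rewrite mulr_sumr; apply: eq_bigr => p _; rewrite mulrCA.
Qed.

Lemma pairing_sum (K : comPzRingType) (I : finType) (c : I -> K) (s : I -> nat -> nat -> K) x :
  pairing (\sum_p c p) (fun i j => \sum_p c p * s p i j) x = \sum_p c p * pairing 1 (s p) x.
Proof.
rewrite /pairing; under [RHS]eq_bigr do rewrite mulrDr mulr_natr mulr_sumr.
rewrite big_split sumrMnl /= exchange_big /=; congr (_ + _).
apply: eq_bigr => i _; under [RHS]eq_bigr do rewrite mulr_sumr.
rewrite exchange_big; apply: eq_bigr => j _ /=; rewrite mulr_suml.
by apply: eq_bigr => p _; rewrite mulrA.
Qed.

(** The sign transform turns [c] into a functional on edges with constant term the sum of the [c p].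
    At a matching it takes 8 times the value of [c] on the plane; on the product table it takes 32
    times the value of [c] on the Bell weights. So [settled_all] applies. *)
Lemma lagrangian_separation (R : realType) (v w : 'cV[R[i]]_(2 * 2)) (c : 'I_4 * 'I_4 -> R) :
  adjmx v *m v = 1%:M -> adjmx w *m w = 1%:M ->
  (forall t, t \in signed_matchings ->
     0 <= \sum_p c p * (if lagrangian t p.1 p.2 then 1 else 0)) ->
  0 <= \sum_p (c p)%:C%C * bell_weight (pure_product v w) p.1 p.2.
Proof.
move=> vv ww cpos.
pose s (p : 'I_4 * 'I_4) i j : R := sgn (edge_sign p.1 p.2 i j).
have sC p : symmetric_table (s p) by move=> i j; rewrite /s /edge_sign pauli_edgeC.
have xC : symmetric_table (product_table v w).
  by move=> i j; rewrite /product_table pauli_edgeC.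
have uC : symmetric_table (fun i j => \sum_p c p * s p i j).
  by move=> i j; apply: eq_bigr => p _; rewrite sC.
have Epos : 0 <= pairing (\sum_p c p) (fun i j => \sum_p c p * s p i j) (product_table v w).
  have := @settled_all R _ _ (\sum_p c p) xC (product_correlations vv ww) uC.
  apply=> // t tS.
  rewrite meval_sum; apply: le_trans (mulrn_wge0 8 (cpos t tS)) _.
  rewrite -sumrMnl; apply: ler_sum => p _.
  by rewrite /s meval_edge_sign // mulrnAr.
have -> : \sum_p (c p)%:C%C * bell_weight (pure_product v w) p.1 p.2 =
    (32^-1 * pairing (\sum_p c p) (fun i j => \sum_p c p * s p i j) (product_table v w))%:C%C.
  rewrite pairing_sum mulr_sumr rmorph_sum /=; apply: eq_bigr => p _.
  rewrite bell_weight_mean -rmorphM; congr (_%:C%C); rewrite [RHS]mulrCA; congr (_ * _).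
  have -> : pairing 1 (s p) (product_table v w) = _ := esym (product_weight p.1 p.2 vv ww).
  by rewrite -[X in _ = _ * X]mulr_natl mulKf // pnatr_eq0.
by rewrite -[0]/((0 : R)%:C%C) lecR mulr_ge0 // invr_ge0 ler0n.
Qed.

(** * Extreme points *)

Lemma pauli_bell (R : realType) (a : nat) (k : 'I_4) : (a < 4)%N ->
  (pauli R a *t pauli R a) *m bell_vec R k = sgn (bell_sign k a) *: bell_vec R k.
Proof.
move=> a4; apply/matrixP => i j; rewrite ord1 scalemxE mxE.
under eq_bigr do rewrite pauli_tens bell_vecE.
rewrite bell_vecE !big_ord_recl big_ord0.
case: a a4 => [|[|[|[|//]]]] _; case: k => [[|[|[|[|//]]]] pk].
all: by case: i => [[|[|[|[|//]]]] pi]; rewrite /bell_sign /bell_entry /sgn /=; ring.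
Qed.

Lemma pauli4_bell_pair (R : realType) a b (k l : 'I_4) : (a < 4)%N -> (b < 4)%N ->
  pauli4 R a b *m bell_pair R k l = sgn (pair_sign k l a b) *: bell_pair R k l.
Proof.
move=> a4 b4; rewrite /pauli4 -tens4E -tens4_assoc.
have := @tensmx_mul R[i] (2 * 2) (2 * 2) (2 * 2) (2 * 2) (2 * 2) (2 * 2)
  (pauli R a *t pauli R a) (pauli R b *t pauli R b) (bell_proj R k) (bell_proj R l).
move=> /(@etrans _ _ _ _); apply.
rewrite /bell_proj -!scalemxAr !mulmxA !pauli_bell // -!scalemxAl !(scalerA 2^-1) !(mulrC 2^-1).
by rewrite -!scalerA tensmxZ -sgnM.
Qed.

Definition anticommute (a c : nat) : bool := [&& a != 0, c != 0 & a != c]%N.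

Lemma pauli_commute (R : realType) a c : (a < 4)%N -> (c < 4)%N ->
  pauli R a *m pauli R c = sgn (anticommute a c) *: (pauli R c *m pauli R a).
Proof.
have ii : ('i : R[i]) * 'i = -1 by rewrite -expr2 sqrCi.
move=> a4 c4; apply/matrixP => i j; rewrite scalemxE !mxE !big_ord_recl !big_ord0 !pauliE.
case: a a4 => [|[|[|[|//]]]] _; case: c c4 => [|[|[|[|//]]]] _.
all: case: i => [[|[|//]] ?]; case: j => [[|[|//]] ?].
all: by rewrite /pauli_entry /anticommute /sgn /=; ring: ii.
Qed.

Lemma pauli_trace (R : realType) a c : (a < 4)%N -> (c < 4)%N ->
  \tr (pauli R a *m pauli R c) = 2 *+ (a == c).
Proof.
have ii : ('i : R[i]) * 'i = -1 by rewrite -expr2 sqrCi.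
move=> a4 c4; rewrite /mxtrace !big_ord_recl big_ord0 !mxE !big_ord_recl !big_ord0 !pauliE.
case: a a4 => [|[|[|[|//]]]] _; case: c c4 => [|[|[|[|//]]]] _.
all: by rewrite /pauli_entry /=; ring: ii.
Qed.

Lemma tens_trace (K : comPzRingType) m n (A : 'M[K]_m) (B : 'M[K]_n) :
  \tr (A *t B) = \tr A * \tr B.
Proof.
rewrite /mxtrace sum_tens mulr_suml; apply: eq_bigr => i _; rewrite mulr_sumr.
by apply: eq_bigr => j _; rewrite tensmxE.
Qed.

Lemma pauli_pair_adj (R : realType) a b : adjmx (pauli_pair R a b) = pauli_pair R a b.
Proof. by rewrite /pauli_pair adjmx_tens !pauli_adj. Qed.

Lemma pauli_pair_sq (R : realType) a b : pauli_pair R a b *m pauli_pair R a b = 1%:M.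
Proof. by rewrite /pauli_pair tensmx_mul !pauli_sq tensmx1. Qed.

Lemma pauli_pair_commute (R : realType) a b c d :
  (a < 4)%N -> (b < 4)%N -> (c < 4)%N -> (d < 4)%N -> anticommute a c = anticommute b d ->
  pauli_pair R a b *m pauli_pair R c d = pauli_pair R c d *m pauli_pair R a b.
Proof.
move=> a4 b4 c4 d4 abcd.
rewrite /pauli_pair !tensmx_mul (pauli_commute _ a4 c4) (pauli_commute _ b4 d4) tensmxZ abcd.
by rewrite sgn_sq scale1r.
Qed.

Lemma pauli_pair_trace (R : realType) a b c d :
  (a < 4)%N -> (b < 4)%N -> (c < 4)%N -> (d < 4)%N ->
  \tr (pauli_pair R a b *m pauli_pair R c d) = 4 *+ ((a == c) && (b == d)).
Proof.
move=> a4 b4 c4 d4; rewrite /pauli_pair tensmx_mul tens_trace !pauli_trace //.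
by case: (a == c); case: (b == d); rewrite ?mulr0 ?mul0r // -natrM.
Qed.

(** * Stabilizer states and their mixtures *)

Definition stabilizer_state (R : realType) n (P Q : 'M[R[i]]_n) (m m' : bool) : 'M[R[i]]_n :=
  4^-1 *: ((1%:M + sgn m *: P) *m (1%:M + sgn m' *: Q)).

(** The matrix is a Hermitian idempotent X, so its quadratic form at v is the squared norm of X v;
    in the trace only the identity term survives. *)
Lemma stabilizer_density (R : realType) (P Q : 'M[R[i]]_(2 * 2)) m m' :
  adjmx P = P -> adjmx Q = Q -> P *m P = 1%:M -> Q *m Q = 1%:M -> P *m Q = Q *m P ->
  \tr P = 0 -> \tr Q = 0 -> \tr (P *m Q) = 0 -> is_density (stabilizer_state P Q m m').
Proof.
move=> Ph Qh P2 Q2 PQ trP trQ trPQ.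
have sgnC (b : bool) : (sgn b : R[i])^* = sgn b.
  by case: b; rewrite /sgn ?rmorphN rmorph1.
have herm1 (A : 'M[R[i]]_(2 * 2)) b : adjmx A = A -> adjmx (1%:M + sgn b *: A) = 1%:M + sgn b *: A.
  move=> Ah; apply/matrixP => i j; rewrite adjmxE !mxE rmorphD rmorphM rmorph_nat /= sgnC.
  by rewrite eq_sym -[in RHS]Ah adjmxE.
have sq1 (A : 'M[R[i]]_(2 * 2)) b : A *m A = 1%:M ->
    (1%:M + sgn b *: A) *m (1%:M + sgn b *: A) = 2 *: (1%:M + sgn b *: A).
  move=> A2; rewrite mulmxDl !mulmxDr mul1mx mulmx1 mul1mx -scalemxAl -scalemxAr A2.
  by rewrite scalerA sgn_sq scale1r scaler_nat mulr2n [X in _ + X]addrC.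
have comm1 : (1%:M + sgn m *: P) *m (1%:M + sgn m' *: Q) =
             (1%:M + sgn m' *: Q) *m (1%:M + sgn m *: P).
  rewrite !mulmxDl !mulmxDr !mul1mx !mulmx1 -!scalemxAl -!scalemxAr PQ !scalerA.
  by rewrite [sgn m * _]mulrC addrACA.
set X := stabilizer_state P Q m m'.
have Xh : adjmx X = X.
  rewrite /X /stabilizer_state; move: (herm1 P m Ph) (herm1 Q m' Qh) => h1 h2.
  apply/matrixP => i j; rewrite adjmxE !scalemxE rmorphM fmorphV rmorph_nat /= -adjmxE adjmxM h1 h2.
  by rewrite comm1.
have XX : X *m X = X.
  rewrite /X /stabilizer_state -scalemxAl -scalemxAr.
  rewrite {2}comm1 mulmxA -(mulmxA _ _ (1%:M + sgn m' *: Q)) sq1 // -scalemxAr -scalemxAl.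
  by rewrite -mulmxA -comm1 mulmxA sq1 // -scalemxAl !scalerA; congr (_ *: _); field.
split=> // [v|].
  rewrite -XX mulmxA -[in X in adjmx v *m X]Xh -adjmxM -mulmxA mxE.
  by apply: sumr_ge0 => i _; rewrite adjmxE mulrC mul_conjC_ge0.
rewrite /X /stabilizer_state mxtraceZ mulmxDl !mulmxDr mul1mx mulmx1 mul1mx -scalemxAl -scalemxAr.
rewrite !mxtraceD !mxtraceZ trP trQ trPQ !mulr0 !addr0 mxtrace1.
by rewrite mulVf // pnatr_eq0.
Qed.

Lemma prodABD (R : realType) (X X' Y Y' : 'M[R[i]]_(2 * 2)) :
  prodAB (X + X') (Y + Y') = prodAB X Y + prodAB X Y' + (prodAB X' Y + prodAB X' Y').
Proof.
apply/matrixP => i j; rewrite !mxE.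
by case: (unidx4 i) => [[[? ?] ?] ?]; case: (unidx4 j) => [[[? ?] ?] ?]; rewrite !mxE; ring.
Qed.

Lemma prodABZ (R : realType) (X Y : 'M[R[i]]_(2 * 2)) c d :
  prodAB (c *: X) (d *: Y) = (c * d) *: prodAB X Y.
Proof.
apply/matrixP => i j; rewrite !mxE.
by case: (unidx4 i) => [[[? ?] ?] ?]; case: (unidx4 j) => [[[? ?] ?] ?]; rewrite !mxE; ring.
Qed.

Lemma prodABZl (R : realType) (X Y : 'M[R[i]]_(2 * 2)) c : prodAB (c *: X) Y = c *: prodAB X Y.
Proof. by rewrite -{1}(scale1r Y) prodABZ mulr1. Qed.

Lemma prodABZr (R : realType) (X Y : 'M[R[i]]_(2 * 2)) c : prodAB X (c *: Y) = c *: prodAB X Y.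
Proof. by rewrite -{1}(scale1r X) prodABZ mul1r. Qed.

Lemma prodAB1 (R : realType) : prodAB (1%:M : 'M[R[i]]_(2 * 2)) 1%:M = 1%:M.
Proof.
rewrite -{1}tensmx1 -{1}(tensmx1 _ 2 2) -tens4E /tens4.
by rewrite (tensmx1 _ 2 2) (tensmx1 _ (2 * 2) 2) (tensmx1 _ (2 * 2 * 2) 2).
Qed.

(** The sign [m] is uniform on each party, so the terms with [P] on one party alone cancel; the
    product of the two signs is always [sgn s], so the correlation stays. *)
Lemma stabilizer_half_sum (R : realType) (P : 'M[R[i]]_(2 * 2)) s :
  \sum_(m : bool) prodAB (1%:M + sgn m *: P) (1%:M + sgn (m (+) s) *: P)
  = 2 *: (1%:M + sgn s *: prodAB P P).
Proof.
have E m : prodAB (1%:M + sgn m *: P) (1%:M + sgn (m (+) s) *: P) =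
    1%:M + sgn s *: prodAB P P + sgn m *: (sgn s *: prodAB 1%:M P + prodAB P 1%:M).
  rewrite prodABD prodAB1 !prodABZl !prodABZr sgnM.
  move: (prodAB 1%:M P) (prodAB P 1%:M) (prodAB P P) => A B C.
  by apply/matrixP => i j; rewrite !mxE; case: m; case: s; rewrite /sgn; ring.
rewrite (eq_bigr _ (fun m _ => E m)) big_bool /=.
by rewrite scaleN1r scale1r addrACA addNr addr0 scaler_nat mulr2n.
Qed.

Lemma stabilizer_mixture (R : realType) (P Q : 'M[R[i]]_(2 * 2)) s t :
  \sum_(m : bool) \sum_(m' : bool)
    4^-1 *: prodAB (stabilizer_state P Q m m') (stabilizer_state P Q (m (+) s) (m' (+) t))
  = 16^-1 *: ((1%:M + sgn s *: prodAB P P) *m (1%:M + sgn t *: prodAB Q Q)).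
Proof.
(* 64 combines the mixing weight 1/4 with the normalisations 1/4 of the two states. The two half
   sums contribute a factor 2 each, leaving 1/16. *)
have E m m' : 4^-1 *: prodAB (stabilizer_state P Q m m') (stabilizer_state P Q (m (+) s) (m' (+) t))
   = 64^-1 *: (prodAB (1%:M + sgn m *: P) (1%:M + sgn (m (+) s) *: P) *m
               prodAB (1%:M + sgn m' *: Q) (1%:M + sgn (m' (+) t) *: Q)).
  by rewrite prodABZ -prodAB_mul scalerA; congr (_ *: _); field.
under eq_bigr do under eq_bigr do rewrite E.
under eq_bigr do rewrite -scaler_sumr -mulmx_sumr stabilizer_half_sum.
rewrite -scaler_sumr -mulmx_suml stabilizer_half_sum -scalemxAl -scalemxAr !scalerA.
by congr (_ *: _); field.
Qed.

(** Without normalised weights the separable operators form a cone, closed under sums and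
    nonnegative scaling; the trace restores the normalisation in [conic_separable_trace1]. *)
Definition conic_separable (R : realType) (rho : 'M[R[i]]_(2 * 2 * 2 * 2)) : Prop :=
  exists (n : nat) (w : 'I_n -> R[i]) (X Y : 'I_n -> 'M[R[i]]_(2 * 2)),
    [/\ forall k, 0 <= w k, forall k, is_density (X k) /\ is_density (Y k)
      & rho = \sum_(k < n) w k *: prodAB (X k) (Y k)].

Lemma conic_separable0 (R : realType) : conic_separable (0 : 'M[R[i]]_(2 * 2 * 2 * 2)).
Proof.
by exists 0%N, (fun _ => 0), (fun _ => 0), (fun _ => 0); split=> [|[]//|]; rewrite ?big_ord0.
Qed.

Lemma conic_separableD (R : realType) (A B : 'M[R[i]]_(2 * 2 * 2 * 2)) :
  conic_separable A -> conic_separable B -> conic_separable (A + B).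
Proof.
case=> [n [w [X [Y [w0 XY ->]]]]] [n' [w' [X' [Y' [w0' XY' ->]]]]].
pose glue T (f : 'I_n -> T) (g : 'I_n' -> T) (i : 'I_(n + n')) :=
  match split i with inl j => f j | inr j => g j end.
exists (n + n')%N, (glue _ w w'), (glue _ X X'), (glue _ Y Y'); split.
- by move=> k; rewrite /glue; case: split.
- by move=> k; rewrite /glue; case: split.
rewrite big_split_ord /glue; congr (_ + _); apply: eq_bigr => i _.
  by rewrite (unsplitK (inl i)).
by rewrite (unsplitK (inr i)).
Qed.

Lemma conic_separableZ (R : realType) c (A : 'M[R[i]]_(2 * 2 * 2 * 2)) :
  0 <= c -> conic_separable A -> conic_separable (c *: A).
Proof.
move=> c0 [n [w [X [Y [w0 XY ->]]]]].
exists n, (fun k => c * w k), X, Y; split=> // [k|]; first exact: mulr_ge0.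
by rewrite scaler_sumr; apply: eq_bigr => k _; rewrite scalerA.
Qed.

Lemma conic_separable_sum (R : realType) (I : finType) (A : I -> 'M[R[i]]_(2 * 2 * 2 * 2)) :
  (forall i, conic_separable (A i)) -> conic_separable (\sum_i A i).
Proof.
by move=> HA; apply: big_ind; [exact: conic_separable0|exact: conic_separableD|].
Qed.

Lemma conic_separable_prod (R : realType) (X Y : 'M[R[i]]_(2 * 2)) :
  is_density X -> is_density Y -> conic_separable (prodAB X Y).
Proof.
move=> HX HY; exists 1%N, (fun _ => 1), (fun _ => X), (fun _ => Y); split=> //.
by rewrite big_ord1 scale1r.
Qed.

Lemma conic_separable_trace1 (R : realType) (rho : 'M[R[i]]_(2 * 2 * 2 * 2)) :
  conic_separable rho -> \tr rho = 1 -> separable_AB rho.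
Proof.
case=> n [w [X [Y [w0 XY rhoE]]]] tr1; exists n, w, X, Y; split=> //.
rewrite -tr1 rhoE raddf_sum; apply: eq_bigr => k _.
by case: (XY k) => [[_ _ trX] [_ _ trY]]; rewrite /= mxtraceZ prodAB_trace trX trY !mulr1.
Qed.

Lemma stabilizer_separable (R : realType) a b c d s t :
  (a < 4)%N -> (b < 4)%N -> (c < 4)%N -> (d < 4)%N -> anticommute a c = anticommute b d ->
  (a, b) != (0, 0)%N -> (c, d) != (0, 0)%N -> (a, b) != (c, d) ->
  conic_separable (16^-1 *: ((1%:M + sgn s *: pauli4 R a b) *m (1%:M + sgn t *: pauli4 R c d))).
Proof.
move=> a4 b4 c4 d4 abcd ab0 cd0 ab_cd; rewrite -stabilizer_mixture.
have tr0 x y : (x < 4)%N -> (y < 4)%N -> (x, y) != (0, 0)%N -> \tr (pauli_pair R x y) = 0.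
  move=> x4 y4 xy0; have := @pauli_pair_trace R x y 0 0 x4 y4 isT isT.
  rewrite [X in _ *m X]tensmx1 mulmx1 => ->; move: xy0; rewrite xpair_eqE => /negPf ->.
  by rewrite mulr0n.
apply: conic_separable_sum => m; apply: conic_separable_sum => m'.
apply: conic_separableZ; first by rewrite invr_ge0 ler0n.
apply: conic_separable_prod; apply: stabilizer_density;
  rewrite ?pauli_pair_adj ?pauli_pair_sq ?tr0 //.
- exact: pauli_pair_commute.
- by rewrite pauli_pair_trace //; move: ab_cd; rewrite xpair_eqE => /negPf ->; rewrite mulr0n.
- exact: pauli_pair_commute.
by rewrite pauli_pair_trace //; move: ab_cd; rewrite xpair_eqE => /negPf ->; rewrite mulr0n.
Qed.

(* A Lagrangian plane is cut out by two of the three signed edges of its matching. *)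
Definition plane_ok (t : matching) : bool :=
  let v := if partner t 0 == 1%N then 2%N else 1%N in
  let e := pauli_edge 0 (partner t 0) in
  let f := pauli_edge v (partner t v) in
  [&& (e.1 < 4)%N, (e.2 < 4)%N, (f.1 < 4)%N, (f.2 < 4)%N,
      anticommute e.1 f.1 == anticommute e.2 f.2, e != (0, 0)%N, f != (0, 0)%N, e != f
    & all (fun k => all (fun l => lagrangian t k l ==
         (pair_sign k l e.1 e.2 == msign t 0) && (pair_sign k l f.1 f.2 == msign t v))
       (iota 0 4)) (iota 0 4)].

Lemma planes_ok : all plane_ok signed_matchings.
Proof. by vm_compute. Qed.

Definition plane_matrix (R : realType) (t : matching) : 'M[R[i]]_4 :=
  \matrix_(k, l) if lagrangian t k l then 4^-1 else 0.

Lemma plane_separable (R : realType) t :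
  t \in signed_matchings -> conic_separable (bell_state (plane_matrix R t)).
Proof.
have iota4 (m : 'I_4) : (m : nat) \in iota 0 4 by rewrite mem_iota ltn_ord.
move=> /(allP planes_ok); rewrite /plane_ok.
(* [v] is a vertex off the edge at 0, so [e] and [f] label two different edges of [t]. *)
set v := if _ then _ else _; set e := pauli_edge _ _; set f := pauli_edge _ _.
case/and5P => e1 e2 f1 f2 /and5P[/eqP ef e0 f0 ne /allP lag].
suff -> : bell_state (plane_matrix R t) = 16^-1 *:
    ((1%:M + sgn (msign t 0) *: pauli4 R e.1 e.2) *m (1%:M + sgn (msign t v) *: pauli4 R f.1 f.2)).
  by apply: stabilizer_separable; rewrite -?surjective_pairing.
(* Both sides are compared on the Bell pairs, on which the two factors act by scalars: their product
   is 4 on the plane and 0 off it, and 4/16 is the entry 1/4. *)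
rewrite -[X in _ *: X]mulmx1 -[X in _ *: (_ *m X)]bell_pair_sum mulmx_sumr scaler_sumr bell_stateE.
apply: eq_bigr => k _; rewrite mulmx_sumr scaler_sumr; apply: eq_bigr => l _.
have /allP/(_ l (iota4 l))/eqP lagE := lag k (iota4 k).
have eig a b s : (a < 4)%N -> (b < 4)%N -> (1%:M + sgn s *: pauli4 R a b) *m bell_pair R k l =
    (1 + sgn s * sgn (pair_sign k l a b)) *: bell_pair R k l.
  by move=> a4 b4; rewrite mulmxDl mul1mx -scalemxAl pauli4_bell_pair // scalerA scalerDl scale1r.
rewrite mxE lagE -mulmxA eig // -scalemxAr eig // !scalerA; congr (_ *: _).
rewrite -!sgnM; move: (pair_sign _ _ _ _) (pair_sign _ _ _ _) => [] [];
  by case: (msign t 0); case: (msign t v); rewrite /sgn /=; field.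
Qed.

(** * The sixty planes and the permuted generators *)

Definition generator_table (diag : bool) (p q : seq nat) (k l : nat) : bool :=
  if diag then nth 0%N p k == nth 0%N q l else (nth 0%N p k < 2)%N && (nth 0%N q l < 2)%N.

Definition table (g : nat -> nat -> bool) : seq (seq bool) :=
  [seq [seq g k l | l <- iota 0 4] | k <- iota 0 4].

Definition plane_tables : seq (seq (seq bool)) :=
  [seq table (lagrangian t) | t <- signed_matchings].

Definition generator_tables : seq (seq (seq bool)) :=
  flatten [seq [seq table (generator_table d p q) | p <- permutations (iota 0 4),
                  q <- permutations (iota 0 4)] | d <- [:: true; false]].

(** Up to repetition there are 24 permutation matrices from [D0] and 36 blocks, two rows by two
    columns, from [G0]: as many as the sixty planes. *)
Lemma generator_tables_sub : let L := plane_tables in all (mem L) generator_tables.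
Proof. by vm_compute. Qed.

Lemma plane_tables_sub : let L := generator_tables in all (mem L) plane_tables.
Proof. by vm_compute. Qed.


Lemma table_inj g h : table g = table h -> forall k l : 'I_4, g k l = h k l.
Proof.
have iota4 (m : 'I_4) : (m : nat) \in iota 0 4 by rewrite mem_iota ltn_ord.
by move=> /eq_in_map gh k l; have /eq_in_map := gh k (iota4 k); apply.
Qed.

Lemma perm_as_list (s : 'S_4) :
  exists2 p, p \in permutations (iota 0 4) & forall k : 'I_4, nth 0%N p k = s k.
Proof.
exists [seq val (s k) | k <- enum 'I_4] => [|k].
  rewrite mem_permutations; apply: uniq_perm; rewrite ?iota_uniq //.
    by rewrite map_inj_uniq ?enum_uniq // => k l /val_inj/perm_inj.
  move=> m; rewrite mem_iota; apply/mapP/idP => [[k _ ->]|/= m4]; first exact: ltn_ord.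
  by exists (s^-1%g (Ordinal m4)); rewrite ?mem_enum // permKV.
by rewrite (nth_map k) ?size_enum_ord // nth_ord_enum.
Qed.

Lemma list_as_perm p : p \in permutations (iota 0 4) ->
  exists s : 'S_4, forall k : 'I_4, nth 0%N p k = s k.
Proof.
rewrite mem_permutations => pP.
have psz := perm_size pP.
have p4 (k : 'I_4) : (nth 0%N p k < 4)%N.
  have : nth 0%N p k \in iota 0 4 by rewrite -(perm_mem pP) mem_nth // psz size_iota ltn_ord.
  by rewrite mem_iota.
pose f k := Ordinal (p4 k).
have finj : injective f.
  move=> k l /(congr1 val) /= /eqP; rewrite nth_uniq ?psz ?size_iota ?ltn_ord //.
    by move/eqP/val_inj.
  by rewrite (perm_uniq pP) iota_uniq.
by exists (perm finj) => k; rewrite permE.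
Qed.

Lemma generator_matrixE (R : realType) (d : bool) (s t : 'S_4) p q :
  (forall k : 'I_4, nth 0%N p k = s k) -> (forall k : 'I_4, nth 0%N q k = t k) ->
  \matrix_(k, l) (if d then D0 R else G0 R) (s k) (t l) =
  \matrix_(k, l) if generator_table d p q k l then 4^-1 else 0.
Proof.
move=> ps qt; apply/matrixP => k l; rewrite !mxE /generator_table ps qt.
case: d; rewrite /D0 /G0 !mxE //.
by rewrite -val_eqE; case: (_ == _); rewrite ?mulr1 ?mulr0.
Qed.

Lemma plane_matrixE (R : realType) t (g : nat -> nat -> bool) :
  table (lagrangian t) = table g ->
  plane_matrix R t = \matrix_(k, l) if g k l then 4^-1 else 0.
Proof. by move=> /table_inj tg; apply/matrixP => k l; rewrite !mxE tg. Qed.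

Lemma perm_generatorP (R : realType) (M : 'M[R[i]]_4) :
  perm_generator M <-> exists2 t, t \in signed_matchings & M = plane_matrix R t.
Proof.
split=> [[s [t HM]]|[t tS ->]].
  have [d ->] : exists d, M = \matrix_(k, l) (if d then D0 R else G0 R) (s k) (t l).
    by case: HM => ->; [exists true|exists false].
  have [p pP ps] := perm_as_list s; have [q qP qt] := perm_as_list t.
  have : table (generator_table d p q) \in plane_tables.
    apply: (allP generator_tables_sub); apply/flatten_mapP; exists d; first by case: (d).
    exact: (allpairs_f (fun p q => table (generator_table d p q))).
  case/mapP => m mS Hm; exists m => //.
  by rewrite (generator_matrixE _ _ ps qt) (plane_matrixE _ (esym Hm)).
have : table (lagrangian t) \in generator_tables.
  by apply: (allP plane_tables_sub); apply: (map_f (fun t => table (lagrangian t))).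
case/flatten_mapP => d _ /allpairsP[[p q] /= [/list_as_perm[s ps] /list_as_perm[s' qs'] H]].
exists s, s'; rewrite (plane_matrixE _ H) -(generator_matrixE _ _ ps qs').
by case: d {H}; [left|right].
Qed.

(** * Separable states *)

Lemma prodAB_sum (R : realType) (I J : finType) (p : I -> R[i]) (q : J -> R[i])
    (X : I -> 'M[R[i]]_(2 * 2)) (Y : J -> 'M[R[i]]_(2 * 2)) :
  prodAB (\sum_i p i *: X i) (\sum_j q j *: Y j) =
  \sum_i \sum_j (p i * q j) *: prodAB (X i) (Y j).
Proof.
have D1 A B C : prodAB (A + B) C = prodAB A C + prodAB B C :> 'M[R[i]]_(2 * 2 * 2 * 2).
  apply/matrixP => i j; rewrite !mxE.
  by case: (unidx4 i) => [[[? ?] ?] ?]; case: (unidx4 j) => [[[? ?] ?] ?]; rewrite !mxE mulrDl.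
have D2 A B C : prodAB C (A + B) = prodAB C A + prodAB C B :> 'M[R[i]]_(2 * 2 * 2 * 2).
  apply/matrixP => i j; rewrite !mxE.
  by case: (unidx4 i) => [[[? ?] ?] ?]; case: (unidx4 j) => [[[? ?] ?] ?]; rewrite !mxE mulrDr.
have Z1 C : prodAB 0 C = 0 :> 'M[R[i]]_(2 * 2 * 2 * 2).
  by rewrite -(scale0r (0 : 'M[R[i]]_(2 * 2))) prodABZl scale0r.
have Z2 C : prodAB C 0 = 0 :> 'M[R[i]]_(2 * 2 * 2 * 2).
  by rewrite -(scale0r (0 : 'M[R[i]]_(2 * 2))) prodABZr scale0r.
rewrite (big_morph (fun A => prodAB A _) (fun A B => D1 A B _) (Z1 _)); apply: eq_bigr => i _.
rewrite (big_morph (fun A => prodAB _ A) (fun A B => D2 A B _) (Z2 _)); apply: eq_bigr => j _.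
by rewrite prodABZ.
Qed.

Definition bell_functional (R : realType) (c : 'I_4 * 'I_4 -> R) (rho : 'M[R[i]]_(2 * 2 * 2 * 2)) :=
  \sum_p (c p)%:C%C * bell_weight rho p.1 p.2.

Lemma bell_functional_sum (R : realType) c (I : finType) (w : I -> R[i])
    (A : I -> 'M[R[i]]_(2 * 2 * 2 * 2)) :
  bell_functional c (\sum_k w k *: A k) = \sum_k w k * bell_functional c (A k).
Proof.
rewrite /bell_functional; under [RHS]eq_bigr do rewrite mulr_sumr.
rewrite exchange_big; apply: eq_bigr => p _ /=.
rewrite /bell_weight mulmx_sumr raddf_sum mulr_sumr; apply: eq_bigr => k _ /=.
by rewrite -scalemxAr mxtraceZ mulrCA.
Qed.

(** A linear functional passes through the mixture and through the spectral decompositions of both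
    factors, so its sign is decided on pure products. *)
Lemma separable_functional (R : realType) (c : 'I_4 * 'I_4 -> R) rho :
  (forall t, t \in signed_matchings ->
     0 <= \sum_p c p * (if lagrangian t p.1 p.2 then 1 else 0)) ->
  separable_AB rho -> 0 <= bell_functional c rho.
Proof.
move=> cpos [n [w [X [Y [w0 _ XY ->]]]]].
rewrite bell_functional_sum; apply: sumr_ge0 => k _; apply: mulr_ge0 => //.
have [/density_pure[p [v [p0 vv ->]]] /density_pure[q [u [q0 uu ->]]]] := XY k.
(* The dummy coefficient 1 gives the outer sum the shape that [bell_functional_sum] expects. *)
rewrite prodAB_sum; have -> : \sum_i \sum_j (p i * q j) *:
    prodAB (v i *m adjmx (v i)) (u j *m adjmx (u j)) =
    \sum_i 1 *: \sum_j (p i * q j) *: pure_product (v i) (u j).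
  by apply: eq_bigr => i _; rewrite scale1r.
rewrite bell_functional_sum; apply: sumr_ge0 => i _; rewrite mul1r.
rewrite bell_functional_sum; apply: sumr_ge0 => j _; apply: mulr_ge0; first exact: mulr_ge0.
exact: lagrangian_separation.
Qed.

Lemma lagrangian_card :
  all (fun t => sumn (map (count id) (table (lagrangian t))) == 4%N) signed_matchings.
Proof. by vm_compute. Qed.

Lemma plane_matrix_sum (R : realType) t : t \in signed_matchings ->
  \sum_k \sum_l plane_matrix R t k l = 1.
Proof.
move=> /(allP lagrangian_card)/eqP card4.
have -> : \sum_k \sum_l plane_matrix R t k l =
    4^-1 * (\sum_(k < 4) \sum_(l < 4) lagrangian t k l)%:R.
  rewrite natr_sum mulr_sumr; apply: eq_bigr => k _.
  rewrite natr_sum mulr_sumr; apply: eq_bigr => l _.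
  by rewrite mxE; case: lagrangian; rewrite ?mulr1 ?mulr0.
have -> : (\sum_(k < 4) \sum_(l < 4) lagrangian t k l = 4)%N.
  by apply: etrans card4; rewrite !big_ord_recl !big_ord0.
by rewrite mulVf // pnatr_eq0.
Qed.

Lemma separable_hull (R : realType) rho : in_varrho rho -> separable_AB rho ->
  in_hull (\matrix_(k, l) bell_weight rho k l : 'M[R[i]]_4).
Proof.
move=> Hrho Hsep.
(* Farkas' lemma is applied over the ordered field [R], so the weights, being nonnegative, are
   replaced by their real parts. *)
have realE k l : bell_weight rho k l = (complex.Re (bell_weight rho k l))%:C%C.
  by rewrite RRe_real // ger0_real // bell_weight_ge0.
pose m := size signed_matchings; pose t (i : 'I_m) := nth [::] signed_matchings i.
have tS i : t i \in signed_matchings by rewrite mem_nth.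
pose v i (p : 'I_4 * 'I_4) : R := if lagrangian (t i) p.1 p.2 then 1 else 0.
(* The generators are the indicators of the planes. A separating functional would be nonnegative on
   all planes yet negative on a separable state. *)
have [[c c0 cE]|[c cpos cneg]] :=
    farkas_alternative v (fun p => complex.Re (bell_weight rho p.1 p.2)); last first.
  have : 0 <= bell_functional c rho.
    apply: separable_functional Hsep => s /(nthP [::])[i im <-].
    exact: (cpos (Ordinal im)).
  rewrite /bell_functional; under eq_bigr do rewrite realE -rmorphM.
  by rewrite -rmorph_sum -[0]/((0 : R)%:C%C) lecR leNgt cneg.
(* The factor 4 compensates for the entries 1/4 of [plane_matrix] where [v] has 1. *)
have rE : (\matrix_(k, l) bell_weight rho k l) =
    \sum_i (4 * c i)%:C%C *: plane_matrix R (t i).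
  apply/matrixP => k l; rewrite mxE summxE realE (cE (k, l)) rmorph_sum.
  apply: eq_bigr => i _; rewrite !mxE /v /= rmorphM /= (rmorphM _ 4) /= rmorph_nat.
  by case: ifP => _; rewrite ?rmorph1 ?rmorph0 ?mulr0 // mulr1 mulrAC divff ?mul1r // pnatr_eq0.
exists m, (fun i => (4 * c i)%:C%C), (fun i => plane_matrix R (t i)); split=> // [i||i].
- by rewrite -[0]/((0 : R)%:C%C) lecR mulr_ge0.
(* The weights sum to 1 by comparing total mass: it is 1 for [rho] and for every plane matrix. *)
- rewrite -(bell_weight_sum Hrho).
  transitivity (\sum_k \sum_l (\matrix_(k, l) bell_weight rho k l) k l); last first.
    by apply: eq_bigr => k _; apply: eq_bigr => l _; rewrite mxE.
  rewrite rE; under [RHS]eq_bigr do under eq_bigr do rewrite summxE.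
  under [RHS]eq_bigr do rewrite exchange_big.
  rewrite exchange_big; apply: eq_bigr => i _ /=.
  under [RHS]eq_bigr do under eq_bigr do rewrite scalemxE.
  under [RHS]eq_bigr do rewrite -mulr_sumr.
  by rewrite -mulr_sumr plane_matrix_sum ?mulr1.
by apply/perm_generatorP; exists (t i).
Qed.

Lemma bell_state_sum (R : realType) (I : finType) (w : I -> R[i]) (M : I -> 'M[R[i]]_4) :
  bell_state (\sum_i w i *: M i) = \sum_i w i *: bell_state (M i).
Proof.
rewrite bell_stateE; under [RHS]eq_bigr do rewrite bell_stateE scaler_sumr.
rewrite [RHS]exchange_big; apply: eq_bigr => k _ /=.
under [RHS]eq_bigr do rewrite scaler_sumr.
rewrite [RHS]exchange_big; apply: eq_bigr => l _ /=.
rewrite summxE scaler_suml; apply: eq_bigr => i _.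
by rewrite scalemxE scalerA.
Qed.

Lemma Ps_separable (R : realType) (rho : 'M[R[i]]_(2 * 2 * 2 * 2)) :
  in_Ps rho -> separable_AB rho.
Proof.
case=> [[[_ _ tr1] _] [r [rhoE [n [w [M [w0 _ Mgen rE]]]]]]].
apply: conic_separable_trace1 => //; rewrite rhoE rE bell_state_sum.
apply: conic_separable_sum => i; apply: conic_separableZ => //.
by have /perm_generatorP[t tS ->] := Mgen i; apply: plane_separable.
Qed.

Theorem theorem1 (R : realType) :
  (forall rho : 'M[R[i]]_(2 * 2 * 2 * 2), in_varrho rho ->
     exists! r : 'M[R[i]]_4,
       [/\ forall i j, 0 <= r i j,
           \sum_(i < 4) \sum_(j < 4) r i j = 1
         & rho = bell_state r]) /\
  (forall rho : 'M[R[i]]_(2 * 2 * 2 * 2), in_varrho rho ->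
     (separable_AB rho <-> in_Ps rho)).
Proof.
split=> rho Hrho.
  exists (\matrix_(k, l) bell_weight rho k l); split=> [|r [_ _ rhoE]].
    split=> [k l||]; [by rewrite mxE bell_weight_ge0| |exact: varrho_bell_state].
    by under eq_bigr do under eq_bigr do rewrite mxE; rewrite bell_weight_sum.
  (* Uniqueness: orthogonality of the Bell pairs lets [bell_weight] read off the coefficients of any
     expansion. *)
  by apply/matrixP => k l; rewrite mxE rhoE bell_weight_state.
split=> [Hsep|]; last exact: Ps_separable.
split=> //; exists (\matrix_(k, l) bell_weight rho k l); split; first exact: varrho_bell_state.
exact: separable_hull.
Qed.
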